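(* Let $\mathcal O_1\subset\mathbb R^2$ be an open neighbourhood of $(0,0)$, let $u:\mathcal O_1\to sl(n)_a^\perp$ be a local solution of the $j$-th flow in the $sl(n,\mathbb C)$-hierarchy defined by $b$, let $E$ be its trivialization, and assume that $m$ is a local reduced wave function for $u$. Let $h_{\alpha_1,\alpha_2,\pi}$ be a simple element, and let $V_1,V_2$ be the images of $\pi$ and $I-\pi$. Put $\tilde V_i(x,t)=E(x,t,\alpha_i)^{-1}(V_i)$ for $i=1,2$. Then there is an open subset $\mathcal O\subset\mathcal O_1$ containing $(0,0)$ such that $\tilde V_1(x,t)\cap\tilde V_2(x,t)=0$ for all $(x,t)\in\mathcal O$. Moreover, let $\tilde\pi(x,t)$ denote the projection of $\mathbb C^n$ onto $\tilde V_1(x,t)$ along the decomposition $\mathbb C^n=\tilde V_1(x,t)\oplus\tilde V_2(x,t)$. Then: (i) $\tilde u:\mathcal O\to sl(n)_a^\perp$, $\tilde u=u+(\alpha_1-\alpha_2)[a,\tilde\pi]$, is a solution of the $j$-th flow, with trivialization $\tilde E$ and local reduced wave function $\tilde m$, where $$\tilde E(x,t,\lambda)=h_{\alpha_1,\alpha_2,\pi}(\lambda)E(x,t,\lambda)h_{\alpha_1,\alpha_2,\tilde\pi(x,t)}(\lambda)^{-1},\qquad \tilde m(x,t,\lambda)=m(x,t,\lambda)h_{\alpha_1,\alpha_2,\tilde\pi(x,t)}(\lambda)^{-1}.$$ (ii) $\tilde\pi$ is the solution of $$\begin{cases}\tilde\pi_x=-[u,\tilde\pi]-[a,\tilde\pi]\,(\alpha_2+(\alpha_1-\alpha_2)\tilde\pi),\\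 \tilde\pi_t=-\sum_{k=0}^j[Q_{b,j-k}(u),\tilde\pi]\,(\alpha_2+(\alpha_1-\alpha_2)\tilde\pi)^k,\\ \tilde\pi^2=\tilde\pi,\quad\tilde\pi(0,0)=\pi.\end{cases}$$
   Context: Fix a nonzero diagonal matrix $a=\mathrm{diag}(a_1,\dots,a_n)\in sl(n,\mathbb C)$, a matrix $b$ that is a polynomial in $a$, and an integer $j\ge1$. $sl(n)_a=\{y\in sl(n,\mathbb C):[a,y]=0\}$ and $sl(n)_a^\perp$ is its orthogonal complement in $sl(n,\mathbb C)$ for the form $(y_1,y_2)\mapsto\mathrm{tr}(y_1y_2)$. $\Gamma_a=\{\lambda\in\mathbb C:\mathrm{Re}(\lambda(a_i-a_k))=0\text{ for some }i<k\text{ with }a_i\ne a_k\}$. For smooth $u$ with values in $sl(n)_a^\perp$: $Q_{b,0}(u)=b$, and $Q_{b,k}(u)$, $k\ge1$, are the unique matrix-valued polynomials without constant term in the entries of $u$ and their $x$-derivatives such that $(Q_{b,k}(u))_x+[u,Q_{b,k}(u)]=[Q_{b,k+1}(u),a]$ for all $k\ge0$. The $j$-th flow defined by $b$ is $u_t=(Q_{b,j}(u))_x+[u,Q_{b,j}(u)]=[Q_{b,j+1}(u),a]$. The trivialization of a solution $u$ (near $(0,0)$) is the solution $E(x,t,\lambda)$, holomorphic in $\lambda\in\mathbb C$, of $E_x=E(a\lambda+u)$, $E_t=E(b\lambda^j+Q_{b,1}(u)\lambda^{j-1}+\dots+Q_{b,j}(u))$, $E(0,0,\lambda)=I$. A local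 reduced wave function for a solution $u$ is a smooth $GL(n,\mathbb C)$-valued function $m(x,t,\lambda)$ (defined away from its poles), meromorphic in $\lambda\in\mathbb C\setminus\Gamma_a$, with an asymptotic expansion $m\sim I+m_1(x,t)\lambda^{-1}+m_2(x,t)\lambda^{-2}+\cdots$ at $\lambda=\infty$, with $u=[a,m_1]$, and such that $m(0,0,\lambda)^{-1}e^{a\lambda x+b\lambda^jt}m(x,t,\lambda)$ equals $E(x,t,\lambda)$ (and so is holomorphic in $\lambda\in\mathbb C$). For $\alpha_1,\alpha_2\in\mathbb C$ and a complex linear projection $\pi$ of $\mathbb C^n$ ($\pi^2=\pi$, not necessarily Hermitian), the simple element is $h_{\alpha_1,\alpha_2,\pi}(\lambda)=I+\frac{\alpha_1-\alpha_2}{\lambda-\alpha_1}(I-\pi)$. *)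

(* Defs.v *)
(* MathComp world, over an abstract [R : realType], with the complex numbers
   [R[i]] of mathcomp-real-closed. *)
From HB Require Import structures.
From mathcomp Require Import all_boot all_order all_algebra.
From mathcomp Require Import all_classical all_reals all_analysis.
From mathcomp Require Import complex finmap.
(* The notations of monalg are incompatible with those of mathcomp-analysis. *)
From mathcomp Require Import -(notations) monalg.

Set Implicit Arguments.
Unset Strict Implicit.
Unset Printing Implicit Defensive.

Import Order.TTheory GRing.Theory Num.Theory.
Import numFieldNormedType.Exports.

Local Open Scope classical_set_scope.
Local Open Scope complex_scope.
Local Open Scope ring_scope.

Section RealCalculus.
Context (R : realType) (V : normedModType R).
Local Notation C := R[i].

(* C^oo on an open set [U]: the iterated directional derivatives of all orders
   exist on [U] and are differentiable there. *)
Definition smooth_on (U : set V) (f : V -> R) : Prop :=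
  forall (s : seq V) (p : V), U p ->
    differentiable (foldr (fun v g => 'D_v g) f s) p.

(* [R[i]] is a normed space over itself but not over [R] in the library, so
   real-variable calculus goes through real and imaginary parts. *)
Definition csmooth_on (U : set V) (f : V -> C) : Prop :=
  smooth_on U (fun p => complex.Re (f p)) /\
  smooth_on U (fun p => complex.Im (f p)).

Definition cderive (v : V) (f : V -> C) : V -> C :=
  fun p => 'D_v (fun q => complex.Re (f q)) p
           +i* 'D_v (fun q => complex.Im (f q)) p.

Definition mxsmooth_on n (U : set V) (F : V -> 'M[C]_n) : Prop :=
  forall i k, csmooth_on U (fun p => F p i k).

Definition mxderive n (v : V) (F : V -> 'M[C]_n) : V -> 'M[C]_n :=
  fun p => \matrix_(i, k) cderive v (fun q => F q i k) p.

End RealCalculus.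

Section Hierarchy.
Context (R : realType) (n : nat).
Local Notation C := R[i].
Local Notation M := 'M[R[i]]_n.+1.

(* Points of the plane are pairs (x, t); matrices have size [n.+1], so that all
   sizes at least 1 are covered. *)
Definition Dx (F : R * R -> M) : R * R -> M := mxderive ((1, 0) : R * R) F.
Definition Dt (F : R * R -> M) : R * R -> M := mxderive ((0, 1) : R * R) F.

Definition bracket (A B : M) : M := A *m B - B *m A.

Definition sl (y : M) : Prop := \tr y = 0.

Definition sl_cent (a y : M) : Prop := sl y /\ bracket a y = 0.

Definition sl_perp (a y : M) : Prop :=
  sl y /\ forall z, sl_cent a z -> \tr (y *m z) = 0.

(* Polynomials in countably many variables: the variable (i, k, r) stands for
   the r-th x-derivative of the entry (i, k) of u. *)
Definition diffpoly : Type := malg (cmonom ('I_n.+1 * 'I_n.+1 * nat)%type) C.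

Definition diffpoly_eval (q : diffpoly) (v : 'I_n.+1 * 'I_n.+1 * nat -> C) : C :=
  mmap (idfun : C -> C)
    (fun m : cmonom ('I_n.+1 * 'I_n.+1 * nat)%type =>
       \prod_(i <- finsupp m) v i ^+ m i) q.

Definition constant_term (q : diffpoly) : C := mcoeff one q.

Definition xjet (u : R * R -> M) (p : R * R) : 'I_n.+1 * 'I_n.+1 * nat -> C :=
  fun i => iter i.2 (cderive ((1, 0) : R * R)) (fun q => u q i.1.1 i.1.2) p.

(* The matrix-valued differential polynomial [q] applied to [u]. *)
Definition mxdp (q : 'M[diffpoly]_n.+1) (u : R * R -> M) : R * R -> M :=
  fun p => \matrix_(i, k) diffpoly_eval (q i k) (xjet u p).

(* [Q k] is Q_{b,k}.  Two families with this property agree on every smooth [u]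
   with values in [sl_perp a].  The variable t is a parameter in the recursion. *)
Definition is_Q (a b : M) (Q : nat -> 'M[diffpoly]_n.+1) : Prop :=
  (forall k i l, (0 < k)%N -> constant_term (Q k i l) = 0) /\
  (forall (U : set (R * R)) (u : R * R -> M),
     open U -> mxsmooth_on U u -> (forall p, U p -> sl_perp a (u p)) ->
     forall p, U p ->
       mxdp (Q 0%N) u p = b /\
       forall k, Dx (mxdp (Q k) u) p + bracket (u p) (mxdp (Q k) u p)
                 = bracket (mxdp (Q k.+1) u p) a).

Definition flow_solution (a : M) (Q : nat -> 'M[diffpoly]_n.+1) (j : nat)
    (O : set (R * R)) (u : R * R -> M) : Prop :=
  [/\ mxsmooth_on O u,
      forall p, O p -> sl_perp a (u p) &
      forall p, O p ->
        Dt u p = Dx (mxdp (Q j) u) p + bracket (u p) (mxdp (Q j) u p)].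

Definition holomorphic_at (f : C -> C) (z : C) : Prop :=
  derivable (f : C^o -> C^o) z 1.

Definition trivialization (a : M) (Q : nat -> 'M[diffpoly]_n.+1) (j : nat)
    (O : set (R * R)) (u : R * R -> M) (E : R * R -> C -> M) : Prop :=
  [/\ forall lam, mxsmooth_on O (fun p => E p lam),
      forall p, O p -> forall i k lam,
        holomorphic_at (fun z => E p z i k) lam,
      forall p lam, O p ->
        Dx (fun q => E q lam) p = E p lam *m (lam *: a + u p),
      forall p lam, O p ->
        Dt (fun q => E q lam) p =
        E p lam *m \sum_(k < j.+1) lam ^+ (j - k) *: mxdp (Q k) u p &
      forall lam, E (0, 0) lam = 1%:M].

Definition Gamma (a : M) : set C :=
  [set lam | exists i k : 'I_n.+1,
     [/\ (i < k)%N, a i i != a k k &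
         complex.Re (lam * (a i i - a k k)) = 0]].

(* [f] is meromorphic on the open set [U], with poles in [P]; the values of [f]
   at the points of [P] are irrelevant, and [P] may contain removable
   singularities. *)
Definition meromorphic_on (U P : set C) (f : C -> C) : Prop :=
  (forall z, U z -> ~ P z -> holomorphic_at f z) /\
  (forall z, U z -> P z -> exists (k : nat) (g : C -> C),
     (\forall w \near (z : C^o), holomorphic_at g w) /\
     (\forall w \near ((z : C^o)^'), ~ P w /\ (w - z) ^+ k * f w = g w)).

Definition mxexp (A : M) : M :=
  \matrix_(i, k) limn (series (fun r : nat => ((r`!%:R^-1 *: A ^+ r) i k : C^o))).

Definition to_complex (q : R * R) : C := q.1 +i* q.2.

(* The asymptotic expansion m ~ \sum_k mk k lam^-k as lam -> oo inside
   [C \ Gamma a], at the point [p] of the plane: after the terms of index < N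
   the remainder is O(lam^-N). *)
Definition asymptotic_at (a : M) (P : set C) (f : C -> M) (c : nat -> M) : Prop :=
  forall N : nat, exists K r : R, forall lam : C,
    ~ Gamma a lam -> ~ P lam -> r%:C <= `|lam| ->
    forall i k,
      `| (f lam - \sum_(s < N) lam ^- s *: c s) i k | <= K%:C * `|lam| ^- N.

(* The set [P p] contains the "poles" of [m p]: being GL-valued, [m] is singular
   where [m] or its inverse fails to be holomorphic. *)
Definition reduced_wave_function (a b : M) (j : nat) (O : set (R * R))
    (u : R * R -> M) (E : R * R -> C -> M) (m : R * R -> C -> M) : Prop :=
  exists P : R * R -> set C,
    let D := [set w : (R * R) * (R * R) |
                [/\ O w.1, ~ Gamma a (to_complex w.2)
                  & ~ P w.1 (to_complex w.2)]] in
    [/\ open D /\ mxsmooth_on D (fun w => m w.1 (to_complex w.2)),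
        forall p lam, O p -> ~ Gamma a lam -> ~ P p lam -> m p lam \in unitmx,
        forall p, O p -> forall i k,
          meromorphic_on (~` Gamma a) (P p) (fun lam => m p lam i k),
        exists mk : nat -> R * R -> M, forall p, O p ->
          [/\ mk 0%N p = 1%:M,
              asymptotic_at a (P p) (m p) (fun k => mk k p) &
              u p = bracket a (mk 1%N p)] &
        forall p lam, O p -> ~ Gamma a lam -> ~ P (0, 0) lam -> ~ P p lam ->
          invmx (m (0, 0) lam)
            *m mxexp ((lam * p.1%:C) *: a + (lam ^+ j * p.2%:C) *: b)
            *m m p lam = E p lam].

Definition simple_element (al1 al2 : C) (pi : M) (lam : C) : M :=
  1%:M + ((al1 - al2) / (lam - al1)) *: (1%:M - pi).

(* Matrices act on column vectors here, whereas the library represents subspaces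
   by row spaces: a subspace V of C^n is represented by a matrix
   whose row space is the set of the transposes of the vectors of V. *)
Definition column_space (A : M) : M := A^T.
Definition map_subspace (g V : M) : M := V *m g^T.
Definition projection_on_along (V W : M) : M := (proj_mx V W)^T.

Definition projection_system (a : M) (Q : nat -> 'M[diffpoly]_n.+1) (j : nat)
    (O : set (R * R)) (u : R * R -> M) (al1 al2 : C) (pi : M)
    (f : R * R -> M) : Prop :=
  let A p := al2%:M + (al1 - al2) *: f p in
  [/\ mxsmooth_on O f,
      forall p, O p ->
        Dx f p = - bracket (u p) (f p) - bracket a (f p) *m A p,
      forall p, O p ->
        Dt f p =
        - \sum_(k < j.+1) bracket (mxdp (Q (j - k)%N) u p) (f p) *m A p ^+ k,
      forall p, O p -> f p *m f p = f p &
      f (0, 0) = pi].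

End Hierarchy.

(* Main.v *)
Require Import Defs.
From HB Require Import structures.
From mathcomp Require Import all_boot all_order all_algebra.
From mathcomp Require Import all_classical all_reals all_analysis.
From mathcomp Require Import complex finmap ring lra.
From mathcomp Require Import -(notations) monalg.
Import Order.TTheory GRing.Theory Num.Theory.
Import numFieldNormedType.Exports.
Set Implicit Arguments.
Unset Strict Implicit.
Unset Printing Implicit Defensive.
Local Open Scope classical_set_scope.
Local Open Scope complex_scope.
Local Open Scope ring_scope.

(** The theorem is a dressing (Baecklund) transformation.  Write
    [d = al1 - al2], [B lam = \sum_k lam ^ (j - k) Q_k u] and let
    [S = E1^-1 pi + E2^-1 (1 - pi)], where [Ei] is [E] at [al_i].  At the origin
    [S = 1], so [S] is invertible on a small ball, where [tpi = S pi S^-1] is the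
    projection of the statement.  Put [A = al2 + d tpi]; then the simple element
    of [tpi] is [(lam - A) / (lam - al1)].

    - The two linear systems for [E] say that [S' = - T S] in both directions,
      where [T] is the right value of the connection polynomial at [A]
      ([u + a A] for [x], [\sum_k Q_(j-k) A^k] for [t]); hence [tpi' = [tpi, T]],
      which is the differential system of part (ii) ([dressed_proj_derive]).
      Conversely, for any solution [f] of that system, [(1 - pi) E1 f] and
      [pi E2 (1 - f)] solve linear systems with zero initial value, so they
      vanish, and this forces [f = tpi] ([dressed_proj_unique]).

    - The apparent poles of [tE = h E h~^-1] at [al1] and [al2] cancel.  In
      [dressed_triv] the quotients [(E lam - Ei) / (lam - al_i)] appear, and one
      has to know that their values at [al_i] are smooth in [(x, t)] and that
      they are holomorphic at [al_i].  Since [E] is only assumed smooth for each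
      [lam] and holomorphic for each point, this is read off the linear systems
      by Gronwall's inequality and a second order expansion
      ([family_second_order], [divided_difference]).  Right division by
      [lam - A] turns [B = T + D (lam - A)] into [T + (lam - A) D], which is the
      connection polynomial of [tE] ([dressed_triv_derive]).

    - The coefficients of [T + (lam - A) D] are the matrices [P_k] with
      [P (lam - A) = (lam - A) \sum_k Q_k lam^-k].  That they are the
      [Q_k] evaluated at [tu] follows from [Q_unique]: a solution of the
      recursion that starts with [b] is determined if it is also annihilated by
      the minimal polynomial of [b], for the first coefficient where two
      solutions differ commutes with [a], hence with [b], and this polynomial is
      separable.  The series of the [Q_k] is annihilated ([root_prod_Q])
      because the coefficients of its polynomial have zero [x]-derivative and
      [u] can be cut off to zero along the [x]-direction; conjugation by
      [lam - A] preserves the property.  The flow equation for [tu] is then the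
      coefficient of [lam^-1] in the same conjugation.

    - For the wave function, [tm (lam - A) = (lam - al1) m] gives the expansion
      of [tm] recursively ([asymptotic_dressing]); the points [al1] and [al2]
      join the poles ([dressed_wave_function]). *)

(** * Smooth real functions on an open set *)

Section Differentiability.
Context (R : realType) (V : normedModType R).

Lemma differentiable_bound (f : V -> R) p (df : {linear V -> R}) :
  continuous df ->
  (forall e, 0 < e -> \forall h \near (0 : V),
     `|f (h + p) - f p - df h| <= e * `|h|) ->
  differentiable f p /\ 'd f p = df :> (V -> R).
Proof.
move=> cdf fdf.
have E : f \o shift p = cst (f p) + df +o_ (0 : V) id.
  apply/eqaddoP => e e0; near=> h; rewrite /= /shift /=.
  by rewrite !fctE opprD addrA; near: h; apply: fdf.
have dE := diff_unique cdf E; split=> //.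
by apply/diff_locallyP; rewrite dE.
Unshelve. all: by end_near. Qed.

Lemma differentiable_le (f : V -> R) p : differentiable f p ->
  forall e, 0 < e -> \forall h \near (0 : V),
     `|f (h + p) - f p - 'd f p h| <= e * `|h|.
Proof.
move=> /diff_locally /eqaddoP dfo e e0; near=> h.
have /= : `|(f \o shift p - (cst (f p) + 'd f p)) h| <= e * `|id h|.
  by near: h; apply: dfo.
by rewrite !fctE /= opprD addrA.
Unshelve. all: by end_near. Qed.

Lemma diff_deriveD (f g : V -> R) p v : differentiable f p -> differentiable g p ->
  'D_v (fun q => f q + g q) p = 'D_v f p + 'D_v g p.
Proof. by move=> df dg; exact: deriveD (diff_derivable df) (diff_derivable dg). Qed.

Lemma diff_deriveB (f g : V -> R) p v : differentiable f p -> differentiable g p ->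
  'D_v (fun q => f q - g q) p = 'D_v f p - 'D_v g p.
Proof. by move=> df dg; exact: deriveB (diff_derivable df) (diff_derivable dg). Qed.

Lemma diff_deriveM (f g : V -> R) p v : differentiable f p -> differentiable g p ->
  'D_v (fun q => f q * g q) p = f p * 'D_v g p + g p * 'D_v f p.
Proof. by move=> df dg; exact: deriveM (diff_derivable df) (diff_derivable dg). Qed.

Lemma near_shift_open (U : set V) p : open U -> U p ->
  \forall h \near (0 : V), U (h + p).
Proof.
move=> oU Up; have : nbhs p U by apply: open_nbhs_nbhs.
by have := near_shift 0 p U; rewrite subr0 => E; rewrite -[nbhs p U]/(\near p, U p) E.
Qed.

End Differentiability.

Section RealSmooth.
Context (R : realType) (V : normedModType R) (U : set V).
Hypothesis oU : open U.
Implicit Types f g : V -> R.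

Lemma smooth_on_differentiable f p : smooth_on U f -> U p -> differentiable f p.
Proof. by move=> /(_ [::]); apply. Qed.

Lemma smooth_on_derive v f : smooth_on U f -> smooth_on U ('D_v f).
Proof. by move=> fs s p Up; have := fs (rcons s v) p Up; rewrite foldr_rcons. Qed.

(** Differentiability to a finite order: the product and quotient rules lower
    the order by one, so closure properties go by induction on it. *)
Fixpoint smooth_upto k f : Prop :=
  (forall p, U p -> differentiable f p) /\
  (if k is k'.+1 then forall v, smooth_upto k' ('D_v f) else True).

Lemma smooth_onP f : smooth_on U f <-> forall k, smooth_upto k f.
Proof.
split=> [fs k|fC s].
  elim: k f fs => [|k IH] f fs.
    by split=> // p Up; apply: smooth_on_differentiable.
  split=> [p Up|v]; first exact: smooth_on_differentiable.
  exact/IH/smooth_on_derive.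
have: smooth_upto (size s) f by [].
elim/last_ind: s f {fC} => [|s v IH] f; first by case.
by rewrite size_rcons foldr_rcons => -[_ /(_ v)]; apply: IH.
Qed.

Lemma smooth_uptoW k f : smooth_upto k.+1 f -> smooth_upto k f.
Proof. by elim: k f => [|k IH] f [? fC]; split=> //= v; apply/IH/fC. Qed.

Lemma smooth_upto_differentiable k f p : smooth_upto k f -> U p -> differentiable f p.
Proof. by case: k => [|k] [+ _]; apply. Qed.

Lemma near_open p : U p -> \forall q \near p, U q.
Proof. by move=> Up; exact: open_nbhs_nbhs. Qed.

Lemma eq_on_derive v f g : {in U, f =1 g} -> {in U, 'D_v f =1 'D_v g}.
Proof.
move=> fg p /set_mem Up; apply: near_eq_derive.
by near=> q; apply/fg/mem_set; near: q; apply: near_open.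
Unshelve. all: by end_near. Qed.

Lemma eq_on_differentiable f g p : {in U, f =1 g} -> U p ->
  differentiable f p -> differentiable g p.
Proof.
move=> fg Up df.
suff [] : differentiable g p /\ 'd g p = 'd f p :> (V -> R) by [].
apply: differentiable_bound => [|e e0]; first exact: diff_continuous.
 have := differentiable_le df e0 => dfe; near=> h.
have Uh : U (h + p) by near: h; exact: near_shift_open.
rewrite -!fg; [by near: h|exact: mem_set|exact: mem_set].
Unshelve. all: by end_near. Qed.

Lemma eq_on_smooth_upto k f g : {in U, f =1 g} -> smooth_upto k f -> smooth_upto k g.
Proof.
elim: k f g => [|k IH] f g fg [df fC].
  by split=> // p Up; exact: (eq_on_differentiable fg Up (df p Up)).
split=> [p Up|v]; first exact: (eq_on_differentiable fg Up (df p Up)).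
exact: (IH _ _ (eq_on_derive v fg) (fC v)).
Qed.

Lemma smooth_upto_cst k c : smooth_upto k (cst c).
Proof.
elim: k c => [|k IH] c; first by split.
split=> //= v; suff -> : 'D_v (cst c) = cst 0 by apply: IH.
by apply/funext => x; rewrite derive_cst.
Qed.

Lemma smooth_uptoD k f g : smooth_upto k f -> smooth_upto k g -> smooth_upto k (f + g).
Proof.
elim: k f g => [|k IH] f g fC gC.
  by split=> // p Up; exact: differentiableD (smooth_upto_differentiable fC Up) (smooth_upto_differentiable gC Up).
split=> [p Up|v]; first by exact: differentiableD (smooth_upto_differentiable fC Up) (smooth_upto_differentiable gC Up).
case: fC gC => [df fC] [dg gC].
apply: eq_on_smooth_upto (IH _ _ (fC v) (gC v)) => p /set_mem Up /=.
by rewrite deriveD//; apply: diff_derivable; [exact: df|exact: dg].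
Qed.

Lemma smooth_uptoM k f g : smooth_upto k f -> smooth_upto k g -> smooth_upto k (f * g).
Proof.
elim: k f g => [|k IH] f g fC gC.
  by split=> // p Up; exact: differentiableM (smooth_upto_differentiable fC Up) (smooth_upto_differentiable gC Up).
split=> [p Up|v]; first by exact: differentiableM (smooth_upto_differentiable fC Up) (smooth_upto_differentiable gC Up).
have [fC' gC'] := (smooth_uptoW fC, smooth_uptoW gC).
case: fC gC => [df fC] [dg gC].
apply: eq_on_smooth_upto (smooth_uptoD (IH _ _ fC' (gC v)) (IH _ _ gC' (fC v))) => p /set_mem Up /=.
by rewrite deriveM//; apply: diff_derivable; [exact: df|exact: dg].
Qed.

Lemma smooth_uptoV k f : {in U, forall p, f p != 0} -> smooth_upto k f -> smooth_upto k (fun p => (f p)^-1).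
Proof.
move=> f0; elim: k f f0 => [|k IH] f f0 fC.
  by split=> // p Up; apply: differentiableV; [exact: smooth_upto_differentiable fC Up|exact/f0/mem_set].
split=> [p Up|v]; first by apply: differentiableV; [exact: smooth_upto_differentiable fC Up|exact/f0/mem_set].
have fC' := IH _ f0 (smooth_uptoW fC); case: fC => df fC.
apply: eq_on_smooth_upto (smooth_uptoM (smooth_upto_cst k (-1)) (smooth_uptoM (smooth_uptoM fC' fC') (fC v))) => p pU /=.
rewrite deriveV ?f0//; last exact/diff_derivable/df/set_mem.
by rewrite !fctE /= mulN1r scaleNr -[_ *: _]/(_ * _) expr2 invfM.
Qed.

Lemma smooth_on_cst c : smooth_on U (cst c).
Proof. by apply/smooth_onP => k; apply: smooth_upto_cst. Qed.

Lemma smooth_onD f g : smooth_on U f -> smooth_on U g -> smooth_on U (f + g).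
Proof. by move=> /smooth_onP fs /smooth_onP gs; apply/smooth_onP => k; apply: smooth_uptoD. Qed.

Lemma smooth_onM f g : smooth_on U f -> smooth_on U g -> smooth_on U (f * g).
Proof. by move=> /smooth_onP fs /smooth_onP gs; apply/smooth_onP => k; apply: smooth_uptoM. Qed.

Lemma smooth_onN f : smooth_on U f -> smooth_on U (fun p => - f p).
Proof.
move=> fs; rewrite (_ : (fun p => _) = cst (-1) * f).
  by apply: smooth_onM => //; apply: smooth_on_cst.
by apply/funext => p /=; rewrite mulN1r.
Qed.

Lemma smooth_onV f : {in U, forall p, f p != 0} -> smooth_on U f ->
  smooth_on U (fun p => (f p)^-1).
Proof. by move=> f0 /smooth_onP fs; apply/smooth_onP => k; apply: smooth_uptoV. Qed.

Lemma eq_smooth_on f g : {in U, f =1 g} -> smooth_on U f -> smooth_on U g.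
Proof. by move=> fg /smooth_onP fs; apply/smooth_onP => k; apply: eq_on_smooth_upto (fs k). Qed.

(** A function whose directional derivatives are given by smooth functions is
    smooth. *)
Lemma smooth_on_of_derive f : (forall p, U p -> differentiable f p) ->
  (forall v, smooth_on U ('D_v f)) -> smooth_on U f.
Proof.
move=> df fs; apply/smooth_onP => -[|k]; split=> // v.
by have /smooth_onP := fs v; apply.
Qed.

Lemma smooth_on_linear (l : {linear V -> R}) : continuous l -> smooth_on U l.
Proof.
move=> cl; apply: smooth_on_of_derive => [p _|v].
  exact: linear_differentiable.
rewrite (_ : 'D_v l = cst (l v)); first exact: smooth_on_cst.
apply/funext => p; rewrite deriveE; last exact: linear_differentiable.
by rewrite diff_lin.
Qed.

End RealSmooth.

Lemma smooth_on_sub (R : realType) (V : normedModType R) (U U' : set V) (f : V -> R) :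
  U' `<=` U -> smooth_on U f -> smooth_on U' f.
Proof. by move=> sU fs s p /sU; apply: fs. Qed.

Lemma smooth_on_comp_linear (R : realType) (V W : normedModType R) (U : set V)
    (U' : set W) (l : {linear V -> W}) (f : W -> R) :
  open U -> open U' -> continuous l -> (forall p, U p -> U' (l p)) ->
  smooth_on U' f -> smooth_on U (f \o l).
Proof.
move=> oU oU' cl UU' /smooth_onP fs; apply/smooth_onP => // k.
have {fs} := fs k; elim: k f => [|k IH] f fC.
  split=> // p Up; apply: differentiable_comp; first exact: linear_differentiable.
  exact: smooth_upto_differentiable fC (UU' _ Up).
have dl p : U p -> differentiable (f \o l) p.
  move=> Up; apply: differentiable_comp; first exact: linear_differentiable.
  exact: smooth_upto_differentiable fC (UU' _ Up).
split=> [p Up|v]; first exact: dl.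
have := IH _ (fC.2 (l v)); apply: eq_on_smooth_upto => // p /set_mem Up /=.
rewrite !deriveE; [|exact: dl|exact: smooth_upto_differentiable fC (UU' _ Up)].
have dfl := smooth_upto_differentiable fC (UU' _ Up).
have ll : differentiable l p by exact: linear_differentiable.
by rewrite (diff_comp ll dfl) /= diff_lin.
Qed.

(** * Smooth functions with complex and matrix values *)

Section ComplexParts.
Context (R : realType).
Implicit Types x y : R[i].

Lemma complexReM x y : complex.Re (x * y) =
  complex.Re x * complex.Re y - complex.Im x * complex.Im y.
Proof. by case: x y => [a b] [c d]. Qed.

Lemma complexImM x y : complex.Im (x * y) =
  complex.Re x * complex.Im y + complex.Im x * complex.Re y.
Proof. by case: x y => [a b] [c d]. Qed.

Lemma complexReD x y : complex.Re (x + y) = complex.Re x + complex.Re y.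
Proof. by case: x y => [a b] [c d]. Qed.

Lemma complexImD x y : complex.Im (x + y) = complex.Im x + complex.Im y.
Proof. by case: x y => [a b] [c d]. Qed.

Lemma complexReN x : complex.Re (- x) = - complex.Re x.
Proof. by case: x. Qed.

Lemma complexImN x : complex.Im (- x) = - complex.Im x.
Proof. by case: x. Qed.

Lemma complexReV x : complex.Re x^-1 =
  complex.Re x * (complex.Re x * complex.Re x + complex.Im x * complex.Im x)^-1.
Proof. by case: x. Qed.

Lemma complexImV x : complex.Im x^-1 =
  - (complex.Im x * (complex.Re x * complex.Re x + complex.Im x * complex.Im x)^-1).
Proof. by case: x => a b /=; rewrite ?mulNr. Qed.

Lemma complex_sqr_neq0 x : x != 0 ->
  complex.Re x * complex.Re x + complex.Im x * complex.Im x != 0.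
Proof.
case: x => a b; rewrite eq_complex negb_and /= -!expr2 => ab.
by rewrite paddr_eq0 ?sqr_ge0// !sqrf_eq0 negb_and.
Qed.

Lemma real_complexM (r s t : R) : r%:C * (s +i* t) = (r * s) +i* (r * t).
Proof. by apply/eqP; rewrite eq_complex /= !mul0r subr0 addr0 !eqxx. Qed.

Lemma complex_parts_inj x y : complex.Re x = complex.Re y -> complex.Im x = complex.Im y -> x = y.
Proof. by case: x y => [a b] [c d] /= -> ->. Qed.

End ComplexParts.

Section ComplexSmooth.
Context (R : realType) (V : normedModType R).
Local Notation C := R[i].
Implicit Types (f g : V -> C) (p v : V).

Definition cdifferentiable f p := differentiable (fun q => complex.Re (f q)) p /\
  differentiable (fun q => complex.Im (f q)) p.

Lemma cdifferentiable_cst (c : C) p : cdifferentiable (cst c) p.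
Proof. by split; apply: differentiable_cst. Qed.

Lemma cdifferentiableD f g p : cdifferentiable f p -> cdifferentiable g p ->
  cdifferentiable (fun q => f q + g q) p.
Proof.
move=> [f1 f2] [g1 g2]; split.
  under eq_fun do rewrite complexReD; exact: differentiableD f1 g1.
under eq_fun do rewrite complexImD; exact: differentiableD f2 g2.
Qed.

Lemma cdifferentiableM f g p : cdifferentiable f p -> cdifferentiable g p ->
  cdifferentiable (fun q => f q * g q) p.
Proof.
move=> [f1 f2] [g1 g2]; split.
  under eq_fun do rewrite complexReM.
  exact: differentiableB (differentiableM f1 g1) (differentiableM f2 g2).
under eq_fun do rewrite complexImM.
exact: differentiableD (differentiableM f1 g2) (differentiableM f2 g1).
Qed.

Lemma cderive_cst v (c : C) p : cderive v (cst c) p = 0.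
Proof. by rewrite /cderive !derive_cst. Qed.

Lemma cderiveD v f g p : cdifferentiable f p -> cdifferentiable g p ->
  cderive v (fun q => f q + g q) p = cderive v f p + cderive v g p.
Proof.
move=> [f1 f2] [g1 g2].
apply: complex_parts_inj.
  rewrite complexReD -(diff_deriveD v f1 g1); congr ('D_v _ p); apply/funext => q.
  exact: complexReD.
rewrite complexImD -(diff_deriveD v f2 g2); congr ('D_v _ p); apply/funext => q.
exact: complexImD.
Qed.

Lemma cderiveM v f g p : cdifferentiable f p -> cdifferentiable g p ->
  cderive v (fun q => f q * g q) p = cderive v f p * g p + f p * cderive v g p.
Proof.
move=> [f1 f2] [g1 g2].
have dM (h k : V -> R) : differentiable h p -> differentiable k p ->
    differentiable (fun q => h q * k q) p by exact: differentiableM.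
apply: complex_parts_inj.
  have -> : complex.Re (cderive v (fun q => f q * g q) p) =
      'D_v (fun q => complex.Re (f q) * complex.Re (g q)
                     - complex.Im (f q) * complex.Im (g q)) p.
    by congr ('D_v _ p); apply/funext => q; exact: complexReM.
  rewrite diff_deriveB; [|exact: dM|exact: dM].
  rewrite (diff_deriveM v f1 g1) (diff_deriveM v f2 g2) complexReD !complexReM.
  rewrite [complex.Re (cderive v f p)]/= [complex.Im (cderive v f p)]/=.
  rewrite [complex.Re (cderive v g p)]/= [complex.Im (cderive v g p)]/=.
  by move: ('D_v _ p) ('D_v _ p) ('D_v _ p) ('D_v _ p) => d1 d2 d3 d4; ring.
have -> : complex.Im (cderive v (fun q => f q * g q) p) =
    'D_v (fun q => complex.Re (f q) * complex.Im (g q)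
                   + complex.Im (f q) * complex.Re (g q)) p.
  by congr ('D_v _ p); apply/funext => q; exact: complexImM.
rewrite diff_deriveD; [|exact: dM|exact: dM].
rewrite (diff_deriveM v f1 g2) (diff_deriveM v f2 g1) complexImD !complexImM.
rewrite [complex.Re (cderive v f p)]/= [complex.Im (cderive v f p)]/=.
rewrite [complex.Re (cderive v g p)]/= [complex.Im (cderive v g p)]/=.
by move: ('D_v _ p) ('D_v _ p) ('D_v _ p) ('D_v _ p) => d1 d2 d3 d4; ring.
Qed.

Variable U : set V.
Hypothesis oU : open U.

Lemma csmooth_on_diff f p : csmooth_on U f -> U p -> cdifferentiable f p.
Proof. by move=> [f1 f2] Up; split; exact: smooth_on_differentiable Up. Qed.

Lemma csmooth_on_derive v f : csmooth_on U f -> csmooth_on U (cderive v f).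
Proof. by move=> [f1 f2]; split; exact: smooth_on_derive. Qed.

Lemma csmooth_on_cst (c : C) : csmooth_on U (cst c).
Proof. by split; exact: smooth_on_cst. Qed.

Lemma csmooth_onD f g : csmooth_on U f -> csmooth_on U g ->
  csmooth_on U (fun q => f q + g q).
Proof.
move=> [f1 f2] [g1 g2]; split.
  under eq_fun do rewrite complexReD; exact: smooth_onD f1 g1.
under eq_fun do rewrite complexImD; exact: smooth_onD f2 g2.
Qed.

Lemma csmooth_onM f g : csmooth_on U f -> csmooth_on U g ->
  csmooth_on U (fun q => f q * g q).
Proof.
move=> [f1 f2] [g1 g2]; split.
  under eq_fun do rewrite complexReM.
  exact: smooth_onD (smooth_onM oU f1 g1) (smooth_onN oU (smooth_onM oU f2 g2)).
under eq_fun do rewrite complexImM.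
exact: smooth_onD (smooth_onM oU f1 g2) (smooth_onM oU f2 g1).
Qed.

Lemma csmooth_onN f : csmooth_on U f -> csmooth_on U (fun q => - f q).
Proof.
move=> [f1 f2]; split.
  by under eq_fun do rewrite complexReN; exact: smooth_onN.
by under eq_fun do rewrite complexImN; exact: smooth_onN.
Qed.

Lemma csmooth_onV f : (forall p, U p -> f p != 0) -> csmooth_on U f ->
  csmooth_on U (fun q => (f q)^-1).
Proof.
move=> f0 [f1 f2].
have V1 : smooth_on U (fun q => (complex.Re (f q) * complex.Re (f q) +
    complex.Im (f q) * complex.Im (f q))^-1).
  apply: smooth_onV => //; last exact: smooth_onD (smooth_onM oU f1 f1) (smooth_onM oU f2 f2).
  by move=> p /set_mem Up; apply: complex_sqr_neq0; exact: f0.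
split.
  under eq_fun do rewrite complexReV; exact: smooth_onM f1 V1.
under eq_fun do rewrite complexImV; exact: smooth_onN (smooth_onM oU f2 V1).
Qed.

Lemma csmooth_on_sum (I : Type) (r : seq I) (P : pred I) (F : I -> V -> C) :
  (forall i, P i -> csmooth_on U (F i)) ->
  csmooth_on U (fun q => \sum_(i <- r | P i) F i q).
Proof.
move=> FC; elim: r => [|i r IH].
  under eq_fun do rewrite big_nil; exact: csmooth_on_cst.
under eq_fun do rewrite big_cons; case Pi: (P i) => //.
by apply: csmooth_onD => //; apply: FC.
Qed.

Lemma csmooth_on_prod (I : Type) (r : seq I) (P : pred I) (F : I -> V -> C) :
  (forall i, P i -> csmooth_on U (F i)) ->
  csmooth_on U (fun q => \prod_(i <- r | P i) F i q).
Proof.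
move=> FC; elim: r => [|i r IH].
  under eq_fun do rewrite big_nil; exact: csmooth_on_cst.
under eq_fun do rewrite big_cons; case Pi: (P i) => //.
by apply: csmooth_onM => //; apply: FC.
Qed.

Lemma eq_csmooth_on f g : (forall p, U p -> f p = g p) -> csmooth_on U f -> csmooth_on U g.
Proof.
move=> fg [f1 f2]; split; [apply: eq_smooth_on f1 => //|apply: eq_smooth_on f2 => //];
  by move=> p /set_mem Up; rewrite fg.
Qed.

Lemma eq_on_cderive v f g p : (forall p, U p -> f p = g p) -> U p ->
  cderive v f p = cderive v g p.
Proof.
move=> fg /mem_set Up; congr (_ +i* _); apply: (eq_on_derive oU) Up => q /set_mem Uq;
  by rewrite fg.
Qed.

Lemma csmooth_on_of_derive f : (forall p, U p -> cdifferentiable f p) ->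
  (forall v, csmooth_on U (cderive v f)) -> csmooth_on U f.
Proof.
move=> df fs; split; apply: smooth_on_of_derive => //.
- by move=> p /df [].
- by move=> v; have [] := fs v.
- by move=> p /df [].
- by move=> v; have [] := fs v.
Qed.

End ComplexSmooth.

Section MatrixSmooth.
Context (R : realType) (V : normedModType R) (n : nat).
Local Notation C := R[i].
Local Notation M := 'M[R[i]]_n.+1.
Implicit Types (F G : V -> M) (p v : V).

Definition mxdifferentiable F p := forall i k, cdifferentiable (fun q => F q i k) p.

Lemma cdifferentiable_sum (I : Type) (r : seq I) (F : I -> V -> C) p :
  (forall i, cdifferentiable (F i) p) ->
  cdifferentiable (fun q => \sum_(i <- r) F i q) p.
Proof.
move=> dF; elim: r => [|i r IH].
  under eq_fun do rewrite big_nil; exact: cdifferentiable_cst.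
by under eq_fun do rewrite big_cons; exact: cdifferentiableD.
Qed.

Lemma cderive_sum (I : Type) (r : seq I) (F : I -> V -> C) p v :
  (forall i, cdifferentiable (F i) p) ->
  cderive v (fun q => \sum_(i <- r) F i q) p = \sum_(i <- r) cderive v (F i) p.
Proof.
move=> dF; elim: r => [|i r IH].
  by under eq_fun do rewrite big_nil; rewrite big_nil cderive_cst.
under eq_fun do rewrite big_cons; rewrite cderiveD// ?big_cons ?IH//.
exact: cdifferentiable_sum.
Qed.

Lemma mxdifferentiable_cst (A : M) p : mxdifferentiable (cst A) p.
Proof. by move=> i k; exact: cdifferentiable_cst. Qed.

Lemma mxdifferentiableD F G p : mxdifferentiable F p -> mxdifferentiable G p ->
  mxdifferentiable (fun q => F q + G q) p.
Proof.
by move=> dF dG i k; under eq_fun do rewrite mxE; exact: cdifferentiableD.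
Qed.

Lemma mxdifferentiableM F G p : mxdifferentiable F p -> mxdifferentiable G p ->
  mxdifferentiable (fun q => F q *m G q) p.
Proof.
move=> dF dG i k; under eq_fun do rewrite mxE.
by apply: cdifferentiable_sum => l; exact: cdifferentiableM.
Qed.

Lemma mxderive_cst v (A : M) p : mxderive v (cst A) p = 0.
Proof. by apply/matrixP => i k; rewrite !mxE cderive_cst. Qed.

Lemma mxderiveD v F G p : mxdifferentiable F p -> mxdifferentiable G p ->
  mxderive v (fun q => F q + G q) p = mxderive v F p + mxderive v G p.
Proof.
move=> dF dG; apply/matrixP => i k; rewrite !mxE -cderiveD//.
by congr (cderive v _ p); apply/funext => q; rewrite mxE.
Qed.

Lemma mxderiveM v F G p : mxdifferentiable F p -> mxdifferentiable G p ->
  mxderive v (fun q => F q *m G q) p = mxderive v F p *m G p + F p *m mxderive v G p.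
Proof.
move=> dF dG; apply/matrixP => i k; rewrite !mxE -big_split /=.
under [in LHS]eq_fun do rewrite mxE.
rewrite cderive_sum; last by move=> l; exact: cdifferentiableM.
by apply: eq_bigr => l _; rewrite cderiveM// !mxE.
Qed.

Lemma scale_mulmx (c : C) (A : M) : c *: A = c%:M *m A.
Proof. by rewrite mul_scalar_mx. Qed.

Lemma mxdifferentiableZ (c : C) F p : mxdifferentiable F p ->
  mxdifferentiable (fun q => c *: F q) p.
Proof.
move=> dF; under eq_fun do rewrite scale_mulmx.
by apply: mxdifferentiableM => //; exact: mxdifferentiable_cst.
Qed.

Lemma mxderiveZ v (c : C) F p : mxdifferentiable F p ->
  mxderive v (fun q => c *: F q) p = c *: mxderive v F p.
Proof.
move=> dF; under eq_fun do rewrite scale_mulmx.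
rewrite (@mxderiveM _ (cst c%:M) F)//; last exact: mxdifferentiable_cst.
by rewrite mxderive_cst mul0mx add0r mul_scalar_mx.
Qed.

Lemma mxdifferentiableN F p : mxdifferentiable F p -> mxdifferentiable (fun q => - F q) p.
Proof.
by move=> dF; under eq_fun do rewrite -scaleN1r; exact: mxdifferentiableZ.
Qed.

Lemma mxderiveN v F p : mxdifferentiable F p ->
  mxderive v (fun q => - F q) p = - mxderive v F p.
Proof.
by move=> dF; under eq_fun do rewrite -scaleN1r; rewrite mxderiveZ// scaleN1r.
Qed.

Lemma mxdifferentiableB F G p : mxdifferentiable F p -> mxdifferentiable G p ->
  mxdifferentiable (fun q => F q - G q) p.
Proof. by move=> dF dG; apply: mxdifferentiableD => //; exact: mxdifferentiableN. Qed.

Lemma mxderiveB v F G p : mxdifferentiable F p -> mxdifferentiable G p ->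
  mxderive v (fun q => F q - G q) p = mxderive v F p - mxderive v G p.
Proof.
by move=> dF dG; rewrite mxderiveD ?mxderiveN//; exact: mxdifferentiableN.
Qed.

Lemma mxdifferentiable_sum (I : Type) (r : seq I) (F : I -> V -> M) p :
  (forall i, mxdifferentiable (F i) p) ->
  mxdifferentiable (fun q => \sum_(i <- r) F i q) p.
Proof.
move=> dF; elim: r => [|i r IH].
  under eq_fun do rewrite big_nil; exact: mxdifferentiable_cst.
by under eq_fun do rewrite big_cons; exact: mxdifferentiableD.
Qed.

Lemma mxderive_sum (I : Type) (r : seq I) (F : I -> V -> M) p v :
  (forall i, mxdifferentiable (F i) p) ->
  mxderive v (fun q => \sum_(i <- r) F i q) p = \sum_(i <- r) mxderive v (F i) p.
Proof.
move=> dF; elim: r => [|i r IH].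
  by under eq_fun do rewrite big_nil; rewrite big_nil mxderive_cst.
under eq_fun do rewrite big_cons; rewrite mxderiveD// ?big_cons ?IH//.
exact: mxdifferentiable_sum.
Qed.

Variable U : set V.
Hypothesis oU : open U.

Lemma mxsmooth_on_diff F p : mxsmooth_on U F -> U p -> mxdifferentiable F p.
Proof. by move=> sF Up i k; exact: csmooth_on_diff (sF i k) Up. Qed.

Lemma mxsmooth_on_cst (A : M) : mxsmooth_on U (cst A).
Proof. by move=> i k; exact: csmooth_on_cst. Qed.

Lemma mxsmooth_onD F G : mxsmooth_on U F -> mxsmooth_on U G ->
  mxsmooth_on U (fun q => F q + G q).
Proof. by move=> sF sG i k; under eq_fun do rewrite mxE; exact: csmooth_onD. Qed.

Lemma mxsmooth_onM F G : mxsmooth_on U F -> mxsmooth_on U G ->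
  mxsmooth_on U (fun q => F q *m G q).
Proof.
move=> sF sG i k; under eq_fun do rewrite mxE.
by apply: csmooth_on_sum => // l _; exact: csmooth_onM.
Qed.

Lemma mxsmooth_on_scale (f : V -> C) F : csmooth_on U f -> mxsmooth_on U F ->
  mxsmooth_on U (fun q => f q *: F q).
Proof. by move=> sf sF i k; under eq_fun do rewrite mxE; exact: csmooth_onM. Qed.

Lemma mxsmooth_onZ (c : C) F : mxsmooth_on U F -> mxsmooth_on U (fun q => c *: F q).
Proof. by move=> sF; apply: mxsmooth_on_scale => //; exact: csmooth_on_cst. Qed.

Lemma mxsmooth_onN F : mxsmooth_on U F -> mxsmooth_on U (fun q => - F q).
Proof. by move=> sF i k; under eq_fun do rewrite mxE; exact: csmooth_onN. Qed.

Lemma mxsmooth_onB F G : mxsmooth_on U F -> mxsmooth_on U G ->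
  mxsmooth_on U (fun q => F q - G q).
Proof. by move=> sF sG; apply: mxsmooth_onD => //; exact: mxsmooth_onN. Qed.

Lemma mxsmooth_on_sum (I : Type) (r : seq I) (F : I -> V -> M) :
  (forall i, mxsmooth_on U (F i)) ->
  mxsmooth_on U (fun q => \sum_(i <- r) F i q).
Proof.
move=> sF; elim: r => [|i r IH].
  under eq_fun do rewrite big_nil; exact: mxsmooth_on_cst.
by under eq_fun do rewrite big_cons; exact: mxsmooth_onD.
Qed.

Lemma csmooth_on_det k (F : V -> 'M[C]_k) :
  (forall i l, csmooth_on U (fun q => F q i l)) -> csmooth_on U (fun q => \det (F q)).
Proof.
move=> sF; rewrite /determinant; apply: csmooth_on_sum => // s _.
apply: csmooth_onM => //; first exact: csmooth_on_cst.
by apply: csmooth_on_prod.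
Qed.

Lemma mxsmooth_onV F : (forall p, U p -> F p \in unitmx) -> mxsmooth_on U F ->
  mxsmooth_on U (fun q => invmx (F q)).
Proof.
move=> uF sF.
have H : mxsmooth_on U (fun q => (\det (F q))^-1 *: \adj (F q)).
  apply: mxsmooth_on_scale.
    by apply: csmooth_onV => //; exact: csmooth_on_det.
  move=> i k; under eq_fun do rewrite mxE; apply: csmooth_onM => //.
    exact: csmooth_on_cst.
  by apply: csmooth_on_det => r s; under eq_fun do rewrite !mxE.
move=> i k; apply: (eq_csmooth_on oU) (H i k) => p Up; have Fu := uF p Up.
by rewrite /invmx Fu.
Qed.

Lemma eq_mxsmooth_on F G : (forall p, U p -> F p = G p) -> mxsmooth_on U F -> mxsmooth_on U G.
Proof. by move=> FG sF i k; apply: (eq_csmooth_on oU) (sF i k) => p Up; rewrite FG. Qed.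

Lemma eq_on_mxderive v F G p : (forall p, U p -> F p = G p) -> U p ->
  mxderive v F p = mxderive v G p.
Proof.
move=> FG Up; apply/matrixP => i k; rewrite !mxE.
by apply: (eq_on_cderive oU) Up => q Uq; rewrite FG.
Qed.

Lemma mxderiveV v F p : (forall p, U p -> F p \in unitmx) -> mxsmooth_on U F -> U p ->
  mxderive v (fun q => invmx (F q)) p = - invmx (F p) *m mxderive v F p *m invmx (F p).
Proof.
move=> uF sF Up.
have : mxderive v (fun q => F q *m invmx (F q)) p = mxderive v (cst 1%:M) p.
  by apply: eq_on_mxderive Up => q Uq; rewrite mulmxV ?(uF _ Uq).
rewrite mxderive_cst mxderiveM; first last.
- by apply: mxsmooth_on_diff Up; apply: mxsmooth_onV.
- exact: mxsmooth_on_diff Up.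
move=> /(congr1 (mulmx (invmx (F p)))); rewrite mulmx0 mulmxDr mulKmx ?(uF _ Up)// => /eqP.
by rewrite addrC addr_eq0 mulmxA !mulNmx => /eqP.
Qed.

Lemma mxsmooth_on_of_derive F : (forall p, U p -> mxdifferentiable F p) ->
  (forall v, mxsmooth_on U (mxderive v F)) -> mxsmooth_on U F.
Proof.
move=> dF sF i k; apply: csmooth_on_of_derive => // [p Up|v]; first exact: dF.
by have := sF v i k; under eq_fun do rewrite mxE.
Qed.

End MatrixSmooth.

Lemma mxsmooth_on_sub (R : realType) (V : normedModType R) (U U' : set V) n
    (F : V -> 'M[R[i]]_n) :
  U' `<=` U -> mxsmooth_on U F -> mxsmooth_on U' F.
Proof. by move=> sU sF i k; have [] := sF i k; split; apply: smooth_on_sub; eassumption. Qed.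

(** * Estimates along segments *)

Section LineCalculus.
Context (R : realType) (V : normedModType R).

Lemma is_derive_line (f : V -> R) (p v : V) (s : R) :
  differentiable f (p + s *: v) ->
  is_derive s 1 (fun r => f (p + r *: v)) ('D_v f (p + s *: v)).
Proof.
move=> df; have dv : derivable f (p + s *: v) v by exact: diff_derivable.
have E : (fun h : R => h^-1 *: (((fun r => f (p + r *: v)) \o shift s) (h *: 1)
                                - f (p + s *: v))) =
         (fun h : R => h^-1 *: ((f \o shift (p + s *: v)) (h *: v) - f (p + s *: v))).
  apply/funext => h /=; congr (_ *: (f _ - _)).
  by rewrite /shift /= -[h *: 1]/(h * 1) mulr1 scalerDl addrCA.
split; first by rewrite /derivable E.
by rewrite /derive E.
Qed.

Lemma mean_value_le (f : V -> R) (p v : V) (k : R) :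
  (forall s : R, 0 <= s <= 1 -> differentiable f (p + s *: v)) ->
  (forall s : R, 0 <= s <= 1 -> `|'D_v f (p + s *: v)| <= k) ->
  `|f (p + v) - f p| <= k.
Proof.
move=> df kf.
have [||c c01] := @MVT_segment R (fun r => f (p + r *: v))
  (fun s => 'D_v f (p + s *: v)) 0 1 ler01.
- move=> s; rewrite in_itv /= => /andP[/ltW s0 /ltW s1].
  by apply: is_derive_line; apply: df; rewrite s0.
- apply: derivable_within_continuous => s; rewrite in_itv /= => s01.
  by have [] := is_derive_line (df s s01).
by rewrite scale1r scale0r addr0 subr0 mulr1 => ->; apply: kf; rewrite in_itv /= in c01.
Qed.

(** The derivative of [exp (- C s) f] along the segment is nonpositive. *)
Lemma gronwall_line (f : V -> R) (p v : V) (C : R) :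
  (forall s : R, 0 <= s <= 1 -> differentiable f (p + s *: v)) ->
  (forall s : R, 0 <= s <= 1 -> 'D_v f (p + s *: v) <= C * f (p + s *: v)) ->
  f (p + v) <= expR C * f p.
Proof.
move=> df kf.
have dg (s : R) : 0 <= s <= 1 -> is_derive s 1 (fun r => expR (- C * r) * f (p + r *: v))
   (expR (- C * s) * ('D_v f (p + s *: v) - C * f (p + s *: v))).
  move=> /df /is_derive_line dl; pose e := fun r : R => expR (- C * r).
  have de : is_derive s 1 e (- C * expR (- C * s)).
    have d1 : is_derive s 1 (fun r : R => - C * r) (- C *: (1 : R)).
      exact: (@is_deriveZ _ _ _ (@id R)).
    have := is_derive1_comp (is_derive_expR (- C * s)) d1.
    by rewrite -[_ *: _]/(_ * _) mulr1 mulrC.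
  apply: (is_derive_eq (is_deriveM de dl)).
  have sE (k x : R) : k *: (x : R^o) = k * x by []. rewrite /e /= !sE; ring.
have [||c] := @MVT_segment R (fun r => expR (- C * r) * f (p + r *: v))
  (fun s => expR (- C * s) * ('D_v f (p + s *: v) - C * f (p + s *: v))) 0 1 ler01.
- by move=> s; rewrite in_itv /= => /andP[/ltW s0 /ltW s1]; apply: dg; rewrite s0.
- apply: derivable_within_continuous => s; rewrite in_itv /= => s01.
  by have [] := dg s s01.
rewrite in_itv /= => c01; rewrite mulr1 mulr0 expR0 scale1r scale0r addr0 mul1r subr0 mulr1 => E.
have : expR (- C) * f (p + v) <= f p.
  rewrite -subr_le0 E pmulr_rle0 ?expR_gt0// subr_le0; exact: kf.
by rewrite expRN mulrC ler_pdivrMr ?expR_gt0// mulrC.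
Qed.

End LineCalculus.

Section EntryNorm.
Context (R : realType) (n : nat).
Local Notation C := R[i].
Local Notation M := 'M[R[i]]_n.+1.
Implicit Types (x y : C) (A B : M).

Definition cnorm1 x : R := `|complex.Re x| + `|complex.Im x|.

(** The sum of the moduli of the real coordinates of the entries: a submultiplicative
    norm with values in [R], while the norms of complex numbers lie in [R[i]]. *)
Definition norm1 A : R := \sum_i \sum_k cnorm1 (A i k).

Lemma cnorm1_ge0 x : 0 <= cnorm1 x.
Proof. by rewrite addr_ge0. Qed.

Lemma cnorm1D x y : cnorm1 (x + y) <= cnorm1 x + cnorm1 y.
Proof.
rewrite /cnorm1 complexReD complexImD addrACA lerD//; exact: ler_normD.
Qed.

Lemma cnorm1M x y : cnorm1 (x * y) <= cnorm1 x * cnorm1 y.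
Proof.
rewrite /cnorm1 complexReM complexImM mulrDl !mulrDr -!normrM.
rewrite (le_trans (lerD (ler_normB _ _) (ler_normD _ _)))//.
by rewrite le_eqVlt; apply/orP; left; apply/eqP; ring.
Qed.

Lemma cnorm10 : cnorm1 0 = 0.
Proof. by rewrite /cnorm1 /= normr0 addr0. Qed.

Lemma cnorm1_eq0 x : cnorm1 x = 0 -> x = 0.
Proof.
case: x => a b; rewrite /cnorm1 /= => /eqP; rewrite paddr_eq0// !normr_eq0.
by move=> /andP[/eqP -> /eqP ->].
Qed.

Lemma cnorm1N x : cnorm1 (- x) = cnorm1 x.
Proof. by rewrite /cnorm1 complexReN complexImN !normrN. Qed.

Lemma cnorm1_sum (I : Type) (r : seq I) (F : I -> C) :
  cnorm1 (\sum_(i <- r) F i) <= \sum_(i <- r) cnorm1 (F i).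
Proof.
elim: r => [|i r IH]; first by rewrite !big_nil cnorm10.
by rewrite !big_cons (le_trans (cnorm1D _ _))// lerD2l.
Qed.

Lemma norm1_ge0 A : 0 <= norm1 A.
Proof. by do 2 apply: sumr_ge0 => ? _; exact: cnorm1_ge0. Qed.

Lemma norm1_entry A i k : cnorm1 (A i k) <= norm1 A.
Proof.
rewrite /norm1 (bigD1 i)//= (bigD1 k)//= -addrA lerDl addr_ge0//.
  by apply: sumr_ge0 => ? _; exact: cnorm1_ge0.
by do 2 apply: sumr_ge0 => ? _; exact: cnorm1_ge0.
Qed.

Lemma norm1D A B : norm1 (A + B) <= norm1 A + norm1 B.
Proof.
rewrite /norm1 -big_split ler_sum// => i _; rewrite -big_split ler_sum// => k _.
by rewrite mxE cnorm1D.
Qed.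

Lemma norm1N A : norm1 (- A) = norm1 A.
Proof.
by apply: eq_bigr => i _; apply: eq_bigr => k _; rewrite mxE cnorm1N.
Qed.

Lemma norm10 : norm1 0 = 0.
Proof. by rewrite /norm1 big1// => i _; rewrite big1// => k _; rewrite mxE cnorm10. Qed.

Lemma norm1_eq0 A : norm1 A = 0 -> A = 0.
Proof.
move=> A0; apply/matrixP => i k; rewrite mxE; apply: cnorm1_eq0.
by apply/eqP; rewrite eq_le cnorm1_ge0 -A0 norm1_entry.
Qed.

Lemma norm1B A B : norm1 (A - B) <= norm1 A + norm1 B.
Proof. by rewrite (le_trans (norm1D _ _))// norm1N. Qed.

Lemma norm1BC A B : norm1 (A - B) = norm1 (B - A).
Proof. by rewrite -norm1N opprB. Qed.

Lemma norm1_sum (I : Type) (r : seq I) (F : I -> M) :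
  norm1 (\sum_(i <- r) F i) <= \sum_(i <- r) norm1 (F i).
Proof.
elim: r => [|i r IH]; first by rewrite !big_nil norm10.
by rewrite !big_cons (le_trans (norm1D _ _))// lerD2l.
Qed.

Lemma norm1Z x A : norm1 (x *: A) <= cnorm1 x * norm1 A.
Proof.
rewrite /norm1 mulr_sumr ler_sum// => i _; rewrite mulr_sumr ler_sum// => k _.
by rewrite mxE cnorm1M.
Qed.

Lemma norm1M A B : norm1 (A *m B) <= norm1 A * norm1 B.
Proof.
rewrite {1}/norm1.
have -> : norm1 A * norm1 B = \sum_i \sum_l cnorm1 (A i l) * norm1 B.
  by rewrite /norm1 mulr_suml; apply: eq_bigr => i _; rewrite mulr_suml.
apply: ler_sum => i _.
apply: (@le_trans _ _ (\sum_k \sum_l cnorm1 (A i l) * cnorm1 (B l k))).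
  apply: ler_sum => k _; rewrite mxE (le_trans (cnorm1_sum _ _))// ler_sum// => l _.
  exact: cnorm1M.
rewrite exchange_big ler_sum//= => l _; rewrite -mulr_sumr ler_wpM2l ?cnorm1_ge0//.
by rewrite /norm1 [leRHS](bigD1 l)//= lerDl; do 2 apply: sumr_ge0 => ? _; exact: cnorm1_ge0.
Qed.

(** The sum of the squares of the real coordinates: unlike [norm1], it is
    differentiable. *)
Definition normsq A : R := \sum_i \sum_k
  (complex.Re (A i k) * complex.Re (A i k) + complex.Im (A i k) * complex.Im (A i k)).

Definition real_dim : R := (2 * (n.+1 * n.+1))%:R.

Lemma real_dim_ge0 : 0 <= real_dim.
Proof. exact: ler0n. Qed.

Lemma sum_le_const (F : 'I_n.+1 -> 'I_n.+1 -> R) c :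
  (forall i k, F i k <= c) -> \sum_i \sum_k F i k <= (n.+1 * n.+1)%:R * c.
Proof.
move=> Fc; apply: (@le_trans _ _ (\sum_(i < n.+1) \sum_(k < n.+1) c)).
  by apply: ler_sum => i _; apply: ler_sum => k _.
by rewrite !sumr_const !card_ord -mulrnA mulr_natl.
Qed.

Lemma norm1_le_normsq A : norm1 A <= real_dim + normsq A.
Proof.
have -> : real_dim = \sum_(i < n.+1) \sum_(k < n.+1) 2.
  by rewrite !sumr_const !card_ord -mulrnA /real_dim natrM -[RHS]mulr_natr.
rewrite /norm1 /normsq -big_split ler_sum// => i _; rewrite -big_split ler_sum//= => k _.
rewrite /cnorm1; move: (complex.Re _) (complex.Im _) => x y.
have H (z : R) : `|z| <= 1 + z * z.
  have := sqr_ge0 (`|z| - 1); have := real_normK (num_real z).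
  by have := normr_ge0 z; nra.
by have := H x; have := H y; lra.
Qed.

Lemma normsq_ge0 A : 0 <= normsq A.
Proof. by do 2 apply: sumr_ge0 => ? _; rewrite addr_ge0// -expr2 sqr_ge0. Qed.

Lemma normsq_le_norm1 A : normsq A <= norm1 A * norm1 A.
Proof.
have H i k : complex.Re (A i k) * complex.Re (A i k) + complex.Im (A i k) * complex.Im (A i k)
    <= cnorm1 (A i k) * norm1 A.
  apply: (@le_trans _ _ (cnorm1 (A i k) * cnorm1 (A i k))).
    rewrite /cnorm1; move: (complex.Re _) (complex.Im _) => x y.
    have := normr_ge0 x; have := normr_ge0 y.
    have := real_normK (num_real x); have := real_normK (num_real y); nra.
  by rewrite ler_wpM2l ?cnorm1_ge0 ?norm1_entry.
rewrite /normsq {2}/norm1 mulr_suml ler_sum// => i _; rewrite mulr_suml ler_sum// => k _.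
Qed.

Lemma norm1_sqr_le A : norm1 A * norm1 A <= 2 * real_dim * normsq A.
Proof.
have H (I : finType) (F : I -> R) : (\sum_i F i) * (\sum_i F i) <= #|I|%:R * \sum_i F i * F i.
  rewrite mulr_suml.
  apply: (@le_trans _ _ (\sum_i \sum_k (F i * F i + F k * F k) / 2)).
    apply: ler_sum => i _; rewrite mulr_sumr ler_sum// => k _.
    by have := sqr_ge0 (F i - F k); rewrite expr2; nra.
  rewrite (eq_bigr (fun i => #|I|%:R * (F i * F i) / 2 + (\sum_k F k * F k) / 2)); last first.
    by move=> i _; rewrite -mulr_suml big_split /= sumr_const -[_ *+ _]mulr_natl mulrDl.
  rewrite big_split /= sumr_const -mulr_suml -mulr_sumr -mulr_natl; lra.
rewrite /norm1 !pair_big /=.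
rewrite (le_trans (H _ _))// card_prod !card_ord /normsq !pair_big /=.
rewrite mulrC (le_trans (y := (\sum_(p : 'I_n.+1 * 'I_n.+1) 2 * (complex.Re (A p.1 p.2) * complex.Re (A p.1 p.2) + complex.Im (A p.1 p.2) * complex.Im (A p.1 p.2))) * (n.+1 * n.+1)%:R))//.
  rewrite ler_wpM2r// ler_sum// => -[i k] _ /=; rewrite /cnorm1.
  move: (complex.Re _) (complex.Im _) => x y.
  have := sqr_ge0 (`|x| - `|y|).
  have := real_normK (num_real x); have := real_normK (num_real y); nra.
rewrite -mulr_sumr /real_dim natrM.
set S := \sum_(p : _) _; have : 0 <= S.
  by apply: sumr_ge0 => -[i k] _; rewrite addr_ge0// -expr2 sqr_ge0.
have : 0 <= (n.+1 * n.+1)%:R :> R by [].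
nra.
Qed.

End EntryNorm.

Section MatrixEstimates.
Context (R : realType) (V : normedModType R) (n : nat).
Local Notation C := R[i].
Local Notation M := 'M[R[i]]_n.+1.
Implicit Types (F : V -> M) (p v : V).

Lemma mx_mean_value_le F p v k :
  (forall s : R, 0 <= s <= 1 -> mxdifferentiable F (p + s *: v)) ->
  (forall s : R, 0 <= s <= 1 -> norm1 (mxderive v F (p + s *: v)) <= k) ->
  norm1 (F (p + v) - F p) <= real_dim R n * k.
Proof.
move=> dF kF; rewrite /norm1 /real_dim natrM mulrAC mulrC.
apply: sum_le_const => i l; rewrite mulrDl !mul1r !mxE /cnorm1.
have H s : 0 <= s <= 1 -> cnorm1 (mxderive v F (p + s *: v) i l) <= k.
  by move=> /kF; apply: le_trans; exact: norm1_entry.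
rewrite lerD//.
  rewrite complexReD complexReN.
  apply: (mean_value_le (f := fun q => complex.Re (F q i l))) => s s01.
    by have [] := dF s s01 i l.
  by apply: le_trans (H s s01); rewrite mxE /cnorm1 lerDl.
rewrite complexImD complexImN.
apply: (mean_value_le (f := fun q => complex.Im (F q i l))) => s s01.
  by have [] := dF s s01 i l.
by apply: le_trans (H s s01); rewrite mxE /cnorm1 lerDr.
Qed.

Lemma is_diff_sum (I : Type) (r : seq I) (f : I -> V -> R) (g : I -> R) p v :
  (forall i, differentiable (f i) p /\ 'D_v (f i) p = g i) ->
  differentiable (fun q => \sum_(i <- r) f i q) p /\
  'D_v (fun q => \sum_(i <- r) f i q) p = \sum_(i <- r) g i.
Proof.
move=> fg; elim: r => [|i r [d1 d2]].
  by under eq_fun do rewrite big_nil; rewrite big_nil derive_cst; split.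
under eq_fun do rewrite big_cons; rewrite big_cons; have [f1 f2] := fg i.
split; first exact: differentiableD f1 d1.
by rewrite (deriveD (diff_derivable f1) (diff_derivable d1)) f2 d2.
Qed.

Lemma normsq_derive F p v : mxdifferentiable F p ->
  differentiable (fun q => normsq (F q)) p /\
  'D_v (fun q => normsq (F q)) p = \sum_i \sum_k
     2 * (complex.Re (F p i k) * complex.Re (mxderive v F p i k)
          + complex.Im (F p i k) * complex.Im (mxderive v F p i k)).
Proof.
move=> dF; apply: is_diff_sum => i; apply: is_diff_sum => k; rewrite mxE /=.
have [d1 d2] := dF i k; split.
  exact: differentiableD (differentiableM d1 d1) (differentiableM d2 d2).
rewrite (diff_deriveD v (differentiableM d1 d1) (differentiableM d2 d2)).
rewrite (diff_deriveM v d1 d1) (diff_deriveM v d2 d2).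
by move: ('D_v _ p) ('D_v _ p) => e1 e2; ring.
Qed.

(** [normsq] is differentiable and comparable to the square of [norm1], so the
    scalar inequality applies to it. *)
Lemma mx_gronwall F p v k :
  (forall s : R, 0 <= s <= 1 -> mxdifferentiable F (p + s *: v)) ->
  (forall s : R, 0 <= s <= 1 ->
     norm1 (mxderive v F (p + s *: v)) <= k * norm1 (F (p + s *: v))) ->
  normsq (F (p + v)) <= expR (1 + k ^+ 2 * (2 * real_dim R n)) * normsq (F p).
Proof.
move=> dF kF.
apply: (gronwall_line (f := fun q => normsq (F q))) => s s01.
  by have [] := normsq_derive v (dF s s01).
have [_ ->] := normsq_derive v (dF s s01).
set A := F _; set B := mxderive v F _.
apply: (@le_trans _ _ (normsq A + normsq B)).
  rewrite /normsq -big_split ler_sum// => i _; rewrite -big_split ler_sum//= => l _.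
  move: (complex.Re (A i l)) (complex.Im (A i l)) (complex.Re (B i l)) (complex.Im (B i l)) => x y z t.
  by have := sqr_ge0 (x - z); have := sqr_ge0 (y - t); nra.
rewrite mulrDl mul1r lerD2l (le_trans (normsq_le_norm1 _))//.
have := kF s s01; rewrite -/A -/B => kAB; have := norm1_sqr_le A.
have := norm1_ge0 B; have := norm1_ge0 A => a0 b0 a2.
apply: (@le_trans _ _ ((k * norm1 A) * (k * norm1 A))); first by rewrite ler_pM.
by rewrite mulrACA -expr2 -mulrA ler_wpM2l ?sqr_ge0.
Qed.

(** With [k] a bound for the coefficients this is uniqueness for homogeneous linear
    systems along a segment. *)
Lemma mx_gronwall0 F p v k :
  (forall s : R, 0 <= s <= 1 -> mxdifferentiable F (p + s *: v)) ->
  (forall s : R, 0 <= s <= 1 ->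
     norm1 (mxderive v F (p + s *: v)) <= k * norm1 (F (p + s *: v))) ->
  F p = 0 -> F (p + v) = 0.
Proof.
move=> dF kF F0; have := mx_gronwall dF kF; rewrite F0.
have -> : normsq (0 : M) = 0.
  by rewrite /normsq big1// => i _; rewrite big1// => l _; rewrite mxE /= !mulr0 addr0.
rewrite mulr0 => H; apply: norm1_eq0; apply/eqP; rewrite eq_le norm1_ge0 andbT.
have := norm1_sqr_le (F (p + v)).
have -> : normsq (F (p + v)) = 0 by apply/eqP; rewrite eq_le H normsq_ge0.
rewrite mulr0 -expr2 => H0; have : norm1 (F (p + v)) ^+ 2 == 0.
  by rewrite eq_le H0 sqr_ge0.
by rewrite expf_eq0 /= => /eqP ->.
Qed.

End MatrixEstimates.

(** * Limits in a complex parameter *)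

Section ParameterLimit.
Context (R : realType) (n : nat).
Local Notation C := R[i].
Local Notation M := 'M[R[i]]_n.+1.
Implicit Types (h z : C).

(** The increments of the parameter over which the estimates below are uniform. *)
Definition small_param h := h != 0 /\ cnorm1 h <= 1.

Lemma small_param_exists (e : R) : 0 < e -> exists2 h : C, small_param h & cnorm1 h <= e.
Proof.
move=> e0; exists ((Num.min e 1)%:C).
  split; last by rewrite /cnorm1 /= normr0 addr0 gtr0_norm ?lt_min ?e0//= ge_min lexx orbT.
  by rewrite eq_complex /= eqxx andbT gt_eqF// lt_min e0 ltr01.
by rewrite /cnorm1 /= normr0 addr0 gtr0_norm ?lt_min ?e0//= ge_min lexx.
Qed.

Lemma cnorm1_real (r : R) : cnorm1 (r%:C) = `|r|.
Proof. by rewrite /cnorm1 /= normr0 addr0. Qed.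

Lemma cnorm1_1 : cnorm1 (1 : C) = 1.
Proof. by rewrite /cnorm1 /= normr0 normr1 addr0. Qed.

Lemma cnorm1X h l : cnorm1 h <= 1 -> cnorm1 (h ^+ l) <= 1.
Proof.
move=> h1; elim: l => [|l IH]; first by rewrite expr0 cnorm1_1.
by rewrite exprS (le_trans (cnorm1M _ _))// -[leRHS](mulr1 1) ler_pM ?cnorm1_ge0.
Qed.

(** The hypothesis says that each [u h - c |h|] is at most each [u h' + c |h'|];
    the supremum of the former is the limit. *)
Lemma scalar_limit (u : C -> R) c :
  (forall h h', small_param h -> small_param h' -> `|u h - u h'| <= c * (cnorm1 h + cnorm1 h')) ->
  exists L, forall h, small_param h -> `|u h - L| <= c * cnorm1 h.
Proof.
move=> uC; pose S := [set x | exists2 h, small_param h & x = u h - c * cnorm1 h].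
have ubS h : small_param h -> ubound S (u h + c * cnorm1 h).
  move=> sh _ [h' sh' ->]; have := uC _ _ sh' sh; rewrite ler_norml => /andP[_].
  lra.
have [h0 sh0 _] := small_param_exists ltr01.
have S0 : S !=set0 by exists (u h0 - c * cnorm1 h0), h0.
exists (sup S) => h sh; rewrite ler_norml; apply/andP; split.
  by have := ge_sup S0 (ubS h sh); lra.
have : u h - c * cnorm1 h <= sup S.
  by apply: ub_le_sup; [exists (u h + c * cnorm1 h); exact: ubS|exists h].
lra.
Qed.

Lemma mx_limit (Y : C -> M) c :
  (forall h h', small_param h -> small_param h' -> norm1 (Y h - Y h') <= c * (cnorm1 h + cnorm1 h')) ->
  exists L, forall h, small_param h -> norm1 (Y h - L) <= real_dim R n * c * cnorm1 h.
Proof.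
move=> YC.
have HRe i k : exists L, forall h, small_param h -> `|complex.Re (Y h i k) - L| <= c * cnorm1 h.
  apply: scalar_limit => h h' sh sh'; apply: le_trans (YC h h' sh sh').
  apply: le_trans (norm1_entry _ i k); rewrite !mxE /cnorm1 complexReD complexReN.
  by rewrite lerDl.
have HIm i k : exists L, forall h, small_param h -> `|complex.Im (Y h i k) - L| <= c * cnorm1 h.
  apply: scalar_limit => h h' sh sh'; apply: le_trans (YC h h' sh sh').
  apply: le_trans (norm1_entry _ i k); rewrite !mxE /cnorm1 complexImD complexImN.
  by rewrite lerDr.
exists (\matrix_(i, k) (projT1 (cid (HRe i k)) +i* projT1 (cid (HIm i k)))) => h sh.
have -> : real_dim R n * c * cnorm1 h = (n.+1 * n.+1)%:R * (2 * (c * cnorm1 h)).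
  by rewrite /real_dim natrM; ring.
apply: sum_le_const => i k.
rewrite !mxE /cnorm1 complexReD complexReN complexImD complexImN /=.
have /= := projT2 (cid (HRe i k)) h sh; have /= := projT2 (cid (HIm i k)) h sh.
rewrite /cnorm1; lra.
Qed.

Lemma le_small_param (x y c : R) : (forall h, small_param h -> x <= y + c * cnorm1 h) -> 0 <= c -> x <= y.
Proof.
move=> H c0; rewrite leNgt; apply/negP => yx.
have e0 : 0 < (x - y) / (2 * (c + 1)) by rewrite divr_gt0 ?subr_gt0//; lra.
have [h sh he] := small_param_exists e0; have := H h sh.
have : c * cnorm1 h <= (x - y) / 2.
  apply: (@le_trans _ _ ((c + 1) * ((x - y) / (2 * (c + 1))))).
    by rewrite ler_pM ?cnorm1_ge0//; lra.
  rewrite le_eqVlt; apply/orP; left; apply/eqP; field; lra.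
lra.
Qed.

End ParameterLimit.

Section Plane.
Context (R : realType).

Definition plane_form (a b : R) (v : R * R) : R := a * v.1 + b * v.2.

Lemma plane_form_linear a b : linear (plane_form a b : R * R -> R^o).
Proof.
by move=> r [x y] [z t]; rewrite /plane_form /= -![_ *: _]/(_ * _); ring.
Qed.

HB.instance Definition _ a b :=
  GRing.isLinear.Build R (R * R)%type R _ (plane_form a b) (plane_form_linear a b).

Lemma plane_form_continuous a b : continuous (plane_form a b).
Proof.
move=> v; rewrite /plane_form; apply: cvgD; apply: cvgM; try exact: cvg_cst.
  exact: cvg_fst. exact: cvg_snd.
Qed.

End Plane.

(** * Differentiability in the plane *)

Lemma near_forall (T : Type) (F : set_system T) (I : finType) (P : I -> T -> Prop) :
  Filter F -> (forall i, \forall x \near F, P i x) -> \forall x \near F, forall i, P i x.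
Proof.
move=> FF H.
suff : \forall x \near F, forall i, i \in enum I -> P i x.
  by apply: filterS => x Hx i; apply: Hx; rewrite mem_enum.
elim: (enum I) => [|j r IH]; first by near=> x.
near=> x => i; rewrite inE => /orP[/eqP ->|ir]; first by near: x.
by move: i ir; near: x.
Unshelve. all: by end_near. Qed.

Section PlaneMatrix.
Context (R : realType) (n : nat).
Local Notation C := R[i].
Local Notation M := 'M[R[i]]_n.+1.
Implicit Types (F : R * R -> M) (p v : R * R) (K : M).

(** The matrix valued 1-form [K1 dx + K2 dt]. *)
Definition mxform K1 K2 v : M := v.1%:C *: K1 + v.2%:C *: K2.

Lemma derive_plane (f : R * R -> R) p v : differentiable f p ->
  'D_v f p = v.1 * 'D_(1, 0) f p + v.2 * 'D_(0, 1) f p.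
Proof.
move=> df; rewrite !deriveE//.
have {1}-> : v = v.1 *: ((1, 0) : R * R) + v.2 *: ((0, 1) : R * R).
  by case: v => x y /=; congr pair; rewrite /= -![_ *: _]/(_ * _) !(mulr1, mulr0) ?addr0 ?add0r.
by rewrite linearD !linearZ.
Qed.

Lemma cderive_plane (f : R * R -> C) p v : cdifferentiable f p ->
  cderive v f p = v.1%:C * cderive ((1, 0) : R * R) f p
                  + v.2%:C * cderive ((0, 1) : R * R) f p.
Proof.
by move=> [d1 d2]; rewrite /cderive (derive_plane _ d1) (derive_plane _ d2) !real_complexM.
Qed.

Lemma mxderive_plane F p v : mxdifferentiable F p ->
  mxderive v F p = mxform (Dx F p) (Dt F p) v.
Proof. by move=> dF; apply/matrixP => i k; rewrite !mxE; exact: cderive_plane. Qed.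

Lemma norm1_form K1 K2 v : norm1 (mxform K1 K2 v) <= `|v| * (norm1 K1 + norm1 K2).
Proof.
have v1 : `|v.1| <= `|v| by rewrite prod_normE le_max lexx.
have v2 : `|v.2| <= `|v| by rewrite prod_normE le_max lexx orbT.
rewrite (le_trans (norm1D _ _))// mulrDr lerD// (le_trans (norm1Z _ _))// cnorm1_real.
  by rewrite ler_wpM2r ?norm1_ge0.
by rewrite ler_wpM2r ?norm1_ge0.
Qed.

Lemma mxformB K1 K2 L1 L2 v :
  mxform K1 K2 v - mxform L1 L2 v = mxform (K1 - L1) (K2 - L2) v.
Proof. by rewrite /mxform !scalerBr opprD addrACA. Qed.

Lemma mxformD K1 K2 L1 L2 v :
  mxform K1 K2 v + mxform L1 L2 v = mxform (K1 + L1) (K2 + L2) v.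
Proof. by rewrite /mxform !scalerDr addrACA. Qed.

Lemma mxform_mull K K1 K2 v : K *m mxform K1 K2 v = mxform (K *m K1) (K *m K2) v.
Proof. by rewrite /mxform mulmxDr -!scalemxAr. Qed.

Lemma mxformZ (c : C) K1 K2 v : c *: mxform K1 K2 v = mxform (c *: K1) (c *: K2) v.
Proof. by rewrite /mxform scalerDr !scalerA mulrC [c * _]mulrC. Qed.

Lemma mx_differentiable_plane F p K1 K2 :
  (forall e, 0 < e -> \forall v \near (0 : R * R),
     norm1 (F (v + p) - F p - mxform K1 K2 v) <= e * `|v|) ->
  [/\ mxdifferentiable F p, Dx F p = K1 & Dt F p = K2].
Proof.
move=> H.
have HR i k : differentiable (fun q => complex.Re (F q i k)) p /\
   'd (fun q => complex.Re (F q i k)) p =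
     plane_form (complex.Re (K1 i k)) (complex.Re (K2 i k)) :> (R * R -> R).
  apply: differentiable_bound => [|e e0]; first exact: plane_form_continuous.
  near=> v.
  apply: (@le_trans _ _ (norm1 (F (v + p) - F p - mxform K1 K2 v))); last first.
    by near: v; apply: H.
  apply: le_trans (norm1_entry _ i k); rewrite !mxE /cnorm1.
  rewrite !(complexReD, complexReN, complexReM) /= !mul0r !subr0.
  by rewrite /plane_form ![complex.Re (_ i k) * _]mulrC lerDl.
have HI i k : differentiable (fun q => complex.Im (F q i k)) p /\
   'd (fun q => complex.Im (F q i k)) p =
     plane_form (complex.Im (K1 i k)) (complex.Im (K2 i k)) :> (R * R -> R).
  apply: differentiable_bound => [|e e0]; first exact: plane_form_continuous.
  near=> v.
  apply: (@le_trans _ _ (norm1 (F (v + p) - F p - mxform K1 K2 v))); last first.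
    by near: v; apply: H.
  apply: le_trans (norm1_entry _ i k); rewrite !mxE /cnorm1.
  rewrite !(complexImD, complexImN, complexImM) /= !mul0r !addr0.
  by rewrite /plane_form ![complex.Im (_ i k) * _]mulrC lerDr.
have DE v i k : cderive v (fun q => F q i k) p =
    plane_form (complex.Re (K1 i k)) (complex.Re (K2 i k)) v
    +i* plane_form (complex.Im (K1 i k)) (complex.Im (K2 i k)) v.
  have [d1 e1] := HR i k; have [d2 e2] := HI i k.
  by rewrite /cderive (deriveE _ d1) (deriveE _ d2) e1 e2.
split.
- by move=> i k; split; [have [] := HR i k|have [] := HI i k].
- apply/matrixP => i k; rewrite mxE DE /plane_form /= !mulr1 !mulr0 !addr0.
  by case: (K1 i k).
- apply/matrixP => i k; rewrite mxE DE /plane_form /= !mulr1 !mulr0 !add0r.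
  by case: (K2 i k).
Unshelve. all: by end_near. Qed.

Lemma smooth_continuous (O : set (R * R)) F p e : mxsmooth_on O F -> O p -> 0 < e ->
  \forall q \near p, norm1 (F q - F p) <= e.
Proof.
move=> sF Op e0.
suff H i k : \forall q \near p, cnorm1 ((F q - F p) i k) <= e / (n.+1 * n.+1)%:R.
  have {}H : \forall q \near p, forall i k, cnorm1 ((F q - F p) i k) <= e / (n.+1 * n.+1)%:R.
    by apply: (@near_forall _ (nbhs p) 'I_n.+1) => i; apply: (@near_forall _ (nbhs p) 'I_n.+1) => k; exact: H.
  near=> q; apply: (@le_trans _ _ ((n.+1 * n.+1)%:R * (e / (n.+1 * n.+1)%:R))).
    by apply: sum_le_const => i k; move: i k; near: q.
  by rewrite mulrC divfK// pnatr_eq0.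
have [/(_ [::] p Op) d1 /(_ [::] p Op) d2] := sF i k.
set e' := _ / _; have e'0 : 0 < e' / 2 by rewrite !divr_gt0// ltr0n.
have /cvgrPdist_lt/(_ _ e'0) c1 := differentiable_continuous d1.
have /cvgrPdist_lt/(_ _ e'0) c2 := differentiable_continuous d2.
near=> q; rewrite [e']splitr mxE mxE /cnorm1 lerD//.
  by rewrite complexReD complexReN distrC ltW//; near: q; exact: c1.
by rewrite complexImD complexImN distrC ltW//; near: q; exact: c2.
Unshelve. all: by end_near. Qed.

Lemma near_unit (O : set (R * R)) (F : R * R -> M) : open O -> O 0 -> mxsmooth_on O F ->
  F 0 = 1%:M -> \forall p \near (0 : R * R), F p \in unitmx.
Proof.
move=> oO O0 sF F0; have [/(_ [::] 0 O0) d1 _] := csmooth_on_det oO sF.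
have /cvgrPdist_lt/(_ _ ltr01) c := differentiable_continuous d1.
near=> p; rewrite unitmxE unitfE; apply/negP => /eqP p0.
have : `|complex.Re (\det (F 0)) - complex.Re (\det (F p))| < 1 by near: p; exact: c.
by rewrite p0 F0 det1 /= subr0 normr1 ltxx.
Unshelve. all: by end_near. Qed.

End PlaneMatrix.

(** * Families of linear systems with a parameter *)

Section ParameterDependence.
Context (R : realType) (n : nat).
Local Notation C := R[i].
Local Notation M := 'M[R[i]]_n.+1.
Implicit Types (F : R * R -> M) (p q v : R * R) (h : C).

Lemma near_segment (p : R * R) (P : R * R -> Prop) : (\forall q \near p, P q) ->
  \forall v \near (0 : R * R), forall s : R, 0 <= s <= 1 -> P (p + s *: v).
Proof.
move=> /nbhs_ballP[r /= r0 rP]; near=> v => s /andP[s0 s1]; apply: rP.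
rewrite -ball_normE /= opprD addrA subrr add0r normrN normrZ ger0_norm//.
apply: (@le_lt_trans _ _ `|v|); first by rewrite ler_piMl.
near: v; apply/nbhs_ballP; exists r => //= w.
by rewrite -ball_normE /= sub0r normrN.
Unshelve. all: by end_near. Qed.

(** The mean value inequality for [Y h] minus the linear form [(K1 p, K2 p)] passes
    to the limit [h -> 0]. *)
Lemma limit_differentiable (O : set (R * R)) (Y : C -> R * R -> M) (G K1 K2 : R * R -> M) (c : R) p :
  open O -> O p -> 0 <= c ->
  (forall h q, small_param h -> O q -> mxdifferentiable (Y h) q) ->
  (forall h q, small_param h -> O q -> norm1 (Y h q - G q) <= c * cnorm1 h) ->
  (forall h q v, small_param h -> O q ->
     norm1 (mxderive v (Y h) q - mxform (K1 q) (K2 q) v) <= c * cnorm1 h * `|v|) ->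
  mxsmooth_on O K1 -> mxsmooth_on O K2 ->
  [/\ mxdifferentiable G p, Dx G p = K1 p & Dt G p = K2 p].
Proof.
move=> oO Op c0 dY YG DY sK1 sK2; apply: mx_differentiable_plane => e e0.
have d0 : 0 < real_dim R n by rewrite /real_dim ltr0n.
have dn0 : real_dim R n != 0 by rewrite gt_eqF.
have e4 : 0 < e / (2 * real_dim R n) by rewrite divr_gt0// mulr_gt0.
have nK1 := near_segment (smooth_continuous sK1 Op e4).
have nK2 := near_segment (smooth_continuous sK2 Op e4).
have nO := near_segment (open_nbhs_nbhs (conj oO Op)).
near=> v.
have vO : forall s : R, 0 <= s <= 1 -> O (p + s *: v) by near: v.
have vK1 : forall s : R, 0 <= s <= 1 -> norm1 (K1 (p + s *: v) - K1 p) <= e / (2 * real_dim R n).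
  by near: v.
have vK2 : forall s : R, 0 <= s <= 1 -> norm1 (K2 (p + s *: v) - K2 p) <= e / (2 * real_dim R n).
  by near: v.
have Ov : O (p + v) by have := vO 1; rewrite scale1r; apply; rewrite lexx ler01.
apply: (@le_small_param _ _ _ (real_dim R n * c * `|v| + 2 * c)); last first.
  by rewrite addr_ge0 ?mulr_ge0// ltW.
move=> h sh; pose L q := Y h q - mxform (K1 p) (K2 p) q.
have dform q : [/\ mxdifferentiable (mxform (K1 p) (K2 p)) q,
   Dx (mxform (K1 p) (K2 p)) q = K1 p & Dt (mxform (K1 p) (K2 p)) q = K2 p].
  apply: mx_differentiable_plane => e' e'0; near=> w.
  have -> : mxform (K1 p) (K2 p) (w + q) =
     mxform (K1 p) (K2 p) w + mxform (K1 p) (K2 p) q.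
    by rewrite /mxform /= !(raddfD, scalerDl) addrACA.
  by rewrite addrK subrr norm10 mulr_ge0// ltW.
have dL q : O q -> mxdifferentiable L q.
  by move=> Oq; apply: mxdifferentiableB; [exact: dY|have [] := dform q].
have EL : L (p + v) - L p = (Y h (p + v) - Y h p) - mxform (K1 p) (K2 p) v.
  rewrite /L; have -> : mxform (K1 p) (K2 p) (p + v) =
     mxform (K1 p) (K2 p) v + mxform (K1 p) (K2 p) p.
    by rewrite /mxform /= !(raddfD, scalerDl) addrACA addrC.
  move: (mxform _ _ v) (mxform _ _ p) => x y.
  by apply/matrixP => i k; rewrite !mxE; ring.
have H : norm1 (Y h (p + v) - Y h p - mxform (K1 p) (K2 p) v) <=
   real_dim R n * ((e / real_dim R n + c * cnorm1 h) * `|v|).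
  rewrite -EL; apply: mx_mean_value_le => s s01; first exact/dL/vO.
  rewrite mxderiveB; [|exact/dY/vO|by have [] := dform (p + s *: v)].
  rewrite [X in _ - X]mxderive_plane; last by have [] := dform (p + s *: v).
  have [_ -> ->] := dform (p + s *: v).
  have := DY h (p + s *: v) v sh (vO s s01); set A := mxderive _ _ _ => HA.
  rewrite -[A](subrK (mxform (K1 (p + s *: v)) (K2 (p + s *: v)) v)) -addrA mxformB.
  rewrite (le_trans (norm1D _ _))// addrC mulrDl lerD//.
  rewrite (le_trans (norm1_form _ _ _))// mulrC ler_wpM2r//.
  have := vK1 s s01; have := vK2 s s01.
  have -> : e / (2 * real_dim R n) = e / real_dim R n / 2 by field; rewrite ?dn0.
  by set x := e / _; lra.
have := YG h (p + v) sh Ov; have := YG h p sh Op; rewrite [v + p]addrC.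
have -> : G (p + v) - G p - mxform (K1 p) (K2 p) v =
  (Y h (p + v) - Y h p - mxform (K1 p) (K2 p) v) + ((Y h p - G p) - (Y h (p + v) - G (p + v))).
  by apply/matrixP => i k; rewrite !mxE; ring.
have := norm1D (Y h (p + v) - Y h p - mxform (K1 p) (K2 p) v)
  ((Y h p - G p) - (Y h (p + v) - G (p + v))).
have := norm1B (Y h p - G p) (Y h (p + v) - G (p + v)).
move: H; have -> : real_dim R n * ((e / real_dim R n + c * cnorm1 h) * `|v|) =
   e * `|v| + real_dim R n * c * `|v| * cnorm1 h by field; rewrite ?dn0.
lra.
Unshelve. all: by end_near. Qed.

(** Polynomials in the parameter with functions on the plane as coefficients. *)
Definition hpoly d (c : nat -> R * R -> M) h p : M := \sum_(l < d) h ^+ l *: c l p.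

Lemma hpoly_recl d c h p :
  hpoly d.+1 c h p = c 0%N p + h *: hpoly d (fun l => c l.+1) h p.
Proof.
rewrite /hpoly big_ord_recl expr0 scale1r scaler_sumr; congr (_ + _).
by apply: eq_bigr => l _; rewrite scalerA -exprS.
Qed.

Lemma norm1_hpoly d c h p B : cnorm1 h <= 1 -> (forall l, norm1 (c l p) <= B) ->
  norm1 (hpoly d c h p) <= d%:R * B.
Proof.
move=> h1 cB; rewrite (le_trans (norm1_sum _ _))//.
have -> : d%:R * B = \sum_(l < d) B by rewrite sumr_const card_ord mulr_natl.
apply: ler_sum => l _; rewrite (le_trans (norm1Z _ _))//.
by rewrite -[leRHS]mul1r ler_pM ?cnorm1_ge0 ?norm1_ge0// cnorm1X.
Qed.

(** [W h] solves [W' = h W K(h)] with [K(h)] polynomial in [h] and starts at the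
    identity.  On a bounded star-shaped set Gronwall's inequality bounds [W]
    uniformly in [h], so that [W - 1 = O(h)]. *)
Section Family.
Variables (O : set (R * R)) (d : nat) (c1 c2 : nat -> R * R -> M) (B : R).
Variable W : C -> R * R -> M.
Hypothesis oO : open O.
Hypothesis O0 : O 0.
Hypothesis starO : forall p (s : R), O p -> 0 <= s <= 1 -> O (s *: p).
Hypothesis O1 : forall p, O p -> `|p| <= 1.
Hypothesis c1s : forall l, mxsmooth_on O (c1 l).
Hypothesis c2s : forall l, mxsmooth_on O (c2 l).
Hypothesis c1B : forall l p, O p -> norm1 (c1 l p) <= B.
Hypothesis c2B : forall l p, O p -> norm1 (c2 l p) <= B.
Hypothesis Ws : forall h, small_param h -> mxsmooth_on O (W h).
Hypothesis W0 : forall h, small_param h -> W h 0 = 1%:M.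
Hypothesis WDx : forall h p, small_param h -> O p ->
  Dx (W h) p = h *: (W h p *m hpoly d.+2 c1 h p).
Hypothesis WDt : forall h p, small_param h -> O p ->
  Dt (W h) p = h *: (W h p *m hpoly d.+2 c2 h p).

Let b := d.+2%:R * B.
Let Om h p v := mxform (hpoly d.+2 c1 h p) (hpoly d.+2 c2 h p) v.
Let Om0 p v := mxform (c1 0%N p) (c2 0%N p) v.
Let Om1 h p v := mxform (hpoly d.+1 (fun l => c1 l.+1) h p)
                        (hpoly d.+1 (fun l => c2 l.+1) h p) v.
Let Om10 p v := mxform (c1 1%N p) (c2 1%N p) v.
Let Om2 h p v := mxform (hpoly d (fun l => c1 l.+2) h p)
                        (hpoly d (fun l => c2 l.+2) h p) v.

Let OmE h p v : Om h p v = Om0 p v + h *: Om1 h p v.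
Proof. by rewrite /Om /Om0 /Om1 mxformZ mxformD !hpoly_recl. Qed.

Let Om1E h p v : Om1 h p v = Om10 p v + h *: Om2 h p v.
Proof. by rewrite /Om1 /Om10 /Om2 mxformZ mxformD !hpoly_recl. Qed.

Let B0 : 0 <= B.
Proof. exact: le_trans (norm1_ge0 _) (c1B 0 O0). Qed.

Let b0 : 0 <= b.
Proof. by rewrite mulr_ge0. Qed.

Let hpoly_b k l (c : nat -> R * R -> M) h p : (k <= d.+2)%N -> small_param h ->
  (forall l, norm1 (c l p) <= B) -> norm1 (hpoly k (fun i => c (l + i)%N) h p) <= b.
Proof.
move=> kd [_ h1] cB; apply: (@le_trans _ _ (k%:R * B)).
  by apply: norm1_hpoly => // i; exact: cB.
by rewrite ler_wpM2r// ler_nat.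
Qed.

Let form_b (K1 K2 : M) v : norm1 K1 <= b -> norm1 K2 <= b ->
  norm1 (mxform K1 K2 v) <= 2 * b * `|v|.
Proof.
move=> k1 k2; rewrite (le_trans (norm1_form _ _ _))// mulrC ler_wpM2r//; lra.
Qed.

Let Om_b h p v : small_param h -> O p -> norm1 (Om h p v) <= 2 * b * `|v|.
Proof.
move=> sh Op; apply: form_b.
  by apply: (hpoly_b 0) => // l; exact: c1B.
by apply: (hpoly_b 0) => // l; exact: c2B.
Qed.

Let Om1_b h p v : small_param h -> O p -> norm1 (Om1 h p v) <= 2 * b * `|v|.
Proof.
move=> sh Op; apply: form_b.
  by apply: (hpoly_b 1) => // l; exact: c1B.
by apply: (hpoly_b 1) => // l; exact: c2B.
Qed.

Let Om2_b h p v : small_param h -> O p -> norm1 (Om2 h p v) <= 2 * b * `|v|.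
Proof.
move=> sh Op; apply: form_b.
  by apply: (hpoly_b 2) => [|//|l]; [rewrite !leqW|exact: c1B].
by apply: (hpoly_b 2) => [|//|l]; [rewrite !leqW|exact: c2B].
Qed.

Let star_le (F : R * R -> M) p k : O p -> 0 <= k ->
  (forall q, O q -> mxdifferentiable F q) ->
  (forall q v, O q -> norm1 (mxderive v F q) <= k * `|v|) -> F 0 = 0 ->
  norm1 (F p) <= real_dim R n * k.
Proof.
move=> Op k0 dF kF F0; have := @mx_mean_value_le _ _ _ F 0 p k _ _.
rewrite add0r F0 subr0; apply=> s s01; rewrite add0r; first exact/dF/starO.
rewrite (le_trans (kF _ _ _))//; first exact: starO.
by rewrite -[leRHS]mulr1 ler_wpM2l// O1.
Qed.

Let WD h p v : small_param h -> O p -> mxderive v (W h) p = h *: (W h p *m Om h p v).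
Proof.
move=> sh Op; rewrite mxderive_plane; last exact: mxsmooth_on_diff (Ws sh) Op.
by rewrite WDx// WDt// /Om mxform_mull mxformZ.
Qed.

Let Wbound : exists2 B1, 0 <= B1 & forall h p, small_param h -> O p -> norm1 (W h p) <= B1.
Proof.
exists (real_dim R n + expR (1 + (2 * b) ^+ 2 * (2 * real_dim R n)) * normsq (1%:M : M)).
  by rewrite addr_ge0 ?real_dim_ge0// mulr_ge0 ?expR_ge0 ?normsq_ge0.
move=> h p sh Op; rewrite (le_trans (norm1_le_normsq _))// lerD2l -(W0 sh).
rewrite -[p in leLHS]add0r; apply: mx_gronwall => s s01; rewrite add0r.
  by apply: mxsmooth_on_diff (Ws sh) _; exact: starO.
have Os := starO Op s01; rewrite WD// (le_trans (norm1Z _ _))//.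
rewrite -[leRHS]mul1r ler_pM ?cnorm1_ge0 ?norm1_ge0 ?(proj2 sh)//.
rewrite (le_trans (norm1M _ _))// mulrC ler_wpM2r ?norm1_ge0//.
rewrite (le_trans (Om_b _ sh Os))// -[leRHS]mulr1 ler_wpM2l ?O1//.
by rewrite mulr_ge0.
Qed.

Let Vq h q : M := h^-1 *: (W h q - 1%:M).

Let WV h q : small_param h -> W h q = 1%:M + h *: Vq h q.
Proof. by move=> [h0 _]; rewrite /Vq scalerA divff// scale1r addrC subrK. Qed.

Let Vd h q : small_param h -> O q -> mxdifferentiable (Vq h) q.
Proof.
move=> sh Oq; apply: mxdifferentiableZ; apply: mxdifferentiableB.
  exact: mxsmooth_on_diff (Ws sh) Oq.
exact: mxdifferentiable_cst.
Qed.

Let VD h q v : small_param h -> O q -> mxderive v (Vq h) q = W h q *m Om h q v.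
Proof.
move=> sh Oq; have dW := mxsmooth_on_diff (Ws sh) Oq.
have d1 := mxdifferentiable_cst (1%:M : M) q.
rewrite /Vq mxderiveZ; last exact: mxdifferentiableB.
rewrite (mxderiveB v dW d1) mxderive_cst subr0 WD// scalerA mulVf ?scale1r//.
by case: sh.
Qed.

Let V0 h : small_param h -> Vq h 0 = 0.
Proof. by move=> sh; rewrite /Vq W0// subrr scaler0. Qed.

Let VDE h q v : small_param h -> O q -> mxderive v (Vq h) q =
  Om0 q v + h *: (Vq h q *m Om h q v + Om1 h q v).
Proof.
move=> sh Oq; rewrite VD// WV// mulmxDl mul1mx {1}OmE -addrA; congr (_ + _).
by rewrite [RHS]scalerDr -scalemxAl [LHS]addrC.
Qed.

Let Vbound : exists2 BV, 0 <= BV & forall h p, small_param h -> O p -> norm1 (Vq h p) <= BV.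
Proof.
have [B1 B10 WB] := Wbound; exists (real_dim R n * (B1 * (2 * b))).
  by rewrite !mulr_ge0 ?real_dim_ge0.
move=> h p sh Op; apply: star_le => //.
- by rewrite !mulr_ge0.
- by move=> q; exact: Vd.
- move=> q v Oq; rewrite VD// (le_trans (norm1M _ _))// -mulrA ler_pM ?norm1_ge0//.
    exact: WB.
  exact: Om_b.
- exact: V0.
Qed.

(** [(W h - 1) / h] vanishes at the origin, and its derivative [W h K(h)] converges
    uniformly at rate [O(h)]; hence so does the function itself. *)
Lemma family_first_order : exists (G : R * R -> M) (B4 : R),
  [/\ 0 <= B4, forall h p, small_param h -> O p -> norm1 (Vq h p - G p) <= B4 * cnorm1 h,
      mxsmooth_on O G, (forall p, O p -> Dx G p = c1 0%N p /\ Dt G p = c2 0%N p) &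
      G 0 = 0] .
Proof.
have [BV BV0 VB] := Vbound.
pose B3 := BV * (2 * b) + 2 * b.
have B30 : 0 <= B3 by rewrite addr_ge0 ?mulr_ge0 ?real_dim_ge0.
have DVB h q v : small_param h -> O q ->
    norm1 (mxderive v (Vq h) q - Om0 q v) <= B3 * cnorm1 h * `|v|.
  move=> sh Oq; rewrite VDE// addrC addKr (le_trans (norm1Z _ _))//.
  rewrite mulrAC [leRHS]mulrC ler_wpM2l ?cnorm1_ge0// /B3 mulrDl.
  rewrite (le_trans (norm1D _ _))// lerD//; last exact: Om1_b.
  rewrite (le_trans (norm1M _ _))// -mulrA ler_pM ?norm1_ge0//; first exact: VB.
  exact: Om_b.
have lim p : O p -> exists L, forall h, small_param h ->
    norm1 (Vq h p - L) <= real_dim R n * (real_dim R n * B3) * cnorm1 h.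
  move=> Op; apply: mx_limit => h h' sh sh'.
  rewrite -mulrA; apply: (star_le (F := fun q => Vq h q - Vq h' q)) => //.
  - by rewrite mulr_ge0// addr_ge0 ?cnorm1_ge0.
  - by move=> q Oq; apply: mxdifferentiableB; exact: Vd.
  - move=> q v Oq; rewrite mxderiveB; [|exact: Vd|exact: Vd].
    rewrite -(subrKA (Om0 q v)) (le_trans (norm1D _ _))//.
    rewrite mulrDr mulrDl lerD//; first exact: DVB.
    by rewrite norm1BC; exact: DVB.
  - by rewrite !V0// subrr.
have limO p : exists L, O p -> forall h, small_param h ->
    norm1 (Vq h p - L) <= real_dim R n * (real_dim R n * B3) * cnorm1 h.
  by have [Op|nOp] := pselect (O p); [have [L HL] := lim p Op; exists L|exists 0].
pose G p := projT1 (cid (limO p)).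
have GP p : O p -> forall h, small_param h ->
    norm1 (Vq h p - G p) <= real_dim R n * (real_dim R n * B3) * cnorm1 h.
  exact: (projT2 (cid (limO p))).
pose B4 := Num.max B3 (real_dim R n * (real_dim R n * B3)).
have B4g : B3 <= B4 /\ real_dim R n * (real_dim R n * B3) <= B4.
  by rewrite /B4 !le_max !lexx orbT.
have Gd p : O p -> [/\ mxdifferentiable G p, Dx G p = c1 0%N p & Dt G p = c2 0%N p].
  move=> Op; apply: (@limit_differentiable O Vq G (c1 0%N) (c2 0%N) B4) => //.
  - by rewrite (le_trans B30)//; case: B4g.
  - move=> h q sh Oq; rewrite (le_trans (GP q Oq h sh))//.
    by rewrite ler_wpM2r ?cnorm1_ge0//; case: B4g.
  - move=> h q v sh Oq; rewrite (le_trans (DVB h q v sh Oq))//.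
    by rewrite ler_wpM2r// ler_wpM2r ?cnorm1_ge0//; case: B4g.
exists G, B4; split.
- by rewrite (le_trans B30)//; case: B4g.
- move=> h q sh Oq; rewrite (le_trans (GP q Oq h sh))//.
  by rewrite ler_wpM2r ?cnorm1_ge0//; case: B4g.
- apply: mxsmooth_on_of_derive => // [p Op|v]; first by have [] := Gd p Op.
  apply: (@eq_mxsmooth_on _ _ _ _ oO (Om0^~ v)) => [p Op|].
    by have [d1 d2 d3] := Gd p Op; rewrite mxderive_plane// d2 d3.
  by apply: mxsmooth_onD => //; apply: mxsmooth_onZ.
- by move=> p Op; have [] := Gd p Op.
- apply: norm1_eq0; apply/eqP; rewrite eq_le norm1_ge0 andbT.
  apply: (@le_small_param _ _ _ (real_dim R n * (real_dim R n * B3))); last first.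
    by rewrite !mulr_ge0 ?real_dim_ge0.
  by move=> h sh; have := GP 0 O0 h sh; rewrite V0// sub0r norm1N add0r.
Qed.

(** The same argument for the next difference quotient: the derivative of
    [((W h - 1) / h - G) / h] converges at rate [O(h)]. *)
Lemma family_second_order : exists (G : R * R -> M) (H : R * R -> M) (c : R),
  [/\ forall h p, small_param h -> O p ->
        norm1 (h^-1 *: (h^-1 *: (W h p - 1%:M) - G p) - H p) <= c * cnorm1 h,
      mxsmooth_on O G, (forall p, O p -> Dx G p = c1 0%N p /\ Dt G p = c2 0%N p) &
      G 0 = 0].
Proof.
have [G [B4 [B40 VG sG GD G0]]] := family_first_order.
have [BV BV0 VB] := Vbound.
pose B5 := BV + B4.
have GB p : O p -> norm1 (G p) <= B5.
  move=> Op; have [h sh _] := @small_param_exists R 1 ltr01.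
  rewrite -[G p](subKr (Vq h p)) (le_trans (norm1B _ _))// lerD ?VB//.
  by rewrite (le_trans (VG h p sh Op))// -[leRHS]mulr1 ler_wpM2l//; case: sh.
have B50 : 0 <= B5 by rewrite addr_ge0 ?mulr_ge0 ?real_dim_ge0.
pose Z h q := h^-1 *: (Vq h q - G q).
have Zd h q : small_param h -> O q -> mxdifferentiable (Z h) q.
  move=> sh Oq; apply: mxdifferentiableZ; apply: mxdifferentiableB; first exact: Vd.
  exact: mxsmooth_on_diff sG Oq.
have ZD h q v : small_param h -> O q -> mxderive v (Z h) q = Vq h q *m Om h q v + Om1 h q v.
  move=> sh Oq; have dG := mxsmooth_on_diff sG Oq; have dV := Vd sh Oq.
  rewrite /Z mxderiveZ; last exact: mxdifferentiableB.
  rewrite (mxderiveB v dV dG) VDE// mxderive_plane//; have [-> ->] := GD q Oq.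
  by rewrite [X in _ *: X]addrC addKr scalerA mulVf ?scale1r//; case: sh.
pose L q v := G q *m Om0 q v + Om10 q v.
pose B6 := B4 * (2 * b) + B5 * (2 * b) + 2 * b.
have B60 : 0 <= B6 by rewrite !addr_ge0 ?mulr_ge0.
have DZB h q v : small_param h -> O q ->
    norm1 (mxderive v (Z h) q - L q v) <= B6 * cnorm1 h * `|v|.
  move=> sh Oq; rewrite ZD//.
  have -> : Vq h q *m Om h q v + Om1 h q v - L q v =
     (Vq h q - G q) *m Om h q v + h *: (G q *m Om1 h q v) + h *: Om2 h q v.
    have E1 : G q *m Om h q v = G q *m Om0 q v + h *: (G q *m Om1 h q v).
      by rewrite OmE mulmxDr -scalemxAr.
    rewrite /L mulmxBl E1 {1}Om1E.
    move: (Vq h q *m _) (G q *m _) (G q *m _) (Om10 q v) (Om2 h q v) => x y z o1 o2.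
    by apply/matrixP => i k; rewrite !mxE; ring.
  rewrite /B6 2!mulrDl 2!mulrDl; rewrite (le_trans (norm1D _ _))// lerD//; last first.
    rewrite (le_trans (norm1Z _ _))// [2 * b * _]mulrC -mulrA.
    by rewrite ler_wpM2l ?cnorm1_ge0// Om2_b.
  rewrite (le_trans (norm1D _ _))// lerD//.
    rewrite (le_trans (norm1M _ _))//.
    rewrite [leRHS](_ : _ = B4 * cnorm1 h * (2 * b * `|v|)); last by ring.
    by rewrite ler_pM ?norm1_ge0// ?VG// Om_b.
  rewrite (le_trans (norm1Z _ _))//.
  rewrite [leRHS](_ : _ = cnorm1 h * (B5 * (2 * b * `|v|))); last by ring.
  rewrite ler_wpM2l ?cnorm1_ge0// (le_trans (norm1M _ _))//.
  by rewrite ler_pM ?norm1_ge0// ?GB// Om1_b.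
have lim p : O p -> exists L, forall h, small_param h ->
    norm1 (Z h p - L) <= real_dim R n * (real_dim R n * B6) * cnorm1 h.
  move=> Op; apply: mx_limit => h h' sh sh'.
  rewrite -mulrA; apply: (star_le (F := fun q => Z h q - Z h' q)) => //.
  - by rewrite mulr_ge0// addr_ge0 ?cnorm1_ge0.
  - by move=> q Oq; apply: mxdifferentiableB; exact: Zd.
  - move=> q v Oq; rewrite mxderiveB; [|exact: Zd|exact: Zd].
    rewrite -(subrKA (L q v)) (le_trans (norm1D _ _))//.
    rewrite mulrDr mulrDl lerD//; first exact: DZB.
    by rewrite norm1BC; exact: DZB.
  - by rewrite /Z !V0// G0 subrr !scaler0 subrr.
have limO p : exists L, O p -> forall h, small_param h ->
    norm1 (Z h p - L) <= real_dim R n * (real_dim R n * B6) * cnorm1 h.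
  by have [Op|nOp] := pselect (O p); [have [L' HL] := lim p Op; exists L'|exists 0].
exists G, (fun p => projT1 (cid (limO p))), (real_dim R n * (real_dim R n * B6)); split=> //.
by move=> h p sh Op; exact: (projT2 (cid (limO p)) Op h sh).
Qed.

End Family.

End ParameterDependence.

(** * Holomorphic functions *)

Section Holomorphic.
Context (R : realType).
Local Notation C := R[i].
Implicit Types (f g : C -> C) (x z : C).

Lemma normc_le_cnorm1 x : `|x| <= (cnorm1 x)%:C.
Proof.
case: x => a b; rewrite normc_def /= lecR /cnorm1 /=.
rewrite -[leRHS]ger0_norm ?addr_ge0// -sqrtr_sqr ler_wsqrtr//.
have := real_normK (num_real a); have := real_normK (num_real b).
by have := normr_ge0 a; have := normr_ge0 b; nra.
Qed.

Lemma cnorm1_le_normc x : (cnorm1 x)%:C <= 2 * `|x|.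
Proof.
case: x => a b; rewrite normc_def /cnorm1 /= rmorphD /= mulr_natl mulr2n.
rewrite lerD// lecR -sqrtr_sqr ler_wsqrtr//; last by rewrite lerDr sqr_ge0.
by rewrite lerDl sqr_ge0.
Qed.

Lemma near_neq z x : z != x -> \forall w \near (z : C^o), w != x.
Proof.
move=> zx; apply/nbhs_ballP; exists `|z - x|; first by rewrite /= normr_gt0 subr_eq0.
by move=> w; rewrite -ball_normE /=; apply: contraTneq => ->; rewrite ltxx.
Qed.

Lemma holomorphic_near f g z : (\forall w \near (z : C^o), f w = g w) ->
  holomorphic_at f z -> holomorphic_at g z.
Proof. exact: (@near_eq_derivable C C^o C^o f g z 1). Qed.

Lemma holomorphic_cst c z : holomorphic_at (fun=> c) z.
Proof. exact: derivable_cst. Qed.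

Lemma holomorphic_id z : holomorphic_at id z.
Proof. exact: derivable_id. Qed.

Lemma holomorphicD f g z : holomorphic_at f z -> holomorphic_at g z ->
  holomorphic_at (fun w => f w + g w) z.
Proof. by move=> fz gz; exact: derivableD fz gz. Qed.

Lemma holomorphicM f g z : holomorphic_at f z -> holomorphic_at g z ->
  holomorphic_at (fun w => f w * g w) z.
Proof. by move=> fz gz; exact: derivableM fz gz. Qed.

Lemma holomorphicV f z : f z != 0 -> holomorphic_at f z ->
  holomorphic_at (fun w => (f w)^-1) z.
Proof. by move=> fz0 fz; exact: derivableV fz0 fz. Qed.

Lemma holomorphic_sum (I : Type) (r : seq I) (F : I -> C -> C) z :
  (forall i, holomorphic_at (F i) z) ->
  holomorphic_at (fun w => \sum_(i <- r) F i w) z.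
Proof.
move=> dF; elim: r => [|i r IH].
  by under eq_fun do rewrite big_nil; exact: holomorphic_cst.
under eq_fun do rewrite big_cons.
exact: (@holomorphicD (F i) (fun w => \sum_(i <- r) F i w) z (dF i) IH).
Qed.

Lemma holomorphic_of_bound f z (L : C) (c : R) :
  (forall h, small_param h -> cnorm1 (h^-1 * (f (z + h) - f z) - L) <= c * cnorm1 h) ->
  holomorphic_at f z.
Proof.
move=> fL.
have c0 : 0 <= c.
  have [h [h0 h1] _] := @small_param_exists R 1 ltr01.
  have := fL h (conj h0 h1); have := cnorm1_ge0 (h^-1 * (f (z + h) - f z) - L).
  have : 0 < cnorm1 h.
    rewrite lt_neqAle cnorm1_ge0 andbT eq_sym; apply/negP => /eqP/cnorm1_eq0 hE.
    by rewrite hE eqxx in h0.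
  nra.
apply/cvg_ex; exists L; apply/cvgrPdist_le => e e0; near=> h.
have h0 : h != 0 by near: h; exact: nbhs_dnbhs_neq.
have hs : `|h| <= 2^-1.
  near: h; apply: dnbhs0_le; by rewrite invr_gt0 ltr0n.
have he : `|h| <= e / (2 * (c%:C + 1)).
  near: h; apply: dnbhs0_le; rewrite divr_gt0// mulr_gt0// ltr_wpDl// lecR//.
have sh : small_param h.
  split=> //; rewrite -(lecR) (le_trans (cnorm1_le_normc _))//.
  by rewrite -ler_pdivlMl ?ltr0n// mulr1.
rewrite distrC (le_trans (normc_le_cnorm1 _))//.
apply: (@le_trans _ _ ((c * cnorm1 h)%:C)).
  rewrite lecR; apply: le_trans (fL h sh).
  by rewrite /= -[h *: (1 : C^o)]/(h * 1) mulr1 [h + z]addrC.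
rewrite rmorphM /=; apply: (@le_trans _ _ (c%:C * (2 * `|h|))).
  by rewrite ler_wpM2l ?cnorm1_le_normc// lecR.
have c1 : 0 < c%:C + 1 by rewrite ltr_wpDl// lecR.
apply: (@le_trans _ _ ((c%:C + 1) * (2 * `|h|))).
  by rewrite ler_wpM2r ?mulr_ge0// lerDl.
by rewrite mulrA [(_ + 1) * 2]mulrC [_ * `|h|]mulrC -ler_pdivlMr ?mulr_gt0.
Unshelve. all: by end_near. Qed.

End Holomorphic.

(** * Divided differences of the trivialization *)

Section PlaneBall.
Context (R : realType).

Lemma plane_ballE (r : R) (p : R * R) : ball (0 : R * R) r p <-> `|p| < r.
Proof. by rewrite -ball_normE /= sub0r normrN. Qed.

Lemma plane_ball_star (r : R) p (s : R) : ball (0 : R * R) r p -> 0 <= s <= 1 ->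
  ball (0 : R * R) r (s *: p).
Proof.
move=> /plane_ballE pr /andP[s0 s1]; apply/plane_ballE; rewrite normrZ ger0_norm//.
by apply: le_lt_trans pr; rewrite ler_piMl.
Qed.

Lemma near_plane_ball (P : R * R -> Prop) : (\forall p \near (0 : R * R), P p) ->
  exists r : R, [/\ 0 < r, r <= 1 & forall p, ball (0 : R * R) r p -> P p].
Proof.
move=> /nbhs_ballP[r /= r0 rP]; exists (Num.min r 1); split.
- by rewrite lt_min r0 ltr01.
- by rewrite ge_min lexx orbT.
move=> p /plane_ballE; rewrite lt_min => /andP[pr _]; apply: rP.
exact/plane_ballE.
Qed.

End PlaneBall.

Section PowerDifference.
Context (R : realType) (al : R[i]).
Local Notation C := R[i].

Definition ddpow m (x : C) : C := \sum_(i < m) x ^+ (m.-1 - i) * al ^+ i.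

Lemma ddpowE m x : x ^+ m - al ^+ m = (x - al) * ddpow m x.
Proof. exact: subrXX. Qed.

Definition ddpow_poly m : {poly C} :=
  \sum_(i < m) ('X + al%:P) ^+ (m.-1 - i) * (al ^+ i)%:P.

Lemma horner_ddpow_poly m h : (ddpow_poly m).[h] = ddpow m (al + h).
Proof.
rewrite /ddpow_poly horner_sum; apply: eq_bigr => i _.
by rewrite hornerM hornerC horner_exp hornerD hornerX hornerC [h + _]addrC.
Qed.

End PowerDifference.

Section MatrixPolynomials.
Context (R : realType) (n : nat).
Local Notation C := R[i].
Local Notation M := 'M[R[i]]_n.+1.

Definition lampoly (q : nat -> M) j (lam : C) : M := \sum_(k < j.+1) lam ^+ (j - k) *: q k.

Definition ddlampoly (q : nat -> M) j (al lam : C) : M :=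
  \sum_(k < j.+1) ddpow al (j - k) lam *: q k.

Lemma lampolyB q j al lam :
  lampoly q j lam - lampoly q j al = (lam - al) *: ddlampoly q j al lam.
Proof.
rewrite /lampoly /ddlampoly -sumrB scaler_sumr; apply: eq_bigr => k _.
by rewrite -scalerBl ddpowE scalerA.
Qed.

End MatrixPolynomials.

Section DividedDifference.
Context (R : realType) (n : nat).
Local Notation C := R[i].
Local Notation M := 'M[R[i]]_n.+1.
Variables (U : set (R * R)) (a : M) (u : R * R -> M) (j : nat) (q : nat -> R * R -> M).
Variables (E : R * R -> C -> M) (al : C).
Hypothesis oU : open U.
Hypothesis U0 : U 0.
Hypothesis qs : forall k, mxsmooth_on U (q k).
Hypothesis Es : forall lam, mxsmooth_on U (fun p => E p lam).
Hypothesis Eh : forall p, U p -> forall i k lam, holomorphic_at (fun z => E p z i k) lam.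
Hypothesis EDx : forall p lam, U p ->
  Dx (fun q => E q lam) p = E p lam *m (lam *: a + u p).
Hypothesis EDt : forall p lam, U p ->
  Dt (fun q => E q lam) p = E p lam *m lampoly (q^~ p) j lam.
Hypothesis E0 : forall lam, E 0 lam = 1%:M.

Let d := (\sum_(k < j.+1) size (ddpow_poly al (j - k)))%N.

Let F p := invmx (E p al).

Let c1 l p : M := if l == 0%N then E p al *m a *m F p else 0.
Let c2 l p : M := \sum_(k < j.+1) (ddpow_poly al (j - k))`_l *: (E p al *m q k p *m F p).

Let c1E h p : hpoly d.+2 c1 h p = E p al *m a *m F p.
Proof.
rewrite /hpoly big_ord_recl expr0 scale1r {1}/c1 /= big1 ?addr0// => l _.
by rewrite /c1 /= scaler0.
Qed.

Let c2_large l p : (d <= l)%N -> c2 l p = 0.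
Proof.
move=> dl; apply: big1 => k _; rewrite nth_default ?scale0r//.
by apply: leq_trans dl; rewrite /d (bigD1 k)//= leq_addr.
Qed.

Let c2E h p : hpoly d.+2 c2 h p = E p al *m ddlampoly (q^~ p) j al (al + h) *m F p.
Proof.
rewrite /hpoly /c2 /ddlampoly mulmx_sumr mulmx_suml.
under eq_bigr do rewrite scaler_sumr.
rewrite exchange_big /=; apply: eq_bigr => k _.
rewrite -scalemxAr -scalemxAl -horner_ddpow_poly (@horner_coef_wide _ d.+2); last first.
  by rewrite !leqW// /d (bigD1 k)//= leq_addr.
rewrite scaler_suml; apply: eq_bigr => l _; by rewrite scalerA mulrC.
Qed.

(** [(E lam - E al) / (lam - al)] extends over [lam = al], smoothly on a ball and
    holomorphically in [lam].  Indeed [W h = E (al + h) (E al)^-1] solves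
    [W' = h W K(h)], and [family_second_order] gives the value [G E(al)] at
    [al] and the derivative there. *)
Lemma divided_difference : exists r : R, [/\ 0 < r, r <= 1,
  forall p, ball (0 : R * R) r p -> U p /\ E p al \in unitmx &
  exists dq : R * R -> C -> M, let O := ball (0 : R * R) r in
  [/\ (forall p lam, O p -> (lam - al) *: dq p lam = E p lam - E p al) /\
      (forall lam, dq 0 lam = 0),
      forall lam, mxsmooth_on O (fun p => dq p lam),
      forall p, O p -> forall i k lam, holomorphic_at (fun z => dq p z i k) lam,
      forall p lam, O p -> Dx (fun q => dq q lam) p =
        dq p lam *m (al *: a + u p) + E p lam *m a &
      forall p lam, O p -> Dt (fun q => dq q lam) p =
        dq p lam *m lampoly (q^~ p) j al + E p lam *m ddlampoly (q^~ p) j al lam]].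
Proof.
have nU : \forall p \near (0 : R * R), U p by exact: open_nbhs_nbhs.
have nE : \forall p \near (0 : R * R), E p al \in unitmx.
  exact: near_unit oU U0 (Es al) (E0 al).
have [r1 [r10 r11 r1P]] : exists r : R, [/\ 0 < r, r <= 1 &
    forall p, ball (0 : R * R) r p -> U p /\ E p al \in unitmx].
  by apply: near_plane_ball; near=> p; split; near: p.
pose O1 := ball (0 : R * R) r1.
have oO1 : open O1 by exact: ball_open.
have O10 : O1 0 by exact: ballxx.
have O1U p : O1 p -> U p by move=> /r1P[].
have O1E p : O1 p -> E p al \in unitmx by move=> /r1P[].
have Es1 lam : mxsmooth_on O1 (fun p => E p lam) by exact: mxsmooth_on_sub (Es lam).
have Fs1 : mxsmooth_on O1 F by exact: mxsmooth_onV.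
have qs1 k : mxsmooth_on O1 (q k) by exact: mxsmooth_on_sub (qs k).
have c1s l : mxsmooth_on O1 (c1 l).
  rewrite /c1; case: (l == 0%N); last exact: mxsmooth_on_cst.
  apply: mxsmooth_onM => //; apply: mxsmooth_onM => //; exact: mxsmooth_on_cst.
have c2s l : mxsmooth_on O1 (c2 l).
  apply: mxsmooth_on_sum => // k; apply: mxsmooth_onZ => //.
  by apply: mxsmooth_onM => //; apply: mxsmooth_onM.
pose B0 := \sum_(l < d.+2) (norm1 (c1 l 0) + norm1 (c2 l 0) + 1).
have B0l l : norm1 (c1 l 0) + norm1 (c2 l 0) + 1 <= B0 \/ (d.+2 <= l)%N.
  have [ld|] := leqP d.+2 l; [by right|move=> ld; left].
  rewrite /B0 (bigD1 (Ordinal ld))//= lerDl sumr_ge0// => k _.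
  by rewrite !addr_ge0 ?norm1_ge0.
have B00 : 0 <= B0.
  by apply: sumr_ge0 => k _; rewrite !addr_ge0 ?norm1_ge0.
have nB : \forall p \near (0 : R * R), forall l : 'I_d.+2,
    norm1 (c1 l p) <= B0 /\ norm1 (c2 l p) <= B0.
  apply: (@near_forall _ (nbhs (0 : R * R)) 'I_d.+2) => l.
  have H (c : nat -> R * R -> M) : mxsmooth_on O1 (c l) ->
      \forall p \near (0 : R * R), norm1 (c l p) <= norm1 (c l 0) + 1.
    move=> /smooth_continuous/(_ O10 ltr01) ns; near=> p.
    rewrite -[c l p](subrK (c l 0)) addrC (le_trans (norm1D _ _))// lerD2l.
    by near: p.
  near=> p.
  have h1 : norm1 (c1 l p) <= norm1 (c1 l 0) + 1 by near: p; exact: H.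
  have h2 : norm1 (c2 l p) <= norm1 (c2 l 0) + 1 by near: p; exact: H.
  have [B0le|] := B0l l; last by rewrite leqNgt ltn_ord.
  split; [apply: le_trans h1 _|apply: le_trans h2 _]; apply: le_trans B0le.
    by rewrite -addrA lerD2l lerDr norm1_ge0.
  by rewrite -addrA lerDr norm1_ge0.
have [r2 [r20 r21 r2P]] : exists r : R, [/\ 0 < r, r <= 1 &
    forall p, ball (0 : R * R) r p -> O1 p /\
      forall l : 'I_d.+2, norm1 (c1 l p) <= B0 /\ norm1 (c2 l p) <= B0].
  have nO1 : \forall p \near (0 : R * R), O1 p by exact: open_nbhs_nbhs.
  by apply: near_plane_ball; near=> p; split; near: p.
exists r2; split=> //; first by move=> p /r2P[/r1P].
pose O := ball (0 : R * R) r2.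
have oO : open O by exact: ball_open.
have O0 : O 0 by exact: ballxx.
have OO1 p : O p -> O1 p by move=> /r2P[].
have OU p : O p -> U p by move=> /OO1/O1U.
have OE p : O p -> E p al \in unitmx by move=> /OO1/O1E.
have starO p (s : R) : O p -> 0 <= s <= 1 -> O (s *: p) by exact: plane_ball_star.
have Ole p : O p -> `|p| <= 1.
  by move=> /plane_ballE pr; rewrite (le_trans (ltW pr)).
have c1B l p : O p -> norm1 (c1 l p) <= B0.
  move=> Op; have [ld|ld] := ltnP l d.+2; first by have [_ /(_ (Ordinal ld))[]] := r2P p Op.
  by rewrite /c1; case: l ld => // l _ /=; rewrite norm10.
have c2B l p : O p -> norm1 (c2 l p) <= B0.
  move=> Op; have [ld|ld] := ltnP l d.+2; first by have [_ /(_ (Ordinal ld))[]] := r2P p Op.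
  by rewrite c2_large ?norm10//; apply: leq_trans ld; rewrite !leqW.
have sO : forall F' : R * R -> M, mxsmooth_on O1 F' -> mxsmooth_on O F'.
  by move=> F0 F0s; apply: mxsmooth_on_sub F0s => p; exact: OO1.
pose W h p := E p (al + h) *m F p.
have Ws h : mxsmooth_on O (W h) by apply: sO; exact: mxsmooth_onM.
have W0 h : W h 0 = 1%:M by rewrite /W /F !E0 mul1mx invmx1.
have WD v h p (Om Om' : M) : O p ->
    mxderive v (fun q => E q (al + h)) p = E p (al + h) *m Om' ->
    mxderive v (fun q => E q al) p = E p al *m Om ->
    mxderive v (W h) p = E p (al + h) *m (Om' - Om) *m F p.
  move=> Op e1 e2; have O1p := OO1 _ Op.
  have dE := mxsmooth_on_diff (Es1 (al + h)) O1p.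
  have dF := mxsmooth_on_diff Fs1 O1p.
  rewrite /W (mxderiveM v dE dF) e1 /F (mxderiveV oO1 v O1E (Es1 al) O1p) e2.
  rewrite mulNmx mulKmx ?O1E// mulNmx mulmxN mulmxBr mulmxBl; congr (_ - _).
  by rewrite !mulmxA.
have alh h : al + h - al = h by rewrite addrC addKr.
have WDx h p : small_param h -> O p -> Dx (W h) p = h *: (W h p *m hpoly d.+2 c1 h p).
  move=> sh Op; rewrite c1E /Dx.
  rewrite (WD _ _ _ _ _ Op (EDx (al + h) (OU _ Op)) (EDx al (OU _ Op))).
  rewrite opprD addrACA subrr addr0 -scalerBl alh.
  rewrite -scalemxAr -scalemxAl; congr (_ *: _).
  by rewrite /W !mulmxA /F mulmxKV ?OE.
have WDt h p : small_param h -> O p -> Dt (W h) p = h *: (W h p *m hpoly d.+2 c2 h p).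
  move=> sh Op; rewrite c2E /Dt.
  rewrite (WD _ _ _ _ _ Op (EDt (al + h) (OU _ Op)) (EDt al (OU _ Op))).
  rewrite lampolyB alh.
  rewrite -scalemxAr -scalemxAl; congr (_ *: _).
  by rewrite /W !mulmxA /F mulmxKV ?OE.
have [G [H [c [GH sG GD G0]]]] := @family_second_order R n O d c1 c2 B0 W oO O0 starO
  Ole (fun l => sO (c1 l) (c1s l)) (fun l => sO (c2 l) (c2s l)) c1B c2B (fun h _ => Ws h)
  (fun h _ => W0 h) WDx WDt.
(* [E al + h (G E al) + ...] is the expansion of [E (al + h) = W h (E al)]. *)
exists (fun p lam => if lam == al then G p *m E p al
                     else (lam - al)^-1 *: (E p lam - E p al)).
split.
- split=> [p lam Op|lam].
    case: eqVneq => [->|lal]; first by rewrite !subrr scale0r.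
    by rewrite scalerA divff ?scale1r// subr_eq0.
  by case: eqVneq => _; rewrite ?G0 ?mul0mx// !E0 subrr scaler0.
- move=> lam; case: eqVneq => [_|lal]; first by apply: mxsmooth_onM => //; exact: sO.
  by apply: mxsmooth_onZ => //; apply: mxsmooth_onB => //; exact: sO.
- move=> p Op i k lam; have [->|lal] := eqVneq lam al.
    apply: (@holomorphic_of_bound _ _ _ ((H p *m E p al) i k) (c * norm1 (E p al))) => h sh.
    have h0 : h != 0 by case: sh.
    have -> : al + h == al = false by rewrite -subr_eq0 addrC addKr (negPf h0).
    rewrite eqxx alh.
    have EW : h^-1 *: (E p (al + h) - E p al) = (h^-1 *: (W h p - 1%:M)) *m E p al.
      by rewrite -scalemxAl mulmxBl mul1mx /W /F mulmxKV ?OE.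

    have -> : h^-1 * ((h^-1 *: (E p (al + h) - E p al)) i k - (G p *m E p al) i k) -
       (H p *m E p al) i k =
       ((h^-1 *: (h^-1 *: (W h p - 1%:M) - G p) - H p) *m E p al) i k.
      rewrite EW; set V := h^-1 *: (W h p - _).
      have -> : (h^-1 *: (V - G p) - H p) *m E p al =
          h^-1 *: (V *m E p al - G p *m E p al) - H p *m E p al.
        by rewrite mulmxBl -scalemxAl mulmxBl.
      by rewrite [RHS]mxE [X in _ = X + _]mxE [X in _ = _ * X + _]mxE
        [X in _ = _ * (_ + X) + _]mxE [X in _ = _ + X]mxE.
    rewrite (le_trans (norm1_entry _ i k))// (le_trans (norm1M _ _))// mulrAC.
    by rewrite ler_wpM2r ?norm1_ge0// GH.
  apply: (@holomorphic_near _ (fun z => (z - al)^-1 * (E p z i k - E p al i k))).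
    near=> z; have -> : z == al = false by apply/negbTE; near: z; exact: near_neq.
    by rewrite !mxE.
  apply: holomorphicM.
    apply: holomorphicV; first by rewrite subr_eq0.
    by apply: holomorphicD; [exact: holomorphic_id|exact: holomorphic_cst].
  by apply: holomorphicD; [exact/Eh/OU|exact: holomorphic_cst].
- move=> p lam Op; have O1p := OO1 _ Op; have dE := mxsmooth_on_diff (Es1 _) O1p.
  case: eqVneq => [->|lal].
    have dG := mxsmooth_on_diff sG Op.
    rewrite /Dx (mxderiveM _ dG (dE al)).
    have [] := GD p Op; rewrite /Dx => -> _.
    have := EDx al (OU _ Op); rewrite /Dx => ->.
    by rewrite /c1 /= /F mulmxKV ?OE// mulmxA addrC.
  rewrite /Dx mxderiveZ; last by apply: mxdifferentiableB.
  rewrite (mxderiveB _ (dE lam) (dE al)).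
  have := EDx al (OU _ Op); have := EDx lam (OU _ Op); rewrite /Dx => -> ->.
  rewrite -scalemxAl mulmxBl.
  have -> : E p lam *m (lam *: a + u p) = E p lam *m (al *: a + u p) +
      (lam - al) *: (E p lam *m a).
    rewrite scalemxAr -mulmxDr scalerBl addrAC; congr (_ *m (_ + _)).
    by rewrite addrC subrK.
  rewrite addrAC scalerDr scalerA mulVf ?scale1r// subr_eq0//.
- move=> p lam Op; have O1p := OO1 _ Op; have dE := mxsmooth_on_diff (Es1 _) O1p.
  case: eqVneq => [->|lal].
    have dG := mxsmooth_on_diff sG Op.
    rewrite /Dt (mxderiveM _ dG (dE al)).
    have [_] := GD p Op; rewrite /Dt => ->.
    have := EDt al (OU _ Op); rewrite /Dt => ->.
    have -> : c2 0%N p = E p al *m ddlampoly (q^~ p) j al al *m F p.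
      have := c2E 0 p; rewrite addr0 hpoly_recl scale0r addr0; apply.
    by rewrite /F mulmxKV ?OE// mulmxA addrC.
  rewrite /Dt mxderiveZ; last by apply: mxdifferentiableB.
  rewrite (mxderiveB _ (dE lam) (dE al)).
  have := EDt al (OU _ Op); have := EDt lam (OU _ Op); rewrite /Dt => -> ->.
  rewrite -scalemxAl mulmxBl.
  have -> : E p lam *m lampoly (q^~ p) j lam = E p lam *m lampoly (q^~ p) j al + (lam - al) *: (E p lam *m ddlampoly (q^~ p) j al lam).
    by rewrite scalemxAr -lampolyB -mulmxDr addrC subrK.
  rewrite addrAC scalerDr scalerA mulVf ?scale1r// subr_eq0//.
Unshelve. all: by end_near. Qed.

End DividedDifference.

(** * Differential polynomials *)

Section DifferentialPolynomials.
Context (R : realType) (n : nat).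
Local Notation C := R[i].
Local Notation M := 'M[R[i]]_n.+1.
Local Notation jet := ('I_n.+1 * 'I_n.+1 * nat -> C).
Implicit Types (q : diffpoly R n) (v w : jet).

Lemma diffpoly_evalE q v : diffpoly_eval q v =
  \sum_(m <- msupp q) mcoeff m q * \prod_(i <- finsupp m) v i ^+ m i.
Proof. exact: mmapE. Qed.

(** A bound for the order of the derivatives that occur in [q]. *)
Definition jet_order q := (\max_(m <- msupp q) \max_(i <- finsupp m) i.2.+1)%N.

Lemma diffpoly_eval_ext q r v w : (jet_order q <= r)%N ->
  (forall i, (i.2 < r)%N -> v i = w i) -> diffpoly_eval q v = diffpoly_eval q w.
Proof.
move=> qr vw; rewrite !diffpoly_evalE; apply: eq_big_seq => m mq; congr (_ * _).
apply: eq_big_seq => i im; rewrite vw//; apply: leq_trans qr.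
apply: (@leq_trans (\max_(i <- finsupp m) i.2.+1)).
  exact: (leq_bigmax_seq (F := fun i : 'I_n.+1 * 'I_n.+1 * nat => i.2.+1)).
exact: (@leq_bigmax_seq _ _ xpredT (fun m : cmonom ('I_n.+1 * 'I_n.+1 * nat)%type => \max_(i <- finsupp m) i.2.+1)%N m).
Qed.

Lemma diffpoly_eval0 q : diffpoly_eval q (fun=> 0) = constant_term q.
Proof.
rewrite diffpoly_evalE.
have E (m : cmonom ('I_n.+1 * 'I_n.+1 * nat)%type) :
    \prod_(i <- finsupp m) (0 : C) ^+ m i = (m == monalg.one)%:R.
  have [->|m1] := eqVneq m monalg.one; first by rewrite mdom1 big_nil.
  have [i im] : exists i, i \in finsupp m.
    apply: contrapT => H; case/negP: m1; apply/cmP => i.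
    by apply/eqP; rewrite cm1 cmE_eq0; apply/negP => im; apply: H; exists i.
  rewrite (big_rem i)//= expr0n; move: im; rewrite -cmE_neq0 => /negPf ->.
  by rewrite mul0r.
under eq_bigr do rewrite E.
have [m1|m1] := boolP (monalg.one \in msupp q).
  rewrite (big_rem monalg.one)//= eqxx mulr1 big_seq big1 ?addr0// => m mq.
  case: eqVneq => [m1'|]; last by rewrite mulr0.
  by move: mq; rewrite m1' mem_rem_uniq ?fset_uniq// inE eqxx.
rewrite /constant_term (mcoeff_outdom m1) big_seq big1// => m mq.
case: eqVneq => [m1'|]; last by rewrite mulr0.
by rewrite -m1' mq in m1.
Qed.

Lemma csmooth_on_eval (V : normedModType R) (U : set V) q (v : V -> jet) : open U ->
  (forall i, csmooth_on U (fun p => v p i)) -> csmooth_on U (fun p => diffpoly_eval q (v p)).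
Proof.
move=> oU vs; under eq_fun do rewrite diffpoly_evalE.
apply: csmooth_on_sum => // m _; apply: csmooth_onM => //; first exact: csmooth_on_cst.
apply: csmooth_on_prod => // i _.
elim: (fun_of_fsfun _ i) => [|k IH].
  under eq_fun do rewrite expr0; exact: csmooth_on_cst.
by under eq_fun do rewrite exprS; exact: csmooth_onM.
Qed.

End DifferentialPolynomials.

(** * Cutting off along a line, and the complement of the centraliser *)

Section Jets.
Context (R : realType).
Local Notation C := R[i].
Variables (V : normedModType R) (U : set V) (v : V).
Hypothesis oU : open U.
Implicit Types (f g y : V -> C).

Lemma csmooth_onX f k : csmooth_on U f -> csmooth_on U (fun p => f p ^+ k).
Proof.
move=> sf; elim: k => [|k IH].
  under eq_fun do rewrite expr0; exact: csmooth_on_cst.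
by under eq_fun do rewrite exprS; exact: csmooth_onM.
Qed.

Lemma csmooth_on_iter f s : csmooth_on U f -> csmooth_on U (iter s (cderive v) f).
Proof. by move=> sf; elim: s => //= s IH; exact: csmooth_on_derive. Qed.

Lemma iter_cderiveD f g s p : csmooth_on U f -> csmooth_on U g -> U p ->
  iter s (cderive v) (fun q => f q + g q) p =
  iter s (cderive v) f p + iter s (cderive v) g p.
Proof.
move=> sf sg; elim: s p => //= s IH p Up.
rewrite (eq_on_cderive oU v IH Up) cderiveD//;
  apply: csmooth_on_diff Up; exact: csmooth_on_iter.
Qed.

Lemma cderive_powM y f m p : csmooth_on U y -> csmooth_on U f -> U p ->
  cderive v (fun q => y q ^+ m.+1 * f q) p =
  y p ^+ m * (m.+1%:R * cderive v y p * f p + y p * cderive v f p).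
Proof.
move=> sy sf Up; have dy := csmooth_on_diff sy Up; have df := csmooth_on_diff sf Up.
have dX k : cderive v (fun q => y q ^+ k.+1) p = k.+1%:R * y p ^+ k * cderive v y p.
  elim: k => [|k IH].
    by under eq_fun do rewrite expr1; rewrite expr0 mulr1 mul1r.
  under eq_fun do rewrite exprS.
  rewrite cderiveM//; last by apply: csmooth_on_diff Up; exact: csmooth_onX.
  by rewrite IH exprS -(natr1 k.+1); ring.
rewrite cderiveM//; last by apply: csmooth_on_diff Up; exact: csmooth_onX.
by rewrite dX exprS; ring.
Qed.

(** A factor [y ^+ r] kills the derivatives of order less than [r] where [y]
    vanishes. *)
Lemma iter_cderive_vanish y f r s p : csmooth_on U y -> csmooth_on U f -> U p ->
  y p = 0 -> (s < r)%N -> iter s (cderive v) (fun q => y q ^+ r * f q) p = 0.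
Proof.
move=> sy sf Up y0 sr.
suff H : forall s, (s <= r)%N -> exists g, csmooth_on U g /\ forall q, U q ->
    iter s (cderive v) (fun q => y q ^+ r * f q) q = y q ^+ (r - s) * g q.
  have [g [_ ->//]] := H s (ltnW sr).
  by rewrite y0 expr0n subn_eq0 leqNgt sr mul0r.
elim=> [|k IH] kr; first by exists f; rewrite subn0.
have [g [sg gE]] := IH (ltnW kr).
exists (fun q => (r - k)%:R * cderive v y q * g q + y q * cderive v g q); split.
  apply: csmooth_onD => //; last by apply: csmooth_onM => //; exact: csmooth_on_derive.
  apply: csmooth_onM => //; apply: csmooth_onM => //; last exact: csmooth_on_derive.
  exact: csmooth_on_cst.
move=> q Uq /=; rewrite (eq_on_cderive oU v gE Uq).
by rewrite -(subnSK kr) cderive_powM.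
Qed.

End Jets.

Section Cutoff.
Context (R : realType).
Local Notation C := R[i].
Variable (U : set (R * R)).
Hypothesis oU : open U.

(** The polynomial [(1 - y ^+ N) ^+ N] is flat to order [N] at [y = 0], where it
    equals 1, and at [y = 1], where it vanishes. *)
Lemma cutoff_exists (p0 : R * R) N : U p0 -> exists (h : R) (chi : R * R -> C),
  let v : R * R := (1, 0) in let p1 := p0 + h *: v in
  [/\ csmooth_on U chi, forall s : R, 0 <= s <= 1 -> U (p0 + s *: (h *: v)) &
  forall f, csmooth_on U f -> forall s, (s < N)%N ->
    iter s (cderive v) (fun q => chi q * f q) p0 = iter s (cderive v) f p0 /\
    iter s (cderive v) (fun q => chi q * f q) p1 = 0].
Proof.
move=> Up0; have nU : \forall p \near p0, U p by exact: open_nbhs_nbhs.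
have /nbhs_ballP[r /= r0 rP] := near_segment nU.
pose h := r / 2; have h0 : 0 < h by rewrite divr_gt0.
pose v : R * R := (1, 0); pose p1 := p0 + h *: v.
have Useg (s : R) : 0 <= s <= 1 -> U (p0 + s *: (h *: v)).
  apply: rP; apply/plane_ballE; rewrite normrZ gtr0_norm//.
  have -> : `|v| = 1 by rewrite prod_normE /= normr1 normr0 max_l.
  by rewrite mulr1 /h ltr_pdivrMr// ltr_pMr// ltr1n.
have Up1 : U p1 by have := Useg 1; rewrite scale1r; apply; rewrite lexx ler01.
pose y (p : R * R) : C := ((p.1 - p0.1) / h)%:C.
have sy : csmooth_on U y.
  split; last exact: smooth_on_cst.
  rewrite (_ : (fun p => _) = (fun p => plane_form h^-1 0 p) + cst (- p0.1 / h)); last first.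
    by apply/funext => p; rewrite /y /plane_form !fctE /=; ring.
  apply: smooth_onD => //; last exact: smooth_on_cst.
  by apply: smooth_on_linear => //; exact: plane_form_continuous.
have y0 : y p0 = 0 by rewrite /y subrr mul0r.
have y1 : y p1 = 1.
  by rewrite /y /p1 /= -[h *: 1]/(h * 1) mulr1 addrC addKr divff ?gt_eqF.
pose w p := y p ^+ N; pose z p := 1 - y p.
have c1 : csmooth_on U (fun=> 1 : C) by exact: csmooth_on_cst.
have sw : csmooth_on U w by exact: csmooth_onX.
have sz : csmooth_on U z by apply: csmooth_onD => //; exact: csmooth_onN.
have s1w : csmooth_on U (fun p => 1 - w p) by apply: csmooth_onD => //; exact: csmooth_onN.
pose chi p := (1 - w p) ^+ N.
pose g1 p := - \sum_(i < N) (1 - w p) ^+ i.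
pose g2 p := (\sum_(i < N) y p ^+ i) ^+ N.
have sg1 : csmooth_on U g1.
  by apply: csmooth_onN => //; apply: csmooth_on_sum => // i _; exact: csmooth_onX.
have sg2 : csmooth_on U g2.
  by apply: csmooth_onX => //; apply: csmooth_on_sum => // i _; exact: csmooth_onX.
have chi0 p : chi p = 1 + y p ^+ N * g1 p.
  have := subrX1 (1 - w p) N; rewrite -/(chi p) => /eqP; rewrite subr_eq => /eqP ->.
  by rewrite addrC addrAC subrr add0r mulNr -mulrN.
have chi1 p : chi p = z p ^+ N * g2 p.
  have := subrX1 (y p) N; rewrite /chi /z /g2 /w -exprMn => E; congr (_ ^+ _).
  by rewrite -opprB E -mulNr opprB.
exists h, chi; split=> //; first exact: csmooth_onX.
move=> f sf s sN; split.
  under eq_fun do rewrite chi0 mulrDl mul1r -mulrA.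
  have sgf : csmooth_on U (fun q => g1 q * f q) by exact: csmooth_onM.
  rewrite (@iter_cderiveD _ _ _ _ oU f)//; last exact: csmooth_onM.
  by rewrite (iter_cderive_vanish v oU sy sgf Up0 y0 sN) addr0.
under eq_fun do rewrite chi1 -mulrA.
have sgf : csmooth_on U (fun q => g2 q * f q) by exact: csmooth_onM.
by apply: (iter_cderive_vanish v oU sz sgf Up1 _ sN); rewrite /z y1 subrr.
Qed.

End Cutoff.

Section PerpAndCentraliser.
Context (R : realType) (n : nat).
Local Notation C := R[i].
Local Notation M := 'M[R[i]]_n.+1.
Implicit Types (a y z : M).

Lemma diag_mulE a y : is_diag_mx a ->
  (forall i k, (a *m y) i k = a i i * y i k) /\ (forall i k, (y *m a) i k = y i k * a k k).
Proof.
move=> /is_diag_mxP da; split=> i k; rewrite mxE.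
  rewrite (bigD1 i)//= big1 ?addr0// => l li; rewrite da ?mul0r//.
  by apply: contra li => /eqP/val_inj ->.
rewrite (bigD1 k)//= big1 ?addr0// => l lk; rewrite da ?mulr0//.
Qed.

Lemma bracket_diagE a y i k : is_diag_mx a ->
  bracket y a i k = y i k * (a k k - a i i).
Proof.
by move=> /diag_mulE H; rewrite mxE [X in _ + X]mxE (H y).1 (H y).2 mulrBr [a i i * _]mulrC.
Qed.

Lemma bracketC (y z : M) : bracket y z = - bracket z y.
Proof. by rewrite /bracket opprB. Qed.

Lemma bracketBl (y z w : M) : bracket (y - z) w = bracket y w - bracket z w.
Proof.
rewrite /bracket mulmxBl mulmxBr; move: (y *m _) (z *m _) (w *m _) (w *m _) => y1 z1 w1 w2.
by apply/matrixP => i k; rewrite !mxE; ring.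
Qed.

Lemma centP a y : is_diag_mx a ->
  bracket y a = 0 <-> forall i k, a i i != a k k -> y i k = 0.
Proof.
move=> da; split=> [y0 i k ik|y0].
  have /matrixP/(_ i k) := y0; rewrite bracket_diagE// mxE => /eqP.
  by rewrite mulf_eq0 subr_eq0 [a k k == _]eq_sym (negPf ik) orbF => /eqP.
apply/matrixP => i k; rewrite bracket_diagE// mxE.
by have [->|/y0 ->] := eqVneq (a i i) (a k k); rewrite ?subrr ?mulr0 ?mul0r.
Qed.

Lemma mxtrace_mul_delta y i k : \tr (y *m delta_mx i k) = y k i.
Proof.
rewrite /mxtrace (bigD1 k)//= mxE (bigD1 i)//= !mxE !eqxx mulr1 big1; last first.
  by move=> l li; rewrite mxE (negPf li) mulr0.
rewrite addr0 big1 ?addr0// => l lk; rewrite mxE big1// => r _.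
by rewrite mxE (negPf lk) andbF mulr0.
Qed.

(** The orthogonal complement of the centraliser of [a] consists of the matrices
    whose entries vanish wherever two eigenvalues of [a] agree. *)
Lemma sl_perpP a y : is_diag_mx a ->
  sl_perp a y <-> forall i k, a i i = a k k -> y i k = 0.
Proof.
move=> da; split=> [[sy oy] i k ik|H].
  have trE (r l : 'I_n.+1) : \tr (delta_mx r l : M) = (r == l)%:R.
    have := mxtrace_mul_delta 1%:M r l; rewrite mul1mx => ->.
    by rewrite mxE eq_sym.
  have cE (r l : 'I_n.+1) : a r r = a l l -> bracket (delta_mx r l : M) a = 0.
    move=> rl; apply/(centP _ da) => s t; rewrite mxE.
    by have [->|//] := eqVneq s r; have [->|//] := eqVneq t l; rewrite rl eqxx.
  have [ik'|ik'] := eqVneq i k; last first.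
    rewrite -mxtrace_mul_delta; apply: oy; split.
      by rewrite /sl trE eq_sym (negPf ik').
    by rewrite bracketC cE ?oppr0.
  have same l : y l l = y i i.
    apply/eqP; rewrite -subr_eq0 -!mxtrace_mul_delta -raddfB -mulmxBr /=; apply/eqP/oy; split.
      by rewrite /sl raddfB /= !trE !eqxx subrr.
    by rewrite bracketC bracketBl !cE// subrr oppr0.
  rewrite -ik'; have : \tr y = (n.+1)%:R * y i i.
    by rewrite /mxtrace (eq_bigr _ (fun l _ => same l)) sumr_const card_ord mulr_natl.
  by rewrite sy => /esym/eqP; rewrite mulf_eq0 pnatr_eq0 /= => /eqP.
split; first by rewrite /sl /mxtrace big1// => i _; exact: H.
move=> z [_ /eqP]; rewrite bracketC oppr_eq0 => /eqP/(centP _ da) z0.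
rewrite /mxtrace big1// => i _; rewrite mxE big1// => k _.
have [ik|ik] := eqVneq (a i i) (a k k); first by rewrite H ?mul0r.
by rewrite z0 ?mulr0// eq_sym.
Qed.

End PerpAndCentraliser.

(** * Formal power series in the inverse spectral parameter *)

Section Sequences.
Context (R : realType) (n : nat).
Local Notation C := R[i].
Local Notation M := 'M[R[i]]_n.+1.
Implicit Types (X Y : nat -> M) (s : seq C) (A a b D : M).

(** A sequence of matrices stands for a formal power series in [1 / lam]. *)
Definition cauchy_prod X Y k : M := \sum_(i < k.+1) X i *m Y (k - i)%N.

Definition sub_scalar (c : C) X k : M := if k is 0%N then X 0%N - c%:M else X k.

(** The product of the series [X - c] over [c] in [s]. *)
Fixpoint root_prod s X : nat -> M :=
  if s is c :: s' then cauchy_prod (sub_scalar c X) (root_prod s' X)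
  else fun k => if k is 0%N then 1%:M else 0.

Definition root_poly s : {poly C} := \prod_(c <- s) ('X - c%:P).

Lemma cauchy_prod0 X Y : cauchy_prod X Y 0 = X 0%N *m Y 0%N.
Proof. by rewrite /cauchy_prod big_ord1. Qed.

Lemma cauchy_prod_ends X Y k : cauchy_prod X Y k.+1 =
  X 0%N *m Y k.+1 + \sum_(i < k) X i.+1 *m Y (k - i)%N + X k.+1 *m Y 0%N.
Proof.
rewrite /cauchy_prod big_ord_recl big_ord_recr /= subn0 addrA /bump /= add1n subSS subnn.
by congr (_ + _ + _); apply: eq_bigr => i _; rewrite subSS.
Qed.

Lemma eq_cauchy_prod X X' Y Y' k : (forall l, (l <= k)%N -> X l = X' l) ->
  (forall l, (l <= k)%N -> Y l = Y' l) -> cauchy_prod X Y k = cauchy_prod X' Y' k.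
Proof.
move=> XX YY; apply: eq_bigr => i _; rewrite XX -1?ltnS// YY//; exact: leq_subr.
Qed.

Lemma eq_root_prod s X X' k : (forall l, (l <= k)%N -> X l = X' l) ->
  root_prod s X k = root_prod s X' k.
Proof.
elim: s k => [|c s IH] k XX //=; apply: eq_cauchy_prod => l lk.
  by case: l lk => [|l] lk /=; rewrite XX.
by apply: IH => i il; apply: XX; exact: leq_trans lk.
Qed.

Lemma root_prod0 s X : root_prod s X 0 = horner_mx (X 0%N) (root_poly s).
Proof.
rewrite /root_poly; elim: s => [|c s IH] /=; first by rewrite big_nil [RHS]rmorph1.
by rewrite cauchy_prod0 IH big_cons rmorphM /= rmorphB /= horner_mx_X horner_mx_C.
Qed.

(** [X (1 - A / lam) = (1 - A / lam) Y] as power series in [1 / lam]. *)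
Definition gauge_related A X Y := X 0%N = Y 0%N /\
  forall k, X k.+1 - X k *m A = Y k.+1 - A *m Y k.

Lemma gauge_cauchy_prod A X X' Y Y' : gauge_related A X X' -> gauge_related A Y Y' ->
  gauge_related A (cauchy_prod X Y) (cauchy_prod X' Y').
Proof.
move=> [X0 XE] [Y0 YE]; split=> [|k]; first by rewrite !cauchy_prod0 X0 Y0.
have E1 : cauchy_prod X Y k.+1 - cauchy_prod X Y k *m A =
    X k.+1 *m Y' 0%N + \sum_(i < k.+1) X i *m (Y' (k - i).+1 - A *m Y' (k - i)%N).
  rewrite {1}/cauchy_prod big_ord_recr /= subnn addrAC addrC Y0; congr (_ + _).
  rewrite mulmx_suml -sumrB; apply: eq_bigr => i _.
  by rewrite -mulmxA -mulmxBr subSn ?leq_ord// YE.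
have E2 : cauchy_prod X' Y' k.+1 - A *m cauchy_prod X' Y' k =
    X 0%N *m Y' k.+1 + \sum_(i < k.+1) (X i.+1 - X i *m A) *m Y' (k - i)%N.
  rewrite {1}/cauchy_prod big_ord_recl /= subn0 -X0 -addrA; congr (_ + _).
  rewrite mulmx_sumr -sumrB; apply: eq_bigr => i _.
  by rewrite mulmxA -mulmxBl XE /bump /= add1n subSS.
rewrite E1 E2.
under eq_bigr do rewrite mulmxBr mulmxA.
rewrite sumrB; under [in RHS]eq_bigr do rewrite mulmxBl.
rewrite sumrB !addrA; apply: (congr2 (fun x y : M => x - y)); last by [].
have HR : cauchy_prod X Y' k.+1 = \sum_(i < k.+1) X i *m Y' (k - i).+1 + X k.+1 *m Y' 0%N.
  rewrite /cauchy_prod big_ord_recr /= subnn; congr (_ + _).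
  by apply: eq_bigr => i _; rewrite subSn ?leq_ord.
have HL : cauchy_prod X Y' k.+1 = X 0%N *m Y' k.+1 + \sum_(i < k.+1) X i.+1 *m Y' (k - i)%N.
  rewrite /cauchy_prod big_ord_recl /= subn0; congr (_ + _).
by rewrite -HL HR addrC.
Qed.

Lemma gauge_root_prod A X Y s : gauge_related A X Y ->
  gauge_related A (root_prod s X) (root_prod s Y).
Proof.
move=> [X0 XE]; elim: s => [|c s IH] /=.
  by split=> // -[|k] /=; rewrite ?mul0mx ?mulmx0 ?mul1mx ?mulmx1.
apply: gauge_cauchy_prod => //; split=> [|k] /=; first by rewrite X0.
case: k => [|k] /=; last exact: XE.
rewrite mulmxBl mulmxBr mul_scalar_mx mul_mx_scalar !opprB.
by rewrite addrCA [RHS]addrCA XE.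
Qed.

Lemma gauge_zero A X : gauge_related A X (fun=> 0) -> forall k, X k = 0.
Proof.
move=> [X0 XE]; elim=> [//|k IH].
by have := XE k; rewrite IH mul0mx mulmx0 !subr0.
Qed.

(** Only the terms with one factor [X K.+1 - X' K.+1] and all others [X 0] survive;
    as these commute, the derivative of the polynomial appears. *)
Lemma root_prod_diff s X X' K : X 0%N = X' 0%N ->
  (forall l, (l <= K)%N -> X l = X' l) ->
  comm_mx (X K.+1 - X' K.+1) (X 0%N) ->
  root_prod s X K.+1 - root_prod s X' K.+1 =
  horner_mx (X 0%N) (root_poly s)^`() *m (X K.+1 - X' K.+1).
Proof.
move=> X0 XX cD; set D := X K.+1 - X' K.+1.
elim: s => [|c s IH]; rewrite /root_poly /=.
  by rewrite big_nil derivC rmorph0 mul0mx subrr.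
have agree l : (l <= K)%N -> root_prod s X l = root_prod s X' l.
  by move=> lK; apply: eq_root_prod => i il; apply: XX; exact: leq_trans lK.
rewrite !cauchy_prod_ends /=.
rewrite (eq_bigr (fun i : 'I_K => X' i.+1 *m root_prod s X' (K - i)%N)); last first.
  by move=> i _; rewrite XX ?ltn_ord// agree// leq_subr.
rewrite -X0 -(agree 0%N)//.
set S := \sum_(_ < _) _; set P := root_prod s X; set P' := root_prod s X'.
have -> : (X 0%N - c%:M) *m P K.+1 + S + X K.+1 *m P 0%N -
   ((X 0%N - c%:M) *m P' K.+1 + S + X' K.+1 *m P 0%N) =
   (X 0%N - c%:M) *m (P K.+1 - P' K.+1) + D *m P 0%N.
  rewrite mulmxBr /D [(X K.+1 - _) *m _]mulmxBl; move: (_ *m P K.+1) (_ *m P' K.+1) (_ *m P 0%N) (_ *m P 0%N) => x1 x2 x3 x4.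
  by apply/matrixP => i k; rewrite !mxE; ring.
rewrite IH /P root_prod0 (comm_mx_horner (root_poly s) cD) mulmxA -mulmxDl; congr (_ *m _).
rewrite big_cons -/(root_poly s) derivM derivXsubC mul1r addrC rmorphD rmorphM /= rmorphB /=.
by rewrite horner_mx_X horner_mx_C addrC.
Qed.

Lemma root_poly_deriv_neq0 s x : uniq s -> x \in s -> (root_poly s)^`().[x] != 0.
Proof.
rewrite /root_poly; elim: s => //= c s IH /andP[cs us]; rewrite inE big_cons.
have rootE y : root (\prod_(z <- s) ('X - z%:P)) y = (y \in s) by exact: root_prod_XsubC.
rewrite derivM derivXsubC mul1r hornerD hornerM hornerXsubC.
have [->|xc] /= := eqVneq x c; first by rewrite subrr mul0r addr0 -/(root _ _) rootE.
move=> xs; have /eqP -> : root (\prod_(z <- s) ('X - z%:P)) x by rewrite rootE.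
by rewrite add0r mulf_neq0 ?subr_eq0// IH.
Qed.

Lemma horner_mx_diagE b p i k : is_diag_mx b ->
  horner_mx b p i k = p.[b i i] *+ (i == k).
Proof.
move=> /diag_mxP[d ->]; rewrite horner_mx_diag !mxE.
by rewrite eqxx mulr1n.
Qed.

Definition diag_seq b : seq C := undup [seq b i i | i <- enum 'I_n.+1].

Lemma root_poly_diag b : is_diag_mx b -> horner_mx b (root_poly (diag_seq b)) = 0.
Proof.
move=> db; apply/matrixP => i k; rewrite horner_mx_diagE// mxE.
suff /eqP -> : root (root_poly (diag_seq b)) (b i i) by rewrite mul0rn.
by rewrite root_prod_XsubC mem_undup; apply/mapP; exists i => //; rewrite mem_enum.
Qed.

(** Two series with the same initial segment that are annihilated by the
    separable polynomial [root_poly (diag_seq b)] differ next by a matrix that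
    cannot commute with [b] unless it vanishes. *)
Lemma root_prod_uniq b X X' K : is_diag_mx b -> X 0%N = b -> X' 0%N = b ->
  (forall l, (l <= K)%N -> X l = X' l) ->
  bracket (X K.+1 - X' K.+1) b = 0 ->
  root_prod (diag_seq b) X K.+1 = 0 -> root_prod (diag_seq b) X' K.+1 = 0 ->
  X K.+1 = X' K.+1.
Proof.
move=> db X0 X'0 XX cD p0 p'0.
have := @root_prod_diff (diag_seq b) X X' K; rewrite X0 X'0 p0 p'0 subrr.
set D := X K.+1 - X' K.+1 => /(_ erefl XX).
have cD' : comm_mx D b by apply/eqP; rewrite -subr_eq0; exact/eqP.
move=> /(_ cD') E; apply/eqP; rewrite -subr_eq0 -/D; apply/eqP/matrixP => i k; rewrite [RHS]mxE.
have /matrixP/(_ i k) := E; rewrite mxE mxE (bigD1 i)//= horner_mx_diagE// eqxx mulr1n.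
rewrite big1 ?addr0; last first.
  by move=> l li; rewrite horner_mx_diagE// eq_sym (negPf li) mul0r.
move=> /esym/eqP; rewrite mulf_eq0 => /orP[|/eqP //].
rewrite (negPf (root_poly_deriv_neq0 _ _)) ?undup_uniq//.
by rewrite mem_undup; apply/mapP; exists i => //; rewrite mem_enum.
Qed.

End Sequences.

(** * Uniqueness of the recursion *)

Section Lax.
Context (R : realType) (n : nat).
Local Notation C := R[i].
Local Notation M := 'M[R[i]]_n.+1.
Implicit Types (u : R * R -> M) (X Y : nat -> R * R -> M) (p : R * R).

(** The equation [X_x + [lam a + u, X] = 0], coefficient by coefficient, for
    [X = \sum_k X_k lam^-k]. *)
Definition lax (a : M) u X p := bracket (X 0%N p) a = 0 /\
  forall k, Dx (X k) p + bracket (u p) (X k p) = bracket (X k.+1 p) a.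

Lemma bracketM (A B D : M) : bracket (A *m B) D = bracket A D *m B + A *m bracket B D.
Proof. by rewrite /bracket mulmxBl mulmxBr !mulmxA [RHS]addrC addrA subrK. Qed.

Lemma bracketMr (A B D : M) : bracket D (A *m B) = bracket D A *m B + A *m bracket D B.
Proof. by rewrite bracketC bracketM opprD -mulNmx -mulmxN -!bracketC. Qed.

Lemma bracket_suml (I : Type) (r : seq I) (F : I -> M) (A : M) :
  bracket (\sum_(i <- r) F i) A = \sum_(i <- r) bracket (F i) A.
Proof. by rewrite /bracket mulmx_suml mulmx_sumr -sumrB. Qed.

Lemma bracket_sumr (I : Type) (r : seq I) (F : I -> M) (A : M) :
  bracket A (\sum_(i <- r) F i) = \sum_(i <- r) bracket A (F i).
Proof. by rewrite /bracket mulmx_suml mulmx_sumr -sumrB. Qed.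

(** Both [d/dx] and the commutator with [lam a + u] are derivations. *)
Lemma lax_cauchy_prod (a : M) u X Y p : (forall k, mxdifferentiable (X k) p) ->
  (forall k, mxdifferentiable (Y k) p) -> lax a u X p -> lax a u Y p ->
  lax a u (fun k q => cauchy_prod (X^~ q) (Y^~ q) k) p.
Proof.
move=> dX dY [X0 XE] [Y0 YE]; split.
  by rewrite cauchy_prod0 bracketM X0 Y0 mul0mx mulmx0 addr0.
move=> k; rewrite /Dx mxderive_sum; last by move=> i; exact: mxdifferentiableM.
rewrite /cauchy_prod bracket_sumr bracket_suml -big_split /=.
under eq_bigr => i _.
  rewrite mxderiveM// bracketMr addrACA -mulmxDl -mulmxDr XE YE; over.
under [in RHS]eq_bigr do rewrite bracketM.
rewrite big_split /= [in RHS]big_split /= [in RHS]big_ord_recl X0 mul0mx add0r.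
rewrite [X in _ = _ + X]big_ord_recr /= subnn Y0 mulmx0 addr0.
apply: (congr2 +%R); apply: eq_bigr => i _; first by rewrite /bump /= add1n subSS.
by rewrite subSn ?leq_ord.
Qed.

Variable U : set (R * R).
Hypothesis oU : open U.

Lemma root_prod_smooth s X : (forall k, mxsmooth_on U (X k)) ->
  forall k, mxsmooth_on U (fun p => root_prod s (X^~ p) k).
Proof.
move=> sX; elim: s => [|c s IH] k /=; first exact: mxsmooth_on_cst.
apply: mxsmooth_on_sum => // i; apply: mxsmooth_onM => //.
case: (nat_of_ord i) => [|l] //=; apply: mxsmooth_onB => //; exact: mxsmooth_on_cst.
Qed.

Lemma lax_root_prod (a : M) u s X : (forall k, mxsmooth_on U (X k)) ->
  (forall p, U p -> lax a u X p) ->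
  forall p, U p -> lax a u (fun k q => root_prod s (X^~ q) k) p.
Proof.
move=> sX lX p Up; have bs (c : C) (A : M) : bracket A c%:M = 0.
  by rewrite /bracket mul_mx_scalar mul_scalar_mx subrr.
elim: s => [|c s IH] /=.
  split=> [|k]; first by rewrite bracketC bs oppr0.
  have -> : Dx (fun=> if k is 0%N then 1%:M else 0 : M) p = 0 by exact: mxderive_cst.
  by case: k => [|k]; rewrite ?bs /bracket ?mulmx0 ?mul0mx subrr addr0.
apply: (@lax_cauchy_prod a u (fun k q => sub_scalar c (X^~ q) k)
  (fun k q => root_prod s (X^~ q) k)) => //.
- move=> k; apply: (mxsmooth_on_diff (U := U)) => //; case: k => [|k] //=.
  by apply: mxsmooth_onB => //; exact: mxsmooth_on_cst.
- by move=> k; apply: (mxsmooth_on_diff (U := U)) => //; exact: root_prod_smooth.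
have [X0 XE] := lX p Up; split=> [|k] /=.
  by rewrite bracketBl X0 [bracket _%:M _]bracketC bs oppr0 subr0.
case: k => [|k] /=; last exact: XE.
have dX := mxsmooth_on_diff (sX 0%N) Up.
have dc := mxdifferentiable_cst (c%:M : M) p.
rewrite -XE /Dx (mxderiveB _ dX dc) mxderive_cst subr0.
by rewrite [bracket _ (_ - _)]bracketC bracketBl opprB [bracket _%:M _]bracketC bs oppr0 sub0r -bracketC.
Qed.

Lemma root_prod_const s (X : nat -> M) : (forall k, X k.+1 = 0) ->
  forall k, root_prod s X k.+1 = 0.
Proof.
move=> X0; elim: s => //= c s IH k; rewrite cauchy_prod_ends IH mulmx0 add0r /= X0 mul0mx addr0.
by rewrite big1// => i _; rewrite X0 mul0mx.
Qed.

End Lax.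

Section Recursion.
Context (R : realType) (n : nat).
Local Notation C := R[i].
Local Notation M := 'M[R[i]]_n.+1.
Variables (a b : M) (Q : nat -> 'M[diffpoly R n]_n.+1) (q : {poly C}).
Hypothesis da : is_diag_mx a.
Hypothesis bq : b = horner_mx a q.
Hypothesis QP : is_Q a b Q.

Lemma mxdp_smooth (U : set (R * R)) (P : 'M[diffpoly R n]_n.+1) (u : R * R -> M) :
  open U -> mxsmooth_on U u -> mxsmooth_on U (mxdp P u).
Proof.
move=> oU su i k; under eq_fun do rewrite mxE.
by apply: csmooth_on_eval => // l; apply: csmooth_on_iter.
Qed.

Lemma diag_b : is_diag_mx b.
Proof.
apply/is_diag_mxP => i k ik; rewrite bq horner_mx_diagE//.
by rewrite -val_eqE /= (negPf ik).
Qed.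

Lemma cent_b (D : M) : bracket D a = 0 -> bracket D b = 0.
Proof.
move=> /eqP; rewrite subr_eq0 => /eqP Da; apply/eqP; rewrite subr_eq0 bq; apply/eqP.
exact: comm_mx_horner.
Qed.

Lemma Q_lax (U : set (R * R)) (u : R * R -> M) : open U -> mxsmooth_on U u ->
  (forall p, U p -> sl_perp a (u p)) -> forall p, U p -> lax a u (fun k => mxdp (Q k) u) p.
Proof.
move=> oU su pu p Up; have [Q0 QE] := QP.2 U u oU su pu p Up; split=> //.
by rewrite Q0 bq bracketC /bracket comm_mx_horner ?subrr ?oppr0.
Qed.

(** The series of the [Q k] is annihilated by the minimal polynomial of [b]: the
    coefficients of that polynomial are constant in [x] and have no constant
    term, and every [u] can be cut off to zero along the [x]-direction. *)
Lemma root_prod_Q k (U : set (R * R)) (u : R * R -> M) : open U -> mxsmooth_on U u ->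
  (forall p, U p -> sl_perp a (u p)) -> forall p, U p ->
  root_prod (diag_seq b) (fun l => mxdp (Q l) u p) k = 0.
Proof.
elim: k U u => [|k IH] U u oU su pu p Up.
  have [Q0 _] := QP.2 U u oU su pu p Up.
  by rewrite root_prod0 Q0 root_poly_diag// diag_b.
have Dx0 (w : R * R -> M) : mxsmooth_on U w -> (forall p, U p -> sl_perp a (w p)) ->
    forall p, U p -> Dx (fun p => root_prod (diag_seq b) (fun l => mxdp (Q l) w p) k.+1) p = 0.
  move=> sw pw p1 Up1; pose Phi l p := root_prod (diag_seq b) (fun l => mxdp (Q l) w p) l.
  have sQ l : mxsmooth_on U (mxdp (Q l) w) by exact: mxdp_smooth.
  have lP p2 : U p2 -> lax a w Phi p2.
    by move=> Up2; apply: (lax_root_prod oU) => // p3 Up3; exact: Q_lax Up3.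
  (* Degree [k] vanishes by induction, so degree [k.+1] commutes with [a]. *)
  have cP p2 : U p2 -> bracket (Phi k.+1 p2) a = 0.
    move=> Up2; have [_ /(_ k) <-] := lP p2 Up2.
    have -> : Dx (Phi k) p2 = Dx (cst 0) p2.
      by apply: (eq_on_mxderive oU _ _ Up2) => p3 Up3; exact: (IH U w).
    rewrite /Dx mxderive_cst add0r /Phi (IH U w)//.
    by rewrite /bracket mulmx0 mul0mx subrr.
  (* On the blocks of the centraliser of [a] both commutators vanish. *)
  apply/matrixP => i l; rewrite [RHS]mxE.
  have [ail|ail] := eqVneq (a i i) (a l l); last first.
    rewrite mxE; apply: (@etrans _ _ (cderive ((1, 0) : R * R) (cst 0) p1)); last exact: cderive_cst.
    apply: (eq_on_cderive oU _ _ Up1).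
    by move=> p2 Up2; have /(centP _ da) := cP p2 Up2; apply.
  have [_ /(_ k.+1) E] := lP p1 Up1; have /matrixP/(_ i l) := E.
  rewrite bracket_diagE// ail subrr mulr0 mxE => /eqP; rewrite addr_eq0 => /eqP ->.
  rewrite -[RHS]oppr0; congr (- _); rewrite !mxE; apply/eqP; rewrite subr_eq0; apply/eqP.
  have /(sl_perpP _ da) w0 := pw p1 Up1; have /(centP _ da) P0 := cP p1 Up1.
  rewrite !big1// => r _.
    have [air|air] := eqVneq (a r r) (a l l); first by rewrite (w0 r l air) mulr0.
    by rewrite P0 ?mul0r// ail eq_sym.
  have [air|air] := eqVneq (a i i) (a r r); first by rewrite (w0 i r air) mul0r.
  by rewrite P0 ?mulr0// -ail eq_sym.
(* [N] bounds the order of all derivatives in [Q_0], ..., [Q_k.+1]. *)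
pose N := (\max_(l < k.+2) \max_i \max_j jet_order (Q l i j))%N.
have QN l i j : (l < k.+2)%N -> (jet_order (Q l i j) <= N)%N.
  move=> lk; rewrite /N; apply: leq_trans (leq_bigmax (Ordinal lk)) => /=.
  by apply: leq_trans (leq_bigmax i) => /=; apply: (leq_bigmax j).
have [h [chi]] := cutoff_exists oU N Up; set v : R * R := (1, 0) => -[schi seg chiP].
pose w p := chi p *: u p; pose p1 := p + h *: v.
have Up1 : U p1 by have := seg 1; rewrite scale1r; apply; rewrite lexx ler01.
have sw : mxsmooth_on U w by exact: mxsmooth_on_scale.
have pw p2 : U p2 -> sl_perp a (w p2).
  move=> /pu/(sl_perpP _ da) u0; apply/(sl_perpP _ da) => i l il.
  by rewrite mxE u0 ?mulr0.
have jetw p2 i : xjet w p2 i =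
    iter i.2 (cderive v) (fun q => chi q * u q i.1.1 i.1.2) p2.
  by rewrite /xjet; congr (iter _ _ _ p2); apply/funext => p3; rewrite mxE.
have Qw l : (l <= k.+1)%N -> mxdp (Q l) w p = mxdp (Q l) u p.
  move=> lk; apply/matrixP => i j; rewrite !mxE.
  apply: (diffpoly_eval_ext (QN l i j _)) => // r rN; rewrite jetw.
  by have [] := chiP _ (su r.1.1 r.1.2) _ rN.
have Qw1 l : (l <= k.+1)%N -> mxdp (Q l) w p1 = if l is 0%N then b else 0.
  case: l => [_|l lk]; first by have [] := QP.2 U w oU sw pw p1 Up1.
  apply/matrixP => i j; rewrite !mxE -(QP.1 l.+1 i j)// -diffpoly_eval0.
  apply: (diffpoly_eval_ext (QN l.+1 i j _)) => // r rN; rewrite jetw.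
  by have [] := chiP _ (su r.1.1 r.1.2) _ rN.
pose F p := root_prod (diag_seq b) (fun l => mxdp (Q l) w p) k.+1.
have sF : mxsmooth_on U F.
  by apply: root_prod_smooth => // l; exact: mxdp_smooth.
rewrite -(eq_root_prod (diag_seq b) Qw) -/(F p).
have F1 : F p1 = 0.
  rewrite /F (eq_root_prod (diag_seq b) Qw1).
  exact: (@root_prod_const _ _ _ (fun l => if l is 0%N then b else 0)).
have : norm1 (F p1 - F p) <= real_dim R n * 0.
  apply: mx_mean_value_le => s s01; first exact: mxsmooth_on_diff sF (seg s s01).
  rewrite mxderive_plane; last exact: mxsmooth_on_diff sF (seg s s01).
  rewrite (Dx0 w sw pw _ (seg s s01)) /mxform /= scaler0.
  by rewrite -[h *: 0]/(h * 0) mulr0 scale0r addr0 norm10.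
rewrite F1 sub0r norm1N mulr0 => H; apply: norm1_eq0; apply/eqP.
by rewrite eq_le H norm1_ge0.
Qed.

(** The recursion together with the minimal polynomial determines the series. *)
Lemma Q_unique (O : set (R * R)) (w : R * R -> M) (X : nat -> R * R -> M) :
  open O -> mxsmooth_on O w -> (forall p, O p -> sl_perp a (w p)) ->
  (forall p, O p -> X 0%N p = b) ->
  (forall p k, O p -> Dx (X k) p + bracket (w p) (X k p) = bracket (X k.+1 p) a) ->
  (forall p k, O p -> root_prod (diag_seq b) (X^~ p) k = 0) ->
  forall k p, O p -> X k p = mxdp (Q k) w p.
Proof.
move=> oO sw pw X0 XE Xr k.
suff H : forall l, (l <= k)%N -> forall p, O p -> X l p = mxdp (Q l) w p by exact: H.
elim: k => [|k IH] l.
  by rewrite leqn0 => /eqP -> p Op; rewrite X0//; have [-> _] := QP.2 O w oO sw pw p Op.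
rewrite leq_eqVlt => /orP[/eqP ->|]; last exact: IH.
move=> p Op; have [Q0 QE] := QP.2 O w oO sw pw p Op.
apply: (@root_prod_uniq _ _ b (X^~ p) (fun l => mxdp (Q l) w p) k) => //.
- exact: diag_b.
- exact: X0.
- by move=> i ik; exact: IH.
- apply: cent_b; rewrite bracketBl -XE// -QE (IH k)//.
  by rewrite /Dx (eq_on_mxderive oO _ (IH k (leqnn k)) Op) subrr.
- exact: Xr.
- exact: (root_prod_Q _ oO sw pw Op).
Qed.

End Recursion.

(** * Dressing of connection polynomials *)

Section MatrixWords.
Context (R : realType) (n : nat).
Local Notation M := 'M[R[i]]_n.+1.
Implicit Types (x y z : M) (c : R[i]).

(** The product of square matrices as a constant of its own, so that the tactic
    below can treat words as atoms. *)
Definition mxword x y : M := x *m y.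

Lemma mxwordE x y : x *m y = mxword x y. Proof. by []. Qed.
Lemma mxwordDl x y z : mxword (x + y) z = mxword x z + mxword y z.
Proof. exact: mulmxDl. Qed.
Lemma mxwordDr x y z : mxword x (y + z) = mxword x y + mxword x z.
Proof. exact: mulmxDr. Qed.
Lemma mxwordNl x y : mxword (- x) y = - mxword x y.
Proof. exact: mulNmx. Qed.
Lemma mxwordNr x y : mxword x (- y) = - mxword x y.
Proof. exact: mulmxN. Qed.
Lemma mxwordZl c x y : mxword (c *: x) y = c *: mxword x y.
Proof. by rewrite /mxword scalemxAl. Qed.
Lemma mxwordZr c x y : mxword x (c *: y) = c *: mxword x y.
Proof. by rewrite /mxword scalemxAr. Qed.
Lemma mxwordA x y z : mxword x (mxword y z) = mxword (mxword x y) z.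
Proof. exact: mulmxA. Qed.
Lemma mxword1l x : mxword 1%:M x = x. Proof. exact: mul1mx. Qed.
Lemma mxword1r x : mxword x 1%:M = x. Proof. exact: mulmx1. Qed.
Lemma mxword_scalarl c x : mxword c%:M x = c *: x. Proof. exact: mul_scalar_mx. Qed.
Lemma mxword_scalarr c x : mxword x c%:M = c *: x. Proof. exact: mul_mx_scalar. Qed.

End MatrixWords.

(** Identities between matrix expressions: expand into words, then compare the
    coefficients of the words entrywise. *)
Ltac mxring :=
  rewrite ?mxwordE;
  rewrite ?(mxwordDl, mxwordDr, mxwordNl, mxwordNr, mxword1l, mxword1r,
            mxword_scalarl, mxword_scalarr, mxwordZl, mxwordZr, mxwordA);
  repeat match goal with |- context [@mxword ?S ?m ?x ?y] =>
    generalize (@mxword S m x y) end;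
  intros; apply/matrixP => ? ?; rewrite ?mxE; ring.

Section Dressing.
Context (R : realType) (n : nat).
Local Notation C := R[i].
Local Notation M := 'M[R[i]]_n.+1.
Implicit Types (A P : M) (q : nat -> M) (lam al : C).

(** The right value at [A] of the polynomial with matrix coefficients [q]. *)
Fixpoint right_value A q j : M :=
  if j is j'.+1 then right_value A q j' *m A + q j else q 0%N.

(** The quotient of the polynomial by [lam - A] on the right, see
    [right_division]. *)
Fixpoint right_quotient A q j lam : M :=
  if j is j'.+1 then lam *: right_quotient A q j' lam + right_value A q j' else 0.

(** The coefficients of [(lam - A) (\sum_k q_k lam^-k) (lam - A)^-1], see
    [gauge_dressed]. *)
Definition dressed A q j : M :=
  if j is j'.+1 then q j + bracket (right_value A q j') A else q 0%N.

Lemma lampoly0 q lam : lampoly q 0 lam = q 0%N.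
Proof. by rewrite /lampoly big_ord1 expr0 scale1r. Qed.

Lemma lampolyS q j lam : lampoly q j.+1 lam = lam *: lampoly q j lam + q j.+1.
Proof.
rewrite /lampoly big_ord_recr /= subnn expr0 scale1r scaler_sumr; congr (_ + _).
by apply: eq_bigr => k _; rewrite subSn ?leq_ord// exprS scalerA.
Qed.

Lemma ddpowS al m lam : ddpow al m.+1 lam = lam * ddpow al m lam + al ^+ m.
Proof.
rewrite /ddpow big_ord_recr /= subnn expr0 mul1r mulr_sumr; congr (_ + _).
by apply: eq_bigr => i _; rewrite mulrA -exprS; case: m i => [[]//|m] i /=; rewrite subSn ?leq_ord.
Qed.

Lemma ddlampolyS q j al lam :
  ddlampoly q j.+1 al lam = lam *: ddlampoly q j al lam + lampoly q j al.
Proof.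
rewrite /ddlampoly big_ord_recr /= subnn /ddpow big_ord0 scale0r addr0.
rewrite scaler_sumr /lampoly -big_split; apply: eq_bigr => k _ /=.
by rewrite subSn ?leq_ord// -/(ddpow _ _ _) ddpowS scalerDl scalerA.
Qed.

Lemma right_value_sum A q j :
  \sum_(k < j.+1) q (j - k)%N *m A ^+ k = right_value A q j.
Proof.
elim: j => [|j IH] /=; first by rewrite big_ord1 subnn expr0 mulmx1.
rewrite big_ord_recl subn0 expr0 mulmx1 addrC -IH mulmx_suml; congr (_ + _).
by apply: eq_bigr => k _; rewrite subSS exprSr mulmxA.
Qed.

Lemma right_division A q j lam : lampoly q j lam =
  right_value A q j + right_quotient A q j lam *m (lam%:M - A).
Proof.
elim: j => [|j IH] /=; first by rewrite lampoly0 mul0mx addr0.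
rewrite lampolyS IH; move: (right_value _ _ _) (right_quotient _ _ _ _) => T D; mxring.
Qed.

(** Conjugation with [lam - A] exchanges the two factors of the divisible part; the
    remainder is kept because [A] moves according to [A' = [A, T]]. *)
Lemma lampoly_dressed A q j lam : lampoly (dressed A q) j lam =
  right_value A q j + (lam%:M - A) *m right_quotient A q j lam.
Proof.
elim: j => [|j IH] /=; first by rewrite lampoly0 mulmx0 addr0.
rewrite lampolyS IH /= /bracket.
move: (right_value _ _ _) (right_quotient _ _ _ _) => T D; mxring.
Qed.

Lemma right_value_eigen A q j al P : A *m P = al *: P ->
  right_value A q j *m P = lampoly q j al *m P.
Proof.
move=> AP; elim: j => [|j IH] /=; first by rewrite lampoly0.
by rewrite lampolyS !mulmxDl -mulmxA AP -scalemxAr IH scalemxAl.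
Qed.

Lemma right_quotient_eigen A q j al lam P : A *m P = al *: P ->
  right_quotient A q j lam *m P = ddlampoly q j al lam *m P.
Proof.
move=> AP; elim: j => [|j IH] /=.
  by rewrite /ddlampoly big_ord1 /= /ddpow big_ord0 scale0r.
by rewrite ddlampolyS !mulmxDl -!scalemxAl IH (right_value_eigen _ _ AP).
Qed.

Lemma gauge_dressed A q : gauge_related A (dressed A q) q.
Proof.
split=> // -[|k] /=; rewrite /bracket.
  by rewrite addrA addrAC addrK.
move: (right_value _ _ _) => T; mxring.
Qed.

Lemma bracket_commP A B P : A *m P = P *m A -> bracket (B *m A) P = bracket B P *m A.
Proof. by move=> AP; rewrite /bracket mulmxBl -!mulmxA AP !mulmxA. Qed.

End Dressing.

Section DressedRecursion.
Context (R : realType) (n : nat).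
Local Notation C := R[i].
Local Notation M := 'M[R[i]]_n.+1.

(** The gauge transformation by [lam - A] carries [lam a + u] to
    [lam a + u + [a, A]].  By induction: the defect of the recursion in degree
    [k.+1] is the defect in degree [k] times [A]. *)
Lemma dressed_lax (a : M) (u A : R * R -> M) (q : nat -> R * R -> M) p :
  mxdifferentiable A p -> (forall k, mxdifferentiable (q k) p) ->
  bracket (q 0%N p) a = 0 -> Dx (q 0%N) p = 0 ->
  (forall k, Dx (q k) p + bracket (u p) (q k p) = bracket (q k.+1 p) a) ->
  Dx A p = bracket (A p) (u p + a *m A p) ->
  forall k, Dx (fun p => dressed (A p) (q^~ p) k) p +
     bracket (u p + bracket a (A p)) (dressed (A p) (q^~ p) k) =
     bracket (dressed (A p) (q^~ p) k.+1) a.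
Proof.
move=> dA dq q0a Dq0 qE DA.
pose Pt k p := dressed (A p) (q^~ p) k.
have PtE k : Pt k.+1 = fun p => Pt k p *m A p + q k.+1 p - A p *m q k p.
  apply/funext => p1; have [_ /(_ k)] := gauge_dressed (A p1) (q^~ p1).
  by rewrite -/(Pt k.+1 p1) -/(Pt k p1) => /eqP; rewrite subr_eq => /eqP ->; rewrite addrC addrA.
have dP k : mxdifferentiable (Pt k) p.
  elim: k => [|k IH]; first exact: dq.
  rewrite PtE; apply: mxdifferentiableB; last exact: mxdifferentiableM.
  by apply: mxdifferentiableD => //; exact: mxdifferentiableM.
have qE' k : Dx (q k) p = bracket (q k.+1 p) a - bracket (u p) (q k p).
  by rewrite -qE addrK.
suff H k : Dx (Pt k) p = bracket (Pt k.+1 p) a - bracket (u p + bracket a (A p)) (Pt k p).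
  by move=> k; have := H k; rewrite /Pt => ->; rewrite subrK.
elim: k => [|k IH].
  have H0 : bracket (q 1%N p) a = bracket (u p) (q 0%N p).
    by rewrite -qE Dq0 add0r.
  have -> : Dx (Pt 0%N) p = 0 by rewrite -Dq0.
  apply/esym/eqP; rewrite subr_eq0; apply/eqP.
  have ab : q 0%N p *m a = a *m q 0%N p by apply/eqP; rewrite -subr_eq0; exact/eqP.
  rewrite PtE /= /bracket.
  move: H0 ab; rewrite /Pt /= /bracket.
  set b := q 0%N p; set q1 := q 1%N p; set B := A p; set v := u p => H0 ab.
  have -> : (b *m B + q1 - B *m b) *m a - a *m (b *m B + q1 - B *m b) =
     (q1 *m a - a *m q1) + (b *m B *m a - B *m (b *m a) - a *m b *m B + a *m B *m b).
    mxring.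
  have -> : (v + (a *m B - B *m a)) *m b - b *m (v + (a *m B - B *m a)) =
     (v *m b - b *m v) + (b *m B *m a - B *m (a *m b) - b *m a *m B + a *m B *m b).
    mxring.
  by rewrite H0 ab.
have dPA := mxdifferentiableM (dP k) dA.
have dAq := mxdifferentiableM dA (dq k).
rewrite {1}PtE /Dx (mxderiveB _ (mxdifferentiableD dPA (dq k.+1)) dAq).
rewrite (mxderiveD _ dPA (dq k.+1)) (mxderiveM _ (dP k) dA) (mxderiveM _ dA (dq k)).
move: IH DA (qE' k) (qE' k.+1); rewrite /Dx => -> -> -> ->.
rewrite (PtE k.+1) (PtE k) /bracket.
move: (Pt k p) (q k p) (q k.+1 p) (q k.+2 p) (A p) (u p) => P q0 q1 q2 B v.
mxring.
Qed.

End DressedRecursion.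

(** * The dressed projection and the dressed trivialization *)

Section DressedProjection.
Context (R : realType) (n : nat).
Local Notation C := R[i].
Local Notation M := 'M[R[i]]_n.+1.
Implicit Types (P : M) (lam : C).

Lemma invmx_eq (X Y : M) : X *m Y = 1%:M -> X \in unitmx /\ invmx X = Y.
Proof.
move=> XY; have [uX uY] := mulmx1_unit XY; split=> //.
by rewrite -[LHS]mulmx1 -XY mulKmx.
Qed.

Lemma simple_element_inv al1 al2 P lam : P *m P = P -> lam != al1 -> lam != al2 ->
  simple_element al1 al2 P lam \in unitmx /\
  invmx (simple_element al1 al2 P lam) =
    1%:M - ((al1 - al2) / (lam - al2)) *: (1%:M - P).
Proof.
move=> PP l1 l2; apply: invmx_eq; rewrite /simple_element.
set c := _ / (lam - al1); set d := _ / (lam - al2).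
have QQ : (1%:M - P) *m (1%:M - P) = 1%:M - P.
  by rewrite mulmxBl mul1mx mulmxBr mulmx1 PP subrr subr0.
have H (x y : C) (N : M) : (1%:M + x *: N) *m (1%:M - y *: N) =
   1%:M + x *: N - y *: N - (x * y) *: (N *m N) by mxring.
rewrite H QQ.
have -> : 1%:M + c *: (1%:M - P) - d *: (1%:M - P) - (c * d) *: (1%:M - P) =
   1%:M + (c - d - c * d) *: (1%:M - P) by rewrite !scalerBl !addrA.
have -> : c - d - c * d = 0.
  by rewrite /c /d; field; rewrite !subr_eq0 ?l1 ?l2.
by rewrite scale0r addr0.
Qed.

Section Projector.
Variables (al1 al2 : C) (pi E1 E2 : M).
Hypothesis pipi : pi *m pi = pi.

(** This matrix carries the images of [pi] and [1 - pi] to the subspaces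
    [E1^-1 V1] and [E2^-1 V2]. *)
Definition dressing_frame : M := invmx E1 *m pi + invmx E2 *m (1%:M - pi).
Definition dressed_proj : M := dressing_frame *m pi *m invmx dressing_frame.

Let S := dressing_frame.
Hypothesis uE1 : E1 \in unitmx.
Hypothesis uE2 : E2 \in unitmx.
Hypothesis uS : S \in unitmx.

Let npi : (1%:M - pi) *m pi = 0.
Proof. by rewrite mulmxBl mul1mx pipi subrr. Qed.

Let pin : pi *m (1%:M - pi) = 0.
Proof. by rewrite mulmxBr mulmx1 pipi subrr. Qed.

Let nn : (1%:M - pi) *m (1%:M - pi) = 1%:M - pi.
Proof. by rewrite mulmxBr mulmx1 npi subr0. Qed.

Lemma frame_pi : S *m pi = invmx E1 *m pi.
Proof. by rewrite /S mulmxDl -!mulmxA pipi npi mulmx0 addr0. Qed.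

Lemma frame_npi : S *m (1%:M - pi) = invmx E2 *m (1%:M - pi).
Proof. by rewrite /S mulmxDl -!mulmxA pin nn mulmx0 add0r. Qed.

Lemma dressed_projN : 1%:M - dressed_proj = S *m (1%:M - pi) *m invmx S.
Proof. by rewrite /dressed_proj -/S mulmxBr mulmx1 mulmxBl mulmxV. Qed.

Lemma dressed_proj_frame : dressed_proj *m S = S *m pi.
Proof. by rewrite /dressed_proj -/S mulmxKV. Qed.

Lemma dressed_projN_frame : (1%:M - dressed_proj) *m S = S *m (1%:M - pi).
Proof. by rewrite dressed_projN mulmxKV. Qed.

Lemma dressed_proj_idem : dressed_proj *m dressed_proj = dressed_proj.
Proof.
by rewrite {2}/dressed_proj -/S !mulmxA dressed_proj_frame -[S *m pi *m pi]mulmxA pipi.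
Qed.

Lemma dressed_proj_ker1 : (1%:M - pi) *m E1 *m dressed_proj = 0.
Proof.
rewrite /dressed_proj -/S frame_pi !mulmxA -[_ *m E1 *m invmx E1]mulmxA mulmxV// mulmx1.
by rewrite npi mul0mx.
Qed.

Lemma dressed_proj_ker2 : pi *m E2 *m (1%:M - dressed_proj) = 0.
Proof.
rewrite dressed_projN frame_npi !mulmxA -[_ *m E2 *m invmx E2]mulmxA mulmxV// mulmx1.
by rewrite pin mul0mx.
Qed.

Let V1 := map_subspace (invmx E1) (column_space pi).
Let V2 := map_subspace (invmx E2) (column_space (1%:M - pi)).

Let V1E : V1 = (S *m pi)^T.
Proof. by rewrite frame_pi trmx_mul. Qed.

Let V2E : V2 = (S *m (1%:M - pi))^T.
Proof. by rewrite frame_npi trmx_mul. Qed.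

Lemma dressed_subspaces_cap : (V1 :&: V2)%MS = 0.
Proof.
apply/eqP/rowV0P => w; rewrite sub_capmx => /andP[/submxP[x wx] /submxP[y wy]].
have uST : S^T \in unitmx by rewrite unitmx_tr.
have E : x *m pi^T = y *m (1%:M - pi)^T.
  apply: (can_inj (mulmxK uST)).
  by rewrite -!mulmxA -!trmx_mul -V1E -V2E -wx -wy.
rewrite wx V1E trmx_mul mulmxA.
have -> : x *m pi^T = 0; last by rewrite mul0mx.
by rewrite -{1}pipi trmx_mul mulmxA E -mulmxA -trmx_mul pin trmx0 mulmx0.
Qed.

Lemma dressed_subspaces_add : (V1 + V2 :=: 1%:M)%MS.
Proof.
apply/eqmxP; rewrite submx1 sub1mx /row_full.
have uST : S^T \in unitmx by rewrite unitmx_tr.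
have H : (S^T <= V1 + V2)%MS.
  have -> : S^T = V1 + V2.
    by rewrite V1E V2E -raddfD /= -mulmxDr addrC subrK mulmx1.
  exact: addmx_sub_adds.
rewrite eqn_leq rank_leq_col /=; apply: leq_trans (mxrankS H).
by rewrite mxrank_unit.
Qed.

Lemma projection_on_alongE : projection_on_along V1 V2 = dressed_proj.
Proof.
rewrite /projection_on_along; set Pj := proj_mx V1 V2.
have uST : S^T \in unitmx by rewrite unitmx_tr.
have e1 : V1 *m Pj = V1 by apply: proj_mx_id dressed_subspaces_cap _.
have e2 : V2 *m Pj = 0 by apply: proj_mx_0 dressed_subspaces_cap _.
have e3 : S^T *m Pj = (S *m pi)^T.
  have -> : S^T = V1 + V2.
    by rewrite V1E V2E -raddfD /= -mulmxDr addrC subrK mulmx1.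
  by apply: etrans (mulmxDl _ _ _) _; rewrite e1 e2 addr0 V1E.
have -> : Pj = invmx S^T *m (S *m pi)^T by rewrite -e3 mulKmx.
by rewrite -trmx_inv -trmx_mul trmxK.
Qed.

End Projector.

Section Derivatives.
Variables (V : normedModType R) (O : set V) (E1 E2 : V -> M) (al1 al2 : C) (pi : M).
Hypothesis oO : open O.
Hypothesis pipi : pi *m pi = pi.
Hypothesis uE1 : forall p, O p -> E1 p \in unitmx.
Hypothesis uE2 : forall p, O p -> E2 p \in unitmx.
Hypothesis uS : forall p, O p -> dressing_frame pi (E1 p) (E2 p) \in unitmx.
Hypothesis sE1 : mxsmooth_on O E1.
Hypothesis sE2 : mxsmooth_on O E2.

Let S p := dressing_frame pi (E1 p) (E2 p).
Let tpi p := dressed_proj pi (E1 p) (E2 p).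

Lemma frame_smooth : mxsmooth_on O S.
Proof.
apply: mxsmooth_onD => //; apply: mxsmooth_onM => //;
  first [exact: mxsmooth_onV|exact: mxsmooth_on_cst].
Qed.

Lemma dressed_proj_smooth : mxsmooth_on O tpi.
Proof.
apply: mxsmooth_onM => //; last by apply: mxsmooth_onV => //; exact: frame_smooth.
by apply: mxsmooth_onM => //; [exact: frame_smooth|exact: mxsmooth_on_cst].
Qed.

(** On the image of [tpi] the matrix [T] agrees with [B1], on that of [1 - tpi] with
    [B2]; therefore the frame [S] satisfies [S' = - T S]. *)
Lemma dressed_proj_derive v p (B1 B2 T : M) : O p ->
  mxderive v E1 p = E1 p *m B1 -> mxderive v E2 p = E2 p *m B2 ->
  T *m tpi p = B1 *m tpi p -> T *m (1%:M - tpi p) = B2 *m (1%:M - tpi p) ->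
  mxderive v tpi p = bracket (tpi p) T.
Proof.
move=> Op DE1 DE2 T1 T2.
have dS := mxsmooth_on_diff frame_smooth Op.
have [e1 e2 e3] := And3 (uE1 Op) (uE2 Op) (uS Op).
have dV1 : mxdifferentiable (fun q => invmx (E1 q)) p.
  by apply: (mxsmooth_on_diff (U := O)) => //; exact: mxsmooth_onV.
have dV2 : mxdifferentiable (fun q => invmx (E2 q)) p.
  by apply: (mxsmooth_on_diff (U := O)) => //; exact: mxsmooth_onV.
have dVS : mxdifferentiable (fun q => invmx (S q)) p.
  by apply: (mxsmooth_on_diff (U := O)) => //; apply: mxsmooth_onV => //; exact: frame_smooth.
have dpi := mxdifferentiable_cst pi p.
have dnpi := mxdifferentiable_cst (1%:M - pi) p.
have DS : mxderive v S p = - T *m S p.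
  rewrite /S /dressing_frame (mxderiveD _ (mxdifferentiableM dV1 dpi) (mxdifferentiableM dV2 dnpi)).
  rewrite (mxderiveM _ dV1 dpi) (mxderiveM _ dV2 dnpi) !mxderive_cst !mulmx0 !addr0.
  rewrite (mxderiveV oO v uE1 sE1 Op) (mxderiveV oO v uE2 sE2 Op) DE1 DE2.
  have f1 : invmx (E1 p) *m pi = tpi p *m S p.
    by rewrite -(frame_pi (E1 p) (E2 p) pipi) dressed_proj_frame.
  have f2 : invmx (E2 p) *m (1%:M - pi) = (1%:M - tpi p) *m S p.
    by rewrite -(frame_npi (E1 p) (E2 p) pipi) dressed_projN_frame.
  rewrite !mulNmx !mulKmx// -!mulmxA f1 f2 -/(S p).
  rewrite (mulmxA B1 (tpi p)) (mulmxA B2 (1%:M - tpi p)) -T1 -T2.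
  move: (tpi p) (S p) => P F; mxring.
rewrite /tpi /dressed_proj (mxderiveM _ (mxdifferentiableM dS dpi) dVS).
rewrite (mxderiveM _ dS dpi) mxderive_cst mulmx0 addr0.
rewrite (mxderiveV oO v uS frame_smooth Op) -/(S p) DS /bracket.
have H (X F I : M) : F *m I = 1%:M ->
    (- X *m F) *m pi *m I + F *m pi *m (- I *m (- X *m F) *m I) =
    (F *m pi *m I) *m X - X *m (F *m pi *m I).
  move=> FI.
  have -> : F *m pi *m (- I *m (- X *m F) *m I) = F *m pi *m I *m X *m (F *m I) by mxring.
  by rewrite FI mulmx1; mxring.
by apply: H; rewrite mulmxV.
Qed.

End Derivatives.

Section DressedTrivialization.
Variables (al1 al2 : C) (pi : M).

(** The matrix [A] for which the simple element of [P] is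
    [(lam - A) / (lam - al1)]. *)
Definition dressing_root P : M := al2%:M + (al1 - al2) *: P.

(** The product [h E h~^-1] after cancellation of its poles; [d1] and [d2] stand for
    the divided differences of [E] at [al1] and [al2], see [dressed_trivE]. *)
Definition dressed_triv (E d1 d2 P : M) : M :=
  E + (al1 - al2) *: ((1%:M - pi) *m d1 *m P - pi *m d2 *m (1%:M - P)).

Lemma dressing_root_eigen P : P *m P = P ->
  dressing_root P *m P = al1 *: P /\
  dressing_root P *m (1%:M - P) = al2 *: (1%:M - P) /\
  P *m dressing_root P = al1 *: P /\
  (1%:M - P) *m dressing_root P = al2 *: (1%:M - P).
Proof.
move=> PP; rewrite /dressing_root.
have e1 : (al2%:M + (al1 - al2) *: P) *m P = al2 *: P + (al1 - al2) *: (P *m P) by mxring.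
have e2 : (al2%:M + (al1 - al2) *: P) *m (1%:M - P) =
  al2 *: (1%:M - P) + (al1 - al2) *: (P - P *m P) by mxring.
have e3 : P *m (al2%:M + (al1 - al2) *: P) = al2 *: P + (al1 - al2) *: (P *m P) by mxring.
have e4 : (1%:M - P) *m (al2%:M + (al1 - al2) *: P) =
  al2 *: (1%:M - P) + (al1 - al2) *: (P - P *m P) by mxring.
rewrite e1 e2 e3 e4 PP subrr scaler0 addr0.
by rewrite -scalerDl addrC subrK.
Qed.

Lemma dressed_trivE E E1 E2 d1 d2 P lam : P *m P = P ->
  (lam - al1) *: d1 = E - E1 -> (lam - al2) *: d2 = E - E2 ->
  (1%:M - pi) *m E1 *m P = 0 -> pi *m E2 *m (1%:M - P) = 0 ->
  lam != al1 -> lam != al2 ->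
  dressed_triv E d1 d2 P =
    simple_element al1 al2 pi lam *m E *m invmx (simple_element al1 al2 P lam).
Proof.
move=> PP D1 D2 K1 K2 l1 l2.
have [_ ->] := simple_element_inv PP l1 l2; rewrite /simple_element /dressed_triv.
have l1' : lam - al1 != 0 by rewrite subr_eq0.
have l2' : lam - al2 != 0 by rewrite subr_eq0.
set c := _ / (lam - al1); set d := _ / (lam - al2).
have cd : c * d = c - d by rewrite /c /d; field; rewrite ?l1' ?l2'.
have cE : c * (lam - al1) = al1 - al2 by rewrite divfK.
have dE : d * (lam - al2) = al1 - al2 by rewrite divfK.
clearbody c d.
have X : (al1 - al2) *: ((1%:M - pi) *m d1 *m P) = c *: ((1%:M - pi) *m E *m P).
  have -> : (al1 - al2) *: ((1%:M - pi) *m d1 *m P) =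
     c *: ((1%:M - pi) *m ((lam - al1) *: d1) *m P).
    by rewrite -scalemxAr -scalemxAl scalerA cE.
  rewrite D1; have -> : (1%:M - pi) *m (E - E1) *m P =
    (1%:M - pi) *m E *m P - (1%:M - pi) *m E1 *m P by mxring.
  by rewrite K1 subr0.
have Y : (al1 - al2) *: (pi *m d2 *m (1%:M - P)) = d *: (pi *m E *m (1%:M - P)).
  have -> : (al1 - al2) *: (pi *m d2 *m (1%:M - P)) =
     d *: (pi *m ((lam - al2) *: d2) *m (1%:M - P)).
    by rewrite -scalemxAr -scalemxAl scalerA dE.
  rewrite D2; have -> : pi *m (E - E2) *m (1%:M - P) =
    pi *m E *m (1%:M - P) - pi *m E2 *m (1%:M - P) by mxring.
  by rewrite K2 subr0.
rewrite scalerBr X Y.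
have -> : (1%:M + c *: (1%:M - pi)) *m E *m (1%:M - d *: (1%:M - P)) =
  E + c *: ((1%:M - pi) *m E) - d *: (E *m (1%:M - P))
  - (c * d) *: ((1%:M - pi) *m E *m (1%:M - P)).
  by move: (1%:M - pi) (1%:M - P) => N N'; mxring.
by rewrite cd; mxring.
Qed.

(** With [D] the right quotient of the connection polynomial, [X = (1 - pi) d1 P]
    and [Y = pi d2 (1 - P)] satisfy [X' = (1 - pi) E D P + X T] and
    [Y' = pi E D (1 - P) + Y T], while [(X - Y) (lam - A) = E P - pi E]. *)
Lemma dressed_triv_derive (V : normedModType R) (v p : V) (E d1 d2 P : V -> M)
    (q : nat -> M) j (E1 E2 : M) lam :
  mxdifferentiable E p -> mxdifferentiable d1 p -> mxdifferentiable d2 p ->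
  mxdifferentiable P p ->
  let A := dressing_root (P p) in
  mxderive v E p = E p *m lampoly q j lam ->
  mxderive v d1 p = d1 p *m lampoly q j al1 + E p *m ddlampoly q j al1 lam ->
  mxderive v d2 p = d2 p *m lampoly q j al2 + E p *m ddlampoly q j al2 lam ->
  mxderive v P p = bracket (P p) (right_value A q j) ->
  P p *m P p = P p ->
  (lam - al1) *: d1 p = E p - E1 -> (lam - al2) *: d2 p = E p - E2 ->
  (1%:M - pi) *m E1 *m P p = 0 -> pi *m E2 *m (1%:M - P p) = 0 ->
  mxderive v (fun r => dressed_triv (E r) (d1 r) (d2 r) (P r)) p =
    dressed_triv (E p) (d1 p) (d2 p) (P p) *m lampoly (dressed A q) j lam.
Proof.
move=> dE dd1 dd2 dP A DE Dd1 Dd2 DP PP R1 R2 K1 K2.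
have dc (X : M) := mxdifferentiable_cst X p.
have dN : mxdifferentiable (fun r => 1%:M - P r) p by exact: mxdifferentiableB.
have d1' := mxdifferentiableM (mxdifferentiableM (dc (1%:M - pi)) dd1) dP.
have d2' := mxdifferentiableM (mxdifferentiableM (dc pi) dd2) dN.
have := dressing_root_eigen PP; rewrite -/A => -[AP [AN [PA NA]]].
rewrite /dressed_triv (mxderiveD _ dE (mxdifferentiableZ _ (mxdifferentiableB d1' d2'))).
rewrite (mxderiveZ _ _ (mxdifferentiableB d1' d2')) (mxderiveB _ d1' d2').
rewrite (mxderiveM _ (mxdifferentiableM (dc (1%:M - pi)) dd1) dP).
rewrite (mxderiveM _ (mxdifferentiableM (dc pi) dd2) dN).
rewrite (mxderiveM _ (dc (1%:M - pi)) dd1) (mxderiveM _ (dc pi) dd2) !mxderive_cst.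
rewrite (mxderiveB _ (dc 1%:M) dP) mxderive_cst !mul0mx !add0r DE Dd1 Dd2 DP.
rewrite lampoly_dressed (right_division A).
have T1 := right_value_eigen q j AP; have T2 := right_value_eigen q j AN.
have C1 := right_quotient_eigen q j lam AP; have C2 := right_quotient_eigen q j lam AN.
move: T1 T2 C1 C2; rewrite /bracket.
have AE : A = al2%:M + (al1 - al2) *: P p by [].
clearbody A.
move: (right_value A q j) (right_quotient A q j lam) => T D.
move: (lampoly q j al1) (lampoly q j al2) (ddlampoly q j al1 lam) (ddlampoly q j al2 lam).
move=> B1 B2 F1 F2 T1 T2 C1 C2.
have [N NE] : exists N, N = 1%:M - P p by eexists.
have [ni niE] : exists ni, ni = 1%:M - pi by eexists.
rewrite -NE in T2 C2 K2 R2 AN NA *; rewrite -niE in K1 *.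
have X : (ni *m (d1 p *m B1 + E p *m F1)) *m P p + ni *m d1 p *m (P p *m T - T *m P p) =
    ni *m E p *m D *m P p + ni *m d1 p *m P p *m T.
  have -> : (ni *m (d1 p *m B1 + E p *m F1)) *m P p =
    ni *m d1 p *m (B1 *m P p) + ni *m E p *m (F1 *m P p) by mxring.
  by rewrite -T1 -C1; mxring.
have Y : (pi *m (d2 p *m B2 + E p *m F2)) *m N + pi *m d2 p *m (- (P p *m T - T *m P p)) =
    pi *m E p *m D *m N + pi *m d2 p *m N *m T.
  have -> : (pi *m (d2 p *m B2 + E p *m F2)) *m N =
    pi *m d2 p *m (B2 *m N) + pi *m E p *m (F2 *m N) by mxring.
  by rewrite -T2 -C2 NE; mxring.
rewrite X Y.
have Z : (ni *m d1 p *m P p - pi *m d2 p *m N) *m (lam%:M - A) = E p *m P p - pi *m E p.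
  have -> : (ni *m d1 p *m P p - pi *m d2 p *m N) *m (lam%:M - A) =
    lam *: (ni *m d1 p *m P p) - ni *m d1 p *m (P p *m A)
    - (lam *: (pi *m d2 p *m N) - pi *m d2 p *m (N *m A)) by mxring.
  rewrite PA NA -!scalemxAr -!scalerBl.
  have -> : (lam - al1) *: (ni *m d1 p *m P p) = ni *m ((lam - al1) *: d1 p) *m P p by mxring.
  have -> : (lam - al2) *: (pi *m d2 p *m N) = pi *m ((lam - al2) *: d2 p) *m N by mxring.
  rewrite R1 R2; have -> : ni *m (E p - E1) *m P p = ni *m E p *m P p - ni *m E1 *m P p by mxring.
  have -> : pi *m (E p - E2) *m N = pi *m E p *m N - pi *m E2 *m N by mxring.
  by rewrite K1 K2 !subr0 niE NE; mxring.
have -> : (E p + (al1 - al2) *: (ni *m d1 p *m P p - pi *m d2 p *m N)) *m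
   (T + (lam%:M - A) *m D) = E p *m T + E p *m (lam%:M - A) *m D +
   (al1 - al2) *: ((ni *m d1 p *m P p - pi *m d2 p *m N) *m T) +
   (al1 - al2) *: ((ni *m d1 p *m P p - pi *m d2 p *m N) *m (lam%:M - A) *m D) by mxring.
rewrite Z AE niE NE; mxring.
Qed.

End DressedTrivialization.

End DressedProjection.

(** * Asymptotic expansions and poles *)

Section Modulus.
Context (R : realType).
Local Notation C := R[i].
Implicit Types x y : C.

(** The real number that the norm of a complex number represents. *)
Definition modulus x : R := complex.Re `|x|.

Lemma modulusE x : `|x| = (modulus x)%:C.
Proof. by rewrite /modulus; case: x => u v; rewrite normc_def. Qed.

Lemma modulusV x : modulus x^-1 = (modulus x)^-1.
Proof. by apply: complexI; rewrite fmorphV /= -!modulusE normfV. Qed.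

Lemma modulus_le_cnorm1 x : modulus x <= cnorm1 x.
Proof. by rewrite -lecR -modulusE normc_le_cnorm1. Qed.

Lemma cnorm1_le_modulus x : cnorm1 x <= 2 * modulus x.
Proof. by rewrite -lecR rmorphM /= -modulusE rmorph_nat cnorm1_le_normc. Qed.

End Modulus.

Section Asymptotics.
Context (R : realType) (n : nat).
Local Notation C := R[i].
Local Notation M := 'M[R[i]]_n.+1.
Variables (a : M) (P : set C).

Definition remainder_bound N (f : C -> M) (c : nat -> M) := exists K r : R,
  forall lam, ~ Gamma a lam -> ~ P lam -> r <= modulus lam ->
    norm1 (f lam - \sum_(s < N) lam ^- s *: c s) <= K * modulus lam ^- N.

Lemma asymptotic_atP f c : asymptotic_at a P f c <-> forall N, remainder_bound N f c.
Proof.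
have E (K : R) lam (x : C) N :
    (`|x| <= K%:C * `|lam| ^- N) = (modulus x <= K * modulus lam ^- N).
  by rewrite !modulusE -rmorphXn -fmorphV -rmorphM lecR.
split=> H N; have [K [r Kr]] := H N.
  exists (real_dim R n * K), r => lam l1 l2 l3.
  have {}Kr := Kr lam l1 l2; rewrite modulusE lecR in Kr; have {}Kr := Kr l3.
  have -> : real_dim R n * K * modulus lam ^- N = (n.+1 * n.+1)%:R * (2 * (K * modulus lam ^- N)).
    by rewrite /real_dim natrM; ring.
  apply: sum_le_const => i k; rewrite (le_trans (cnorm1_le_modulus _))//.
  by rewrite ler_wpM2l// -E Kr.
exists K, r => lam l1 l2; rewrite modulusE lecR => l3 i k.
rewrite -modulusE E (le_trans (modulus_le_cnorm1 _))//.
by rewrite (le_trans (norm1_entry _ i k))// Kr.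
Qed.

(** The expansion of [c (lam - al) (lam - A)^-1], for [c] the series
    [\sum_k c_k lam^-k]. *)
Fixpoint dressed_coef (A : M) (al : C) (c : nat -> M) k : M :=
  if k is k'.+1 then c k + dressed_coef A al c k' *m A - al *: c k' else c 0%N.

(** A solution [g] of [g (lam - A) = (lam - al) f] inherits an asymptotic expansion
    from [f]: each further coefficient comes from
    [g = f + lam^-1 (g A - al f)]. *)
Lemma asymptotic_dressing f g c (A : M) al :
  (exists K r : R, forall lam, ~ Gamma a lam -> ~ P lam -> r <= modulus lam ->
     norm1 (g lam) <= K) ->
  (forall lam, ~ Gamma a lam -> ~ P lam -> g lam *m (lam%:M - A) = (lam - al) *: f lam) ->
  asymptotic_at a P f c -> asymptotic_at a P g (dressed_coef A al c).
Proof.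
move=> [K0 [r0 gK0]] gA /asymptotic_atP fc; apply/asymptotic_atP; elim=> [|N [K [r IH]]].
  exists K0, r0 => lam l1 l2 l3; rewrite big_ord0 subr0 expr0 invr1 mulr1.
  exact: gK0.
have [K1 [r1 f1]] := fc N.+1; have [K2 [r2 f2]] := fc N.
exists (K1 + 2 * (K * norm1 A + cnorm1 al * K2)), (Num.max 1 (Num.max r (Num.max r1 r2))).
move=> lam l1 l2; rewrite !ge_max => /and4P[l3 l4 l5 l6].
have lam0 : lam != 0.
  apply: contraTneq l3 => ->; rewrite -ltNge /modulus normr0 /= ltr01//.
have gE : g lam = f lam + lam^-1 *: (g lam *m A - al *: f lam).
  have := gA lam l1 l2; rewrite mulmxBr mul_mx_scalar scalerBl => E.
  have E' : lam *: g lam = lam *: f lam + (g lam *m A - al *: f lam).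
    by rewrite -[lam *: g lam](subrK (g lam *m A)) E addrAC addrA.
  by rewrite -[LHS]scale1r -(mulVf lam0) -scalerA E' scalerDr scalerA mulVf// scale1r.
set G := g lam - \sum_(s < N) lam ^- s *: dressed_coef A al c s.
set F := f lam - \sum_(s < N) lam ^- s *: c s.
set F1 := f lam - \sum_(s < N.+1) lam ^- s *: c s.
have -> : g lam - \sum_(s < N.+1) lam ^- s *: dressed_coef A al c s =
    F1 + lam^-1 *: (G *m A - al *: F).
  rewrite {1}gE /F1 /G /F !big_ord_recl expr0 invr1 !scale1r /=.
  rewrite mulmxBl mulmx_suml [al *: (_ - \sum_(_ < _) _)]scalerBr [al *: \sum_(_ < _) _]scaler_sumr.
  have -> : \sum_(i < N) lam ^- (bump 0 i) *: (c (bump 0 i)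
      + dressed_coef A al c i *m A - al *: c i) =
     \sum_(i < N) lam ^- (bump 0 i) *: c (bump 0 i)
     + lam^-1 *: (\sum_(i < N) lam ^- i *: dressed_coef A al c i *m A
       - \sum_(i < N) al *: (lam ^- i *: c i)).
    rewrite -sumrB scaler_sumr -big_split; apply: eq_bigr => i _ /=.
    rewrite /bump /= add1n -addrA scalerDr; congr (_ + _).
    by rewrite -scalemxAl scalerA mulrC -scalerA -scalerBr scalerA exprS invfM.
  move: (\sum_(i < N) lam ^- (bump 0 i) *: _) (\sum_(i < N) _ *m A) (\sum_(i < N) al *: _).
  move: (g lam *m A) (f lam) (c 0%N) => x1 x2 x3 x4 x5 x6.
  by apply/matrixP => i k; rewrite !mxE; ring.
have H1 := f1 lam l1 l2 l5; have H2 := f2 lam l1 l2 l6; have H3 := IH lam l1 l2 l4.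
rewrite mulrDl (le_trans (norm1D _ _))// lerD//.
rewrite (le_trans (norm1Z _ _))//.
have lV : cnorm1 lam^-1 <= 2 * (modulus lam)^-1.
  by rewrite (le_trans (cnorm1_le_modulus _))// modulusV.
rewrite exprS invfM [leRHS](_ : _ = (2 * (modulus lam)^-1) *
   (K * modulus lam ^- N * norm1 A + cnorm1 al * (K2 * modulus lam ^- N))); last by ring.
rewrite ler_pM ?cnorm1_ge0 ?norm1_ge0//.
rewrite (le_trans (norm1B _ _))// lerD//.
  by rewrite (le_trans (norm1M _ _))// ler_wpM2r ?norm1_ge0.
by rewrite (le_trans (norm1Z _ _))// ler_wpM2l ?cnorm1_ge0.
Qed.

End Asymptotics.

Section Meromorphic.
Context (R : realType).
Local Notation C := R[i].
Implicit Types (f g : C -> C) (P : set C) (z : C).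

(** A pole or a regular point of [f] at [z] with no point of [P] accumulating; the
    form is closed under sums and products. *)
Definition meromorphic_at P f z := exists (k : nat) (g : C -> C),
  (\forall w \near (z : C^o), holomorphic_at g w) /\
  (\forall w \near ((z : C^o)^'), ~ P w /\ (w - z) ^+ k * f w = g w).

Lemma holomorphicX f k z : holomorphic_at f z -> holomorphic_at (fun w => f w ^+ k) z.
Proof.
move=> hf; elim: k => [|k IH].
  under eq_fun do rewrite expr0; exact: holomorphic_cst.
under eq_fun do rewrite exprS.
exact: (@holomorphicM R f (fun w => f w ^+ k) z hf IH).
Qed.

Lemma holomorphic_shift c z : holomorphic_at (fun w => w - c) z.
Proof. by apply: holomorphicD; [exact: holomorphic_id|exact: holomorphic_cst]. Qed.

Lemma meromorphicM P f g z : meromorphic_at P f z -> meromorphic_at P g z ->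
  meromorphic_at P (fun w => f w * g w) z.
Proof.
move=> [k [f1 [hf ef]]] [l [g1 [hg eg]]]; exists (k + l)%N, (fun w => f1 w * g1 w); split.
  apply: filterS2 hf hg => w h1 h2.
  exact: (@holomorphicM R f1 g1 w h1 h2).
by apply: filterS2 ef eg => w [Pw <-] [_ <-]; split=> //; rewrite exprD; ring.
Qed.

Lemma meromorphicD P f g z : meromorphic_at P f z -> meromorphic_at P g z ->
  meromorphic_at P (fun w => f w + g w) z.
Proof.
move=> [k [f1 [hf ef]]] [l [g1 [hg eg]]].
exists (k + l)%N, (fun w => (w - z) ^+ l * f1 w + (w - z) ^+ k * g1 w); split.
  apply: filterS2 hf hg => w h1 h2.
  have hX m : holomorphic_at (fun w => (w - z) ^+ m) w.
    exact: (@holomorphicX (fun w => w - z) m w (@holomorphic_shift z w)).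
  exact: (@holomorphicD R (fun w => (w - z) ^+ l * f1 w) (fun w => (w - z) ^+ k * g1 w) w
    (@holomorphicM R (fun w => (w - z) ^+ l) f1 w (hX l) h1)
    (@holomorphicM R (fun w => (w - z) ^+ k) g1 w (hX k) h2)).
by apply: filterS2 ef eg => w [Pw <-] [_ <-]; split=> //; rewrite exprD; ring.
Qed.

Lemma meromorphic_holo P f z : (\forall w \near ((z : C^o)^'), ~ P w) ->
  (\forall w \near (z : C^o), holomorphic_at f w) -> meromorphic_at P f z.
Proof.
move=> nP hf; exists 0%N, f; split=> //; near=> w; split; last by rewrite expr0 mul1r.
by near: w.
Unshelve. all: by end_near. Qed.

Lemma meromorphic_sum P (I : Type) (r : seq I) (F : I -> C -> C) z :
  (\forall w \near ((z : C^o)^'), ~ P w) ->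
  (forall i, meromorphic_at P (F i) z) ->
  meromorphic_at P (fun w => \sum_(i <- r) F i w) z.
Proof.
move=> nP mF; elim: r => [|i r IH].
  under eq_fun do rewrite big_nil; apply: meromorphic_holo => //.
  by near=> w; exact: holomorphic_cst.
under eq_fun do rewrite big_cons.
exact: (@meromorphicD P (F i) (fun w => \sum_(i <- r) F i w) z (mF i) IH).
Unshelve. all: by end_near. Qed.

Lemma eq_meromorphic P f g z : (\forall w \near ((z : C^o)^'), f w = g w) ->
  meromorphic_at P f z -> meromorphic_at P g z.
Proof.
move=> fg [k [f1 [hf ef]]]; exists k, f1; split=> //; near=> w.
have <- : f w = g w by near: w.
by near: w.
Unshelve. all: by end_near. Qed.

Lemma near_puncture z x : \forall w \near ((z : C^o)^'), w <> x.
Proof.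
have [->|zx] := eqVneq z x; last first.
  by apply: cvg_within; apply: filterS (near_neq zx) => w /eqP.
by apply: filterS (nbhs_dnbhs_neq (x : C^o)) => w /eqP.
Qed.

Lemma meromorphic_pole P (c d al : C) z : (\forall w \near ((z : C^o)^'), ~ P w) ->
  meromorphic_at P (fun w => c - d / (w - al)) z.
Proof.
have [->|zal] := eqVneq z al => nP; last first.
  apply: meromorphic_holo => //; near=> w.
  have wal : w - al != 0 by rewrite subr_eq0; near: w; exact: near_neq.
  apply: (@holomorphicD R (fun=> c) (fun w => - (d / (w - al))) w (@holomorphic_cst R c w)).
  under eq_fun do rewrite -mulNr.
  apply: (@holomorphicM R (fun=> - d) (fun w => (w - al)^-1) w (@holomorphic_cst R (- d) w)).
  exact: (@holomorphicV R (fun w => w - al) w wal (@holomorphic_shift al w)).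
exists 1%N, (fun w => (w - al) * c - d); split.
  near=> w.
  apply: (@holomorphicD R (fun w => (w - al) * c) (fun=> - d) w _ (@holomorphic_cst R (- d) w)).
  exact: (@holomorphicM R (fun w => w - al) (fun=> c) w (@holomorphic_shift al w)
    (@holomorphic_cst R c w)).
apply: filterS2 nP (near_puncture al al) => w Pw wal; split=> //.
have w0 : w - al != 0 by rewrite subr_eq0; apply/eqP.
by rewrite expr1 mulrBr mulrCA divff// mulr1.
Unshelve. all: by end_near. Qed.

End Meromorphic.

(** * The dressed wave function *)

Section WaveFunction.
Context (R : realType) (n : nat).
Local Notation C := R[i].
Local Notation M := 'M[R[i]]_n.+1.

Lemma to_complexE (z : C) : to_complex (complex.Re z, complex.Im z) = z.
Proof. by case: z. Qed.

Lemma open_slice (O : set (R * R)) (Dset : set ((R * R) * (R * R))) (p : R * R) (z : C) :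
  open Dset -> Dset (p, (complex.Re z, complex.Im z)) ->
  \forall w \near (z : C^o), Dset (p, (complex.Re w, complex.Im w)).
Proof.
move=> oD Dz; have /nbhs_ballP[r /= r0 rP] : nbhs (p, (complex.Re z, complex.Im z)) Dset.
  exact: open_nbhs_nbhs.
apply/nbhs_ballP; exists (r%:C); first by rewrite /= ltcR.
move=> w; rewrite -ball_normE /= => zw; apply: rP.
split=> /=; first exact: ballxx.
have zwR : modulus (z - w) < r by rewrite -ltcR -modulusE.
have reim : `|complex.Re (z - w)| <= modulus (z - w) /\ `|complex.Im (z - w)| <= modulus (z - w).
  case: (z - w) => x y; rewrite /modulus normc_def /=.
  by split; rewrite -sqrtr_sqr ler_wsqrtr// ?lerDl ?lerDr sqr_ge0.
split=> /=; rewrite -ball_normE /=.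
  by apply: le_lt_trans zwR; rewrite -complexReN -complexReD; case: reim.
by apply: le_lt_trans zwR; rewrite -complexImN -complexImD; case: reim.
Qed.

Lemma open_neq_complex (al : C) : open [set w : (R * R) * (R * R) | to_complex w.2 <> al].
Proof.
rewrite (_ : [set w | _] = snd @^-1` (~` [set (complex.Re al, complex.Im al)])).
  apply: open_comp; first by move=> w _; exact: cvg_snd.
  by apply: closed_openC; apply: accessible_closed_set1; apply: hausdorff_accessible; exact: norm_hausdorff.
apply/seteqP; split=> -[p [x y]] /=; case: al => s t H E; apply: H; move: E.
  by case=> -> ->.
by rewrite /to_complex /= => -[-> ->].
Qed.

Lemma smooth_comp_fst (O : set (R * R)) (D : set ((R * R) * (R * R))) (F : R * R -> M) :
  open O -> open D -> (forall w, D w -> O w.1) -> mxsmooth_on O F ->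
  mxsmooth_on D (fun w => F w.1).
Proof.
move=> oO oD DO sF i k; have [s1 s2] := sF i k.
have cf : continuous (fst : (R * R) * (R * R) -> R * R) by move=> w; exact: cvg_fst.
split; [exact: (smooth_on_comp_linear (l := fst) oD oO cf DO s1)
       |exact: (smooth_on_comp_linear (l := fst) oD oO cf DO s2)].
Qed.

Lemma csmooth_to_complex (D : set ((R * R) * (R * R))) : open D ->
  csmooth_on D (fun w => to_complex w.2).
Proof.
move=> oD; have oT := @openT (R * R)%type.
have cs : continuous (snd : (R * R) * (R * R) -> R * R) by move=> w; exact: cvg_snd.
split.
  apply: (smooth_on_comp_linear (l := snd) (f := fst) oD oT cs) => //.
  apply: (@eq_smooth_on R (R * R)%type setT oT (plane_form 1 0)); last first.
    by apply: smooth_on_linear => //; exact: plane_form_continuous.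
  by move=> q _; rewrite /plane_form mul1r mul0r addr0.
apply: (smooth_on_comp_linear (l := snd) (f := snd) oD oT cs) => //.
apply: (@eq_smooth_on R (R * R)%type setT oT (plane_form 0 1)); last first.
  by apply: smooth_on_linear => //; exact: plane_form_continuous.
by move=> q _; rewrite /plane_form mul1r mul0r add0r.
Qed.

(** The inverse simple elements are rational in [lam] with their only pole at [al2]
    and invertible away from [al1] and [al2], so these two points are added to
    the poles. *)
Lemma dressed_wave_function (a b : M) (j : nat) (O1 O : set (R * R)) (u : R * R -> M)
    (E m tE : R * R -> C -> M) (al1 al2 : C) (pi : M) (P : R * R -> M) :
  reduced_wave_function a b j O1 u E m ->
  open O -> O (0, 0) -> O `<=` O1 -> mxsmooth_on O P ->
  (forall p, O p -> P p *m P p = P p) -> pi *m pi = pi -> P (0, 0) = pi ->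
  (forall p lam, O p -> lam <> al1 -> lam <> al2 ->
     tE p lam = simple_element al1 al2 pi lam *m E p lam
                  *m invmx (simple_element al1 al2 (P p) lam)) ->
  reduced_wave_function a b j O (fun p => u p + (al1 - al2) *: bracket a (P p)) tE
    (fun p lam => m p lam *m invmx (simple_element al1 al2 (P p) lam)).
Proof.
move=> [Pol [[oD sD] um mm [mk mkP] mE]] oO O0 OO1 sP PP pipi P0 tEE.
pose Pol' p := [set lam | [\/ Pol p lam, lam = al1 | lam = al2]].
have hE p lam : O p -> lam <> al1 -> lam <> al2 ->
    simple_element al1 al2 (P p) lam \in unitmx /\
    invmx (simple_element al1 al2 (P p) lam) =
    1%:M - ((al1 - al2) / (lam - al2)) *: (1%:M - P p).
  by move=> Op /eqP l1 /eqP l2; apply: simple_element_inv => //; exact: PP.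
set D := [set w | _] in oD sD.
have DE p (z : C) : D (p, (complex.Re z, complex.Im z)) <->
    [/\ O1 p, ~ Gamma a z & ~ Pol p z] by rewrite /D /= to_complexE.
exists Pol'; split.
- set D' := [set w | _].
  have D'E : D' = D `&` (fst @^-1` O) `&`
      ([set w | to_complex w.2 <> al1] `&` [set w | to_complex w.2 <> al2]).
    apply/seteqP; split=> w /=.
      move=> [Ow Gw nP]; split; first split=> //.
        by split=> //; [exact: OO1|move=> Pw; apply: nP; exact: Or31].
      by split=> lE; apply: nP; [exact: Or32|exact: Or33].
    by move=> [[[w1 Gw nP] Ow] [l1 l2]]; split=> // -[].
  have oD' : open D'.
    rewrite D'E; apply: openI; last by apply: openI; exact: open_neq_complex.
    by apply: openI => //; apply: open_comp => // w _; exact: cvg_fst.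
  have D'O w : D' w -> O w.1 by case.
  have D'n w : D' w -> to_complex w.2 <> al1 /\ to_complex w.2 <> al2.
    by move=> [_ _ nP]; split=> lE; apply: nP; [exact: Or32|exact: Or33].
  split=> //.
  apply: (@eq_mxsmooth_on _ _ _ _ oD' (fun w => m w.1 (to_complex w.2) *m
      (1%:M - ((al1 - al2) / (to_complex w.2 - al2)) *: (1%:M - P w.1)))).
    by move=> w Dw; have [l1 l2] := D'n w Dw; have [_ ->] := hE w.1 _ (D'O _ Dw) l1 l2.
  have sT : csmooth_on D' (fun w => to_complex w.2 - al2).
    apply: csmooth_onD => //; first exact: csmooth_to_complex.
    exact: csmooth_on_cst.
  apply: mxsmooth_onM => //.
    by apply: mxsmooth_on_sub sD => w; rewrite D'E => -[[]].
  apply: mxsmooth_onB => //; first exact: mxsmooth_on_cst.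
  apply: mxsmooth_on_scale => //.
    apply: csmooth_onM => //; first exact: csmooth_on_cst.
    apply: csmooth_onV => // w Dw; have [_ l2] := D'n w Dw.
    by rewrite subr_eq0; apply/eqP.
  apply: mxsmooth_onB => //; first exact: mxsmooth_on_cst.
  exact: (smooth_comp_fst oO oD' D'O).
- move=> p lam Op Gl nP.
  have l1 : lam <> al1 by move=> lE; apply: nP; exact: Or32.
  have l2 : lam <> al2 by move=> lE; apply: nP; exact: Or33.
  rewrite unitmx_mul unitmx_inv um//=; [|exact: OO1|by move=> Pl; apply: nP; exact: Or31].
  by have [] := hE p lam Op l1 l2.
- move=> p Op i k.
  have invE lam : lam <> al1 -> lam <> al2 ->
      (m p lam *m invmx (simple_element al1 al2 (P p) lam)) i k =
      \sum_l m p lam i l * ((1%:M : M) l k - ((al1 - al2) * (1%:M - P p) l k) / (lam - al2)).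
    move=> l1 l2; have [_ ->] := hE p lam Op l1 l2; rewrite mxE.
    apply: eq_bigr => l _; congr (_ * _).
    by rewrite [LHS]mxE [X in _ + X]mxE [X in _ - X]mxE mulrAC.
  have nearD z : ~ Gamma a z -> ~ Pol p z ->
      \forall w \near (z : C^o), ~ Gamma a w /\ ~ Pol p w.
    move=> Gz Pz; have Dz : D (p, (complex.Re z, complex.Im z)).
      by apply/DE; split=> //; exact: OO1.
    by apply: filterS (open_slice O oD Dz) => w /DE[].
  have nPol z : ~ Gamma a z -> \forall w \near ((z : C^o)^'), ~ Pol p w.
    move=> Gz; have [Pz|Pz] := pselect (Pol p z).
      have [k' [g [_ H]]] := (mm p (OO1 _ Op) i k).2 z Gz Pz.
      by apply: filterS H => w [].
    by apply: cvg_within; apply: filterS (nearD z Gz Pz) => w [].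
  have nPol' z : ~ Gamma a z -> \forall w \near ((z : C^o)^'), ~ Pol' p w.
    move=> Gz; have n1 := near_puncture z al1; have n2 := near_puncture z al2.
    by apply: filterS3 n1 n2 (nPol z Gz) => w w1 w2 wP [].
  have mer z l : ~ Gamma a z -> meromorphic_at (Pol' p) (fun w => m p w i l) z.
    move=> Gz; have [Pz|Pz] := pselect (Pol p z).
      have [k' [g [hg H]]] := (mm p (OO1 _ Op) i l).2 z Gz Pz.
      exists k', g; split=> //.
      by apply: filterS2 H (nPol' z Gz) => w [_ e] ?.
    apply: meromorphic_holo; first exact: nPol'.
    apply: filterS (nearD z Gz Pz) => w [Gw Pw].
    exact: (mm p (OO1 _ Op) i l).1.
  split=> z Gz Pz.
    have z1 : z <> al1 by move=> zE; apply: Pz; exact: Or32.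
    have z2 : z <> al2 by move=> zE; apply: Pz; exact: Or33.
    have Pz' : ~ Pol p z by move=> zP; apply: Pz; exact: Or31.
    apply: (@holomorphic_near R (fun lam => \sum_l m p lam i l *
        ((1%:M : M) l k - ((al1 - al2) * (1%:M - P p) l k) / (lam - al2)))).
      have /eqP z1' := z1; have /eqP z2' := z2.
      by apply: filterS2 (near_neq z1') (near_neq z2') => w /eqP w1 /eqP w2; rewrite invE.
    apply: holomorphic_sum => l.
    apply: (@holomorphicM R (fun w => m p w i l) _ z).
      exact: ((mm p (OO1 _ Op) i l).1 z Gz Pz').
    have zal : z - al2 != 0 by rewrite subr_eq0; apply/eqP.
    apply: (@holomorphicD R (fun=> (1%:M : M) l k)
      (fun w => - ((al1 - al2) * (1%:M - P p) l k / (w - al2))) z (@holomorphic_cst R _ z)).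
    under eq_fun do rewrite -mulNr.
    apply: (@holomorphicM R (fun=> _) (fun w => (w - al2)^-1) z (@holomorphic_cst R _ z)).
    exact: (@holomorphicV R (fun w => w - al2) z zal (@holomorphic_shift R al2 z)).
  have : meromorphic_at (Pol' p) (fun lam => \sum_l m p lam i l *
        ((1%:M : M) l k - ((al1 - al2) * (1%:M - P p) l k) / (lam - al2))) z.
    apply: meromorphic_sum; first exact: nPol'.
    move=> l; apply: meromorphicM; first exact: mer.
    by apply: meromorphic_pole; exact: nPol'.
  apply: eq_meromorphic.
  have n1 := near_puncture z al1; have n2 := near_puncture z al2.
  by apply: filterS2 n1 n2 => w w1 w2; rewrite invE.
- exists (fun k p => dressed_coef (dressing_root al1 al2 (P p)) al1 (mk^~ p) k) => p Op.
  have [mk0 mka uE] := mkP p (OO1 _ Op).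
  split=> //.
    apply: (@asymptotic_dressing _ _ _ _ (m p)).
    + have /asymptotic_atP/(_ 0%N)[K [r Kr]] := mka.
      exists (K * (norm1 (1%:M : M) + cnorm1 (al1 - al2) * 2 * norm1 (1%:M - P p))).
      exists (Num.max r (modulus al2 + 1)) => lam Gl Pl; rewrite ge_max => /andP[l3 l4].
      have l1 : lam <> al1 by move=> lE; apply: Pl; exact: Or32.
      have l2 : lam <> al2 by move=> lE; apply: Pl; exact: Or33.
      have [_ ->] := hE p lam Op l1 l2.
      have := Kr lam Gl (fun Pl' => Pl (Or31 _ _ Pl')) l3.
      rewrite big_ord0 subr0 expr0 invr1 mulr1 => mK.
      rewrite (le_trans (norm1M _ _))// ler_pM ?norm1_ge0//.
      rewrite (le_trans (norm1B _ _))// lerD// (le_trans (norm1Z _ _))//.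
      rewrite ler_wpM2r ?norm1_ge0// (le_trans (cnorm1M _ _))// ler_wpM2l ?cnorm1_ge0//.
      rewrite (le_trans (cnorm1_le_modulus _))// modulusV -[leRHS]mulr1 ler_wpM2l//.
      have : 1 <= modulus (lam - al2).
        rewrite -lecR -modulusE; apply: le_trans (lerB_dist _ _).
        rewrite !modulusE -rmorphB lecR; lra.
      by move=> h1; rewrite invf_le1//; exact: lt_le_trans h1.
    + move=> lam Gl Pl.
      have l1 : lam <> al1 by move=> lE; apply: Pl; exact: Or32.
      have l2 : lam <> al2 by move=> lE; apply: Pl; exact: Or33.
      have [hu _] := hE p lam Op l1 l2.
      have l1' : lam - al1 != 0 by rewrite subr_eq0; apply/eqP.
      have -> : lam%:M - dressing_root al1 al2 (P p) =
          (lam - al1) *: simple_element al1 al2 (P p) lam.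
        rewrite /simple_element /dressing_root scalerDr scalerA [(lam - al1) * _]mulrC divfK//.
        by apply/matrixP => r s; rewrite !mxE; ring.
      by rewrite -scalemxAr mulmxKV.
    + move=> N; have [K [r Kr]] := mka N; exists K, r => lam Gl Pl.
      by apply: Kr => // Pl'; apply: Pl; exact: Or31.
  rewrite /= mk0 mul1mx uE /bracket /dressing_root.
  move: (mk 1%N p) (P p) => X Y; mxring.
- move=> p lam Op Gl Pl0 Pl.
  have l1 : lam <> al1 by move=> lE; apply: Pl; exact: Or32.
  have l2 : lam <> al2 by move=> lE; apply: Pl; exact: Or33.
  have Pl0' : ~ Pol (0, 0) lam by move=> Pl'; apply: Pl0; exact: Or31.
  have Pl' : ~ Pol p lam by move=> Pl'; apply: Pl; exact: Or31.
  have [hu0 _] := hE (0, 0) lam O0 l1 l2.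
  have um0 : m (0, 0) lam \in unitmx by apply: um => //; exact: OO1.
  have -> : invmx (m (0, 0) lam *m invmx (simple_element al1 al2 (P (0, 0)) lam)) =
      simple_element al1 al2 (P (0, 0)) lam *m invmx (m (0, 0) lam).
    have XY : m (0, 0) lam *m invmx (simple_element al1 al2 (P (0, 0)) lam) *m
        (simple_element al1 al2 (P (0, 0)) lam *m invmx (m (0, 0) lam)) = 1%:M.
      by rewrite mulmxA mulmxKV// mulmxV.
    by have [] := invmx_eq XY.
  by rewrite tEE// -(mE p lam (OO1 _ Op) Gl Pl0' Pl') -P0 !mulmxA.
Qed.

End WaveFunction.

(** * The differential system of the projection *)

Section ProjectionSystem.
Context (R : realType) (n : nat).
Local Notation C := R[i].
Local Notation M := 'M[R[i]]_n.+1.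

Lemma bracket_expP (A B P : M) k : A *m P = P *m A ->
  bracket (B *m A ^+ k) P = bracket B P *m A ^+ k.
Proof.
move=> AP; apply: bracket_commP; elim: k => [|k IH]; first by rewrite mul1mx mulmx1.
by rewrite exprS -mulmxA IH mulmxA AP -mulmxA.
Qed.

Lemma dressing_root_comm (al1 al2 : C) (P : M) :
  dressing_root al1 al2 P *m P = P *m dressing_root al1 al2 P.
Proof. by rewrite /dressing_root; mxring. Qed.

Lemma projection_system_t (al1 al2 : C) (P : M) (q : nat -> M) j :
  let A := dressing_root al1 al2 P in
  - \sum_(k < j.+1) bracket (q (j - k)%N) P *m A ^+ k = bracket P (right_value A q j).
Proof.
move=> A; rewrite bracketC -right_value_sum bracket_suml; congr (- _).
apply: eq_bigr => k _; rewrite bracket_expP//; exact: dressing_root_comm.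
Qed.

Lemma projection_system_x (al1 al2 : C) (P a u : M) :
  let A := dressing_root al1 al2 P in
  - bracket u P - bracket a P *m A = bracket P (u + a *m A).
Proof.
move=> A; rewrite -bracket_commP; last exact: dressing_root_comm.
by rewrite /bracket; move: A => A; mxring.
Qed.

Lemma segment_bounded (O : set (R * R)) (F : R * R -> M) (v : R * R) :
  mxsmooth_on O F -> (forall s : R, 0 <= s <= 1 -> O (0 + s *: v)) ->
  exists k, forall s : R, 0 <= s <= 1 -> norm1 (F (0 + s *: v)) <= k.
Proof.
move=> sF Ov; pose g (s : R) := normsq (F (0 + s *: v)).
have cg : {within `[0, 1], continuous g}.
  apply: derivable_within_continuous => s; rewrite in_itv /= => s01.
  have [d _] := normsq_derive v (mxsmooth_on_diff sF (Ov s s01)).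
  by have [] := is_derive_line d.
have [c _ cmax] := EVT_max (@ler01 R) cg; exists (real_dim R n + g c) => s s01.
rewrite (le_trans (norm1_le_normsq _))// lerD2l; apply: cmax.
by rewrite in_itv.
Qed.

Lemma linear_unique (O : set (R * R)) (Y K1 K2 : R * R -> M) (v : R * R) :
  (forall s : R, 0 <= s <= 1 -> O (0 + s *: v)) ->
  mxsmooth_on O Y -> open O -> mxsmooth_on O K1 -> mxsmooth_on O K2 ->
  (forall p, O p -> Dx Y p = Y p *m K1 p) -> (forall p, O p -> Dt Y p = Y p *m K2 p) ->
  Y 0 = 0 -> Y v = 0.
Proof.
move=> Ov sY oO s1 s2 Y1 Y2 Y0.
have sK : mxsmooth_on O (fun p => mxform (K1 p) (K2 p) v).
  by apply: mxsmooth_onD => //; apply: mxsmooth_onZ.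
have [k kP] := segment_bounded sK Ov.
rewrite -[v]add0r; apply: (@mx_gronwall0 _ _ _ Y 0 v k) => // s s01.
  exact: mxsmooth_on_diff sY (Ov s s01).
rewrite mxderive_plane; last exact: mxsmooth_on_diff sY (Ov s s01).
rewrite (Y1 _ (Ov s s01)) (Y2 _ (Ov s s01)) -mxform_mull (le_trans (norm1M _ _))// mulrC.
by rewrite ler_wpM2r ?norm1_ge0// kP.
Qed.

Lemma right_value_smooth (O : set (R * R)) (A : R * R -> M) (q : nat -> R * R -> M) j :
  open O -> mxsmooth_on O A -> (forall k, mxsmooth_on O (q k)) ->
  mxsmooth_on O (fun p => right_value (A p) (q^~ p) j).
Proof.
move=> oO sA sq; elim: j => [|j IH] //=.
by apply: mxsmooth_onD => //; exact: mxsmooth_onM.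
Qed.

(** For a solution [f], both [(1 - pi) E1 f] and [pi E2 (1 - f)] solve linear
    systems with zero initial value, hence vanish along rays; so [f] maps into
    [E1^-1 V1] and [1 - f] into [E2^-1 V2]. *)
Lemma dressed_proj_unique (r : R) (a : M) (u : R * R -> M) (q : nat -> R * R -> M) j
    (E1 E2 f : R * R -> M) (al1 al2 : C) (pi : M) :
  let O := ball (0 : R * R) r in
  let A p := dressing_root al1 al2 (f p) in
  pi *m pi = pi -> mxsmooth_on O u -> (forall k, mxsmooth_on O (q k)) ->
  mxsmooth_on O E1 -> mxsmooth_on O E2 -> mxsmooth_on O f ->
  (forall p, O p -> E1 p \in unitmx) -> (forall p, O p -> E2 p \in unitmx) ->
  (forall p, O p -> dressing_frame pi (E1 p) (E2 p) \in unitmx) ->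
  (forall p, O p -> Dx E1 p = E1 p *m (al1 *: a + u p)) ->
  (forall p, O p -> Dx E2 p = E2 p *m (al2 *: a + u p)) ->
  (forall p, O p -> Dt E1 p = E1 p *m lampoly (q^~ p) j al1) ->
  (forall p, O p -> Dt E2 p = E2 p *m lampoly (q^~ p) j al2) ->
  E1 0 = 1%:M -> E2 0 = 1%:M ->
  (forall p, O p -> Dx f p = bracket (f p) (u p + a *m A p)) ->
  (forall p, O p -> Dt f p = bracket (f p) (right_value (A p) (q^~ p) j)) ->
  (forall p, O p -> f p *m f p = f p) -> f 0 = pi ->
  forall p, O p -> f p = dressed_proj pi (E1 p) (E2 p).
Proof.
move=> O A pipi su sq s1 s2 sf u1 u2 uS E1x E2x E1t E2t E10 E20 fx ft ff f0 p Op.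
have oO : open O by exact: ball_open.
have Ov (s : R) : 0 <= s <= 1 -> O (0 + s *: p).
  by move=> s01; rewrite add0r; exact: plane_ball_star.
have sA : mxsmooth_on O A.
  apply: mxsmooth_onD => //; first exact: mxsmooth_on_cst.
  exact: mxsmooth_onZ.
have saA : mxsmooth_on O (fun p => u p + a *m A p).
  by apply: mxsmooth_onD => //; apply: mxsmooth_onM => //; exact: mxsmooth_on_cst.
have sT := right_value_smooth j oO sA sq.
have eig p1 : O p1 -> A p1 *m f p1 = al1 *: f p1 /\
    A p1 *m (1%:M - f p1) = al2 *: (1%:M - f p1).
  by move=> Op1; have [e1 [e2 _]] := dressing_root_eigen al1 al2 (ff _ Op1).
have c1 (X : M) (p1 : R * R) : mxdifferentiable (fun=> X) p1 by exact: mxdifferentiable_cst.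
have DY v p1 (B1 T : M) : O p1 -> mxderive v E1 p1 = E1 p1 *m B1 ->
    mxderive v f p1 = bracket (f p1) T -> T *m f p1 = B1 *m f p1 ->
    mxderive v (fun p => (1%:M - pi) *m E1 p *m f p) p1 =
    (1%:M - pi) *m E1 p1 *m f p1 *m T.
  move=> Op1 e1 e2 e3; have dE := mxsmooth_on_diff s1 Op1; have df := mxsmooth_on_diff sf Op1.
  rewrite (mxderiveM _ (mxdifferentiableM (c1 _ p1) dE) df) (mxderiveM _ (c1 _ p1) dE).
  rewrite mxderive_cst mul0mx add0r e1 e2 /bracket.
  have -> : (1%:M - pi) *m (E1 p1 *m B1) *m f p1 = (1%:M - pi) *m E1 p1 *m (B1 *m f p1).
    by rewrite !mulmxA.
  by rewrite -e3; move: (1%:M - pi) (E1 p1) (f p1) => X1 X2 X3; mxring.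
have DZ v p1 (B2 T : M) : O p1 -> mxderive v E2 p1 = E2 p1 *m B2 ->
    mxderive v f p1 = bracket (f p1) T -> T *m (1%:M - f p1) = B2 *m (1%:M - f p1) ->
    mxderive v (fun p => pi *m E2 p *m (1%:M - f p)) p1 =
    pi *m E2 p1 *m (1%:M - f p1) *m T.
  move=> Op1 e1 e2 e3; have dE := mxsmooth_on_diff s2 Op1; have df := mxsmooth_on_diff sf Op1.
  have dN : mxdifferentiable (fun p => 1%:M - f p) p1 by exact: mxdifferentiableB.
  rewrite (mxderiveM _ (mxdifferentiableM (c1 _ p1) dE) dN) (mxderiveM _ (c1 _ p1) dE).
  rewrite (mxderiveB _ (c1 _ p1) df) !mxderive_cst mul0mx !add0r e1 e2 /bracket.
  have -> : pi *m (E2 p1 *m B2) *m (1%:M - f p1) = pi *m E2 p1 *m (B2 *m (1%:M - f p1)).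
    by rewrite !mulmxA.
  by rewrite -e3; move: (E2 p1) (f p1) => X2 X3; mxring.
have Tx1 p1 : O p1 -> (u p1 + a *m A p1) *m f p1 = (al1 *: a + u p1) *m f p1.
  move=> Op1; have [e _] := eig _ Op1.
  by rewrite mulmxDl -mulmxA e -scalemxAr addrC scalemxAl -mulmxDl.
have Tx2 p1 : O p1 -> (u p1 + a *m A p1) *m (1%:M - f p1) = (al2 *: a + u p1) *m (1%:M - f p1).
  move=> Op1; have [_ e] := eig _ Op1.
  by rewrite mulmxDl -mulmxA e -scalemxAr addrC scalemxAl -mulmxDl.
have Y0 : (1%:M - pi) *m E1 p *m f p = 0.
  apply: (linear_unique (O := O) (Y := fun p => (1%:M - pi) *m E1 p *m f p)
    (K1 := fun p => u p + a *m A p) (K2 := fun p => right_value (A p) (q^~ p) j) Ov) => //.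
  - apply: mxsmooth_onM => //; apply: mxsmooth_onM => //; exact: mxsmooth_on_cst.
  - move=> p1 Op1; exact: (DY _ _ _ _ Op1 (E1x _ Op1) (fx _ Op1) (Tx1 _ Op1)).
  - move=> p1 Op1; apply: (DY _ _ _ _ Op1 (E1t _ Op1) (ft _ Op1)).
    by apply: right_value_eigen; have [] := eig _ Op1.
  - by rewrite E10 f0 mulmx1 mulmxBl mul1mx pipi subrr.
have Z0 : pi *m E2 p *m (1%:M - f p) = 0.
  apply: (linear_unique (O := O) (Y := fun p => pi *m E2 p *m (1%:M - f p))
    (K1 := fun p => u p + a *m A p) (K2 := fun p => right_value (A p) (q^~ p) j) Ov) => //.
  - apply: mxsmooth_onM => //; first by apply: mxsmooth_onM => //; exact: mxsmooth_on_cst.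
    by apply: mxsmooth_onB => //; exact: mxsmooth_on_cst.
  - move=> p1 Op1; exact: (DZ _ _ _ _ Op1 (E2x _ Op1) (fx _ Op1) (Tx2 _ Op1)).
  - move=> p1 Op1; apply: (DZ _ _ _ _ Op1 (E2t _ Op1) (ft _ Op1)).
    by apply: right_value_eigen; have [] := eig _ Op1.
  - by rewrite E20 f0 mulmx1 mulmxBr mulmx1 pipi subrr.
have [v1 v2 vS] := And3 (u1 _ Op) (u2 _ Op) (uS _ Op).
set P := dressed_proj _ _ _; set S := dressing_frame pi (E1 p) (E2 p) in vS.
have PS : P *m S = S *m pi by exact: dressed_proj_frame.
have PNS : (1%:M - P) *m S = S *m (1%:M - pi) by exact: dressed_projN_frame.
have fE : f p = S *m pi *m (E1 p *m f p).
  rewrite (frame_pi _ _ pipi) -!mulmxA; apply: (can_inj (mulKmx v1)); rewrite mulKVmx//.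
  by apply/eqP; rewrite -subr_eq0 -Y0 mulmxBl mul1mx mulmxBl mulmxA.
have gE : 1%:M - f p = S *m (1%:M - pi) *m (E2 p *m (1%:M - f p)).
  rewrite (frame_npi _ _ pipi) -!mulmxA; apply: (can_inj (mulKmx v2)); rewrite mulKVmx//.
  apply/eqP; rewrite -subr_eq0 -Z0 [(1%:M - pi) *m _]mulmxBl mul1mx.
  by rewrite opprB addrCA subrr addr0 mulmxA.
have Pf : P *m f p = f p.
  apply/eqP; rewrite eq_sym -subr_eq0 -{1}[f p]mul1mx -mulmxBl fE !mulmxA PNS.
  by rewrite -[S *m (1%:M - pi) *m pi]mulmxA [(1%:M - pi) *m pi]mulmxBl mul1mx pipi subrr mulmx0 !mul0mx.
have PN : P *m (1%:M - f p) = 0.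
  rewrite gE !mulmxA PS -[S *m pi *m (1%:M - pi)]mulmxA [pi *m (1%:M - pi)]mulmxBr mulmx1 pipi subrr.
  by rewrite mulmx0 !mul0mx.
by move: PN; rewrite mulmxBr mulmx1 Pf => /eqP; rewrite subr_eq0 => /eqP.
Qed.

End ProjectionSystem.

(** * The dressing theorem *)

Section Assembly.
Context (R : realType) (n : nat).
Local Notation C := R[i].
Local Notation M := 'M[R[i]]_n.+1.

Lemma holomorphic_mx_conj (X Y : M) (D : C -> M) i k lam :
  (forall r s, holomorphic_at (fun z => D z r s) lam) ->
  holomorphic_at (fun z => (X *m D z *m Y) i k) lam.
Proof.
move=> hD.
rewrite (_ : (fun z => _) = fun z => \sum_s (\sum_r X i r * D z r s) * Y s k); last first.
  by apply/funext => z; rewrite mxE; apply: eq_bigr => s _; rewrite mxE.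
apply: holomorphic_sum => s.
apply: (@holomorphicM R (fun z => \sum_r X i r * D z r s) (fun=> Y s k) lam _ (@holomorphic_cst R _ lam)).
apply: holomorphic_sum => r.
exact: (@holomorphicM R (fun=> X i r) (fun z => D z r s) lam (@holomorphic_cst R _ lam) (hD r s)).
Qed.

Lemma holomorphic_dressed (al1 al2 : C) (pi P : M) (E d1 d2 : C -> M) i k lam :
  (forall r s, holomorphic_at (fun z => E z r s) lam) ->
  (forall r s, holomorphic_at (fun z => d1 z r s) lam) ->
  (forall r s, holomorphic_at (fun z => d2 z r s) lam) ->
  holomorphic_at (fun z => dressed_triv al1 al2 pi (E z) (d1 z) (d2 z) P i k) lam.
Proof.
move=> hE h1 h2; have c0 c := @holomorphic_cst R c lam.
have H1 := @holomorphic_mx_conj (1%:M - pi) P d1 i k lam h1.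
have H2 := @holomorphic_mx_conj pi (1%:M - P) d2 i k lam h2.
rewrite (_ : (fun z => _) = fun z => E z i k + ((al1 - al2) * ((1%:M - pi) *m d1 z *m P) i k
   + - (al1 - al2) * (pi *m d2 z *m (1%:M - P)) i k)); last first.
  apply/funext => z; rewrite /dressed_triv; move: (_ *m P) (_ *m (1%:M - P)) => X Y.
  by rewrite !mxE; ring.
pose f1 z := (al1 - al2) * ((1%:M - pi) *m d1 z *m P) i k.
pose f2 z := - (al1 - al2) * (pi *m d2 z *m (1%:M - P)) i k.
have F1 : holomorphic_at f1 lam.
  exact: (@holomorphicM R (fun=> al1 - al2) (fun z => ((1%:M - pi) *m d1 z *m P) i k) lam (c0 _) H1).
have F2 : holomorphic_at f2 lam.
  exact: (@holomorphicM R (fun=> - (al1 - al2)) (fun z => (pi *m d2 z *m (1%:M - P)) i k) lam (c0 _) H2).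
exact: (@holomorphicD R (fun z => E z i k) (fun z => f1 z + f2 z) lam (hE i k)
  (@holomorphicD R f1 f2 lam F1 F2)).
Qed.

(** The coefficients of the connection form [lam a + u], so that the two
    directions are treated alike. *)
Definition x_coef (a : M) (u : R * R -> M) (k : nat) : R * R -> M :=
  if k is 0%N then fun=> a else u.

Lemma x_coef_lampoly (a : M) (u : R * R -> M) p lam :
  lampoly ((x_coef a u)^~ p) 1 lam = lam *: a + u p.
Proof. by rewrite lampolyS lampoly0. Qed.

Lemma x_coef_ddlampoly (a : M) (u : R * R -> M) p al lam :
  ddlampoly ((x_coef a u)^~ p) 1 al lam = a.
Proof.
rewrite ddlampolyS lampoly0 /ddlampoly big_ord1 /ddpow big_ord0 scale0r scaler0 add0r.
by [].
Qed.

End Assembly.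

Theorem mainTheorem1 (R : realType) (n : nat) (a b : 'M[R[i]]_n.+1) (j : nat)
    (Q : nat -> 'M[diffpoly R n]_n.+1)
    (O1 O2 : set (R * R)) (u : R * R -> 'M[R[i]]_n.+1)
    (E m : R * R -> R[i] -> 'M[R[i]]_n.+1)
    (al1 al2 : R[i]) (pi : 'M[R[i]]_n.+1) :
  is_diag_mx a -> sl a -> a <> 0 ->
  (exists q : {poly R[i]}, b = horner_mx a q) ->
  (1 <= j)%N ->
  is_Q a b Q ->
  open O1 -> O1 (0, 0) ->
  flow_solution a Q j O1 u ->
  open O2 -> O2 (0, 0) -> O2 `<=` O1 ->
  trivialization a Q j O2 u E ->
  reduced_wave_function a b j O2 u E m ->
  pi *m pi = pi ->
  let V1 := column_space pi in
  let V2 := column_space (1%:M - pi) in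
  let tV1 := fun p => map_subspace (invmx (E p al1)) V1 in
  let tV2 := fun p => map_subspace (invmx (E p al2)) V2 in
  let tpi := fun p => projection_on_along (tV1 p) (tV2 p) in
  let tu := fun p => u p + (al1 - al2) *: bracket a (tpi p) in
  let tm := fun p lam => m p lam *m invmx (simple_element al1 al2 (tpi p) lam) in
  exists O : set (R * R),
    [/\ open O, O (0, 0), O `<=` O2 &
        forall p, O p ->
          (tV1 p :&: tV2 p)%MS = 0 /\ (tV1 p + tV2 p :=: 1%:M)%MS] /\
    (flow_solution a Q j O tu /\
     exists tE : R * R -> R[i] -> 'M[R[i]]_n.+1,
       [/\ trivialization a Q j O tu tE,
           forall p lam, O p -> lam <> al1 -> lam <> al2 ->
             tE p lam =
             simple_element al1 al2 pi lam *m E p lam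
               *m invmx (simple_element al1 al2 (tpi p) lam) &
           reduced_wave_function a b j O tu tE tm]) /\
    (projection_system a Q j O u al1 al2 pi tpi /\
     forall f, projection_system a Q j O u al1 al2 pi f ->
       forall p, O p -> f p = tpi p).
Proof.
move=> da _ _ [qb bq] j1 QP oO1 O10 [su pu ut] oO2 O20 O21 [Es Eh Ex Et E0] wf pipi.
move=> V1 V2 tV1 tV2 tpi tu tm.
pose q k := mxdp (Q k) u.
have su2 : mxsmooth_on O2 u by exact: mxsmooth_on_sub su.
have sq2 k : mxsmooth_on O2 (q k) by exact: mxdp_smooth.
have [r1 [r10 r11 r1P [dq1 [[d1E d10] d1s d1h d1x d1t]]]] :=
  divided_difference al1 oO2 O20 sq2 Es Eh Ex Et E0.
have [r2 [r20 r21 r2P [dq2 [[d2E d20] d2s d2h d2x d2t]]]] :=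
  divided_difference al2 oO2 O20 sq2 Es Eh Ex Et E0.
pose E1 p := E p al1; pose E2 p := E p al2.
pose r12 := Num.min r1 r2.
have sub1 p : ball (0 : R * R) r12 p -> ball (0 : R * R) r1 p.
  by move=> /plane_ballE; rewrite lt_min => /andP[? _]; exact/plane_ballE.
have sub2 p : ball (0 : R * R) r12 p -> ball (0 : R * R) r2 p.
  by move=> /plane_ballE; rewrite lt_min => /andP[_ ?]; exact/plane_ballE.
have r120 : 0 < r12 by rewrite lt_min r10.
have [r [r0 _ rP]] : exists r : R, [/\ 0 < r, r <= 1 & forall p, ball (0 : R * R) r p ->
    ball (0 : R * R) r12 p /\ dressing_frame pi (E1 p) (E2 p) \in unitmx].
  apply: near_plane_ball; apply: filterS2.
  - by move=> p h1 h2; split; [exact: h1|exact: h2].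
  - by apply: open_nbhs_nbhs; split; [exact: ball_open|exact: ballxx].
  - apply: (@near_unit _ _ (ball (0 : R * R) r12)); [exact: ball_open|exact: ballxx| |].
      apply: frame_smooth; first exact: ball_open.
      + by move=> p /sub1/r1P[].
      + by move=> p /sub2/r2P[].
      + by apply: mxsmooth_on_sub (Es al1) => p /sub1/r1P[].
      + by apply: mxsmooth_on_sub (Es al2) => p /sub1/r1P[].
    by rewrite /dressing_frame /E1 /E2 !E0 invmx1 !mul1mx addrC subrK.
pose O := ball (0 : R * R) r.
have oO : open O by exact: ball_open.
have O0 : O (0, 0) by exact: ballxx.
have OO2 p : O p -> O2 p by move=> /rP[/sub1/r1P[]].
have OO1 p : O p -> O1 p by move=> /OO2; exact: O21.
have Ob1 p : O p -> ball (0 : R * R) r1 p by move=> /rP[/sub1].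
have Ob2 p : O p -> ball (0 : R * R) r2 p by move=> /rP[/sub2].
have uE1 p : O p -> E1 p \in unitmx by move=> /rP[/sub1/r1P[]].
have uE2 p : O p -> E2 p \in unitmx by move=> /rP[/sub2/r2P[]].
have uS p : O p -> dressing_frame pi (E1 p) (E2 p) \in unitmx by move=> /rP[].
have sE lam : mxsmooth_on O (fun p => E p lam) by exact: mxsmooth_on_sub (Es lam).
have suO : mxsmooth_on O u by exact: mxsmooth_on_sub su2.
have sq k : mxsmooth_on O (q k) by exact: mxsmooth_on_sub (sq2 k).
have puO p : O p -> sl_perp a (u p) by move=> /OO1/pu.
have tpiE p : O p -> tpi p = dressed_proj pi (E1 p) (E2 p).
  by move=> Op; apply: projection_on_alongE => //; exact: uS.
have PP p : O p -> tpi p *m tpi p = tpi p.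
  by move=> Op; rewrite !tpiE//; apply: dressed_proj_idem => //; exact: uS.
have sP : mxsmooth_on O tpi.
  apply: (eq_mxsmooth_on oO (F := fun p => dressed_proj pi (E1 p) (E2 p))).
    by move=> p Op; rewrite tpiE.
  exact: (dressed_proj_smooth oO uE1 uE2 uS (sE al1) (sE al2)).
have tpi0 : tpi (0, 0) = pi.
  rewrite tpiE// /dressed_proj /dressing_frame /E1 /E2 !E0 invmx1 !mul1mx.
  by rewrite [pi + _]addrC subrK mul1mx invmx1 mulmx1.
pose A p := dressing_root al1 al2 (tpi p).
have eig p : O p -> A p *m tpi p = al1 *: tpi p /\
    A p *m (1%:M - tpi p) = al2 *: (1%:M - tpi p).
  by move=> Op; have [e1 [e2 _]] := dressing_root_eigen al1 al2 (PP p Op).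
have sA : mxsmooth_on O A.
  apply: mxsmooth_onD => //; first exact: mxsmooth_on_cst.
  exact: mxsmooth_onZ.
(* The directions [x] and [t] differ only in the connection polynomial. *)
have Dtpi v p (c : nat -> 'M[R[i]]_n.+1) d : O p ->
    mxderive v E1 p = E1 p *m lampoly c d al1 -> mxderive v E2 p = E2 p *m lampoly c d al2 ->
    mxderive v tpi p = bracket (tpi p) (right_value (A p) c d).
  move=> Op e1 e2.
  have -> : mxderive v tpi p = mxderive v (fun p => dressed_proj pi (E1 p) (E2 p)) p.
    by apply: (eq_on_mxderive oO v _ Op) => p1 Op1; rewrite tpiE.
  have [g1 g2] := eig p Op; rewrite tpiE// in g1 g2 *.
  apply: (dressed_proj_derive (B1 := lampoly c d al1) (B2 := lampoly c d al2)
    oO pipi uE1 uE2 uS (sE al1) (sE al2) Op e1 e2); exact: right_value_eigen.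
have DxE lam p : O p -> Dx (fun p => E p lam) p =
    E p lam *m lampoly ((x_coef a u)^~ p) 1 lam.
  by move=> Op; rewrite x_coef_lampoly; exact: Ex (OO2 _ Op).
have DtE lam p : O p -> Dt (fun p => E p lam) p = E p lam *m lampoly (q^~ p) j lam.
  by move=> Op; exact: Et (OO2 _ Op).
have Dxtpi p : O p -> Dx tpi p = bracket (tpi p) (u p + a *m A p).
  move=> Op; rewrite /Dx (Dtpi _ _ ((x_coef a u)^~ p) 1%N Op (DxE al1 p Op) (DxE al2 p Op)).
  by rewrite /= addrC.
have Dttpi p : O p -> Dt tpi p = bracket (tpi p) (right_value (A p) (q^~ p) j).
  by move=> Op; exact: (Dtpi _ _ (q^~ p) j Op (DtE al1 p Op) (DtE al2 p Op)).
have brA X p : bracket X (A p) = (al1 - al2) *: bracket X (tpi p).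
  by rewrite /A /dressing_root /bracket; move: (tpi p) => Y; mxring.
have tuE p : tu p = u p + bracket a (A p) by rewrite brA.
have stu : mxsmooth_on O tu.
  apply: mxsmooth_onD => //; apply: mxsmooth_onZ => //.
  by apply: mxsmooth_onB => //; apply: mxsmooth_onM => //; exact: mxsmooth_on_cst.
have ptu p : O p -> sl_perp a (tu p).
  move=> Op; have /(sl_perpP _ da) u0 := puO p Op; apply/(sl_perpP _ da) => i k ik.
  rewrite mxE u0// add0r mxE bracketC mxE bracket_diagE// ik subrr mulr0 oppr0 mulr0//.
have laxq p : O p -> lax a u q p by exact: (Q_lax bq QP oO suO puO).
have q0E p : O p -> q 0%N p = b by move=> Op; have [e _] := QP.2 O u oO suO puO p Op; exact: e.
(* The conjugated series is the series of the [Q k] for [tu]. *)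
have QtuE k p : O p -> dressed (A p) (q^~ p) k = mxdp (Q k) tu p.
  move: k p; apply: (Q_unique da bq QP oO stu ptu (X := fun k p => dressed (A p) (q^~ p) k)).
  - exact: q0E.
  - move=> p k Op; have [l1 l2] := laxq p Op.
    rewrite tuE; apply: dressed_lax => //.
    + exact: mxsmooth_on_diff sA Op.
    + by move=> k'; exact: mxsmooth_on_diff (sq k') Op.
    + rewrite (_ : Dx (q 0%N) p = Dx (cst b) p); first exact: mxderive_cst.
      exact: (eq_on_mxderive oO _ q0E Op).
    + have dP := mxsmooth_on_diff sP Op; have c1 (X : 'M[R[i]]_n.+1) := mxdifferentiable_cst X p.
      rewrite /A /dressing_root /Dx (mxderiveD _ (c1 _) (mxdifferentiableZ _ dP)).
      rewrite mxderive_cst add0r mxderiveZ//.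
      have := Dxtpi p Op; rewrite /Dx => ->; rewrite /A /dressing_root /bracket.
      by move: (tpi p) (u p) => Y Z; mxring.
  - move=> p k Op; apply: (gauge_zero (A := A p) (X := root_prod (diag_seq b) (dressed (A p) (q^~ p)))).
    have -> : (fun=> 0) = root_prod (diag_seq b) (q^~ p).
      by apply/funext => l; rewrite (root_prod_Q da bq QP _ oO suO puO Op).
    by apply: gauge_root_prod; exact: gauge_dressed.
pose tE p lam := dressed_triv al1 al2 pi (E p lam) (dq1 p lam) (dq2 p lam) (tpi p).
have K1 p : O p -> (1%:M - pi) *m E1 p *m tpi p = 0.
  by move=> Op; rewrite tpiE//; apply: dressed_proj_ker1 => //; exact: uE1.
have K2 p : O p -> pi *m E2 p *m (1%:M - tpi p) = 0.
  by move=> Op; rewrite tpiE//; apply: dressed_proj_ker2 => //; [exact: uE2|exact: uS].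
have tEE p lam : O p -> lam <> al1 -> lam <> al2 -> tE p lam =
    simple_element al1 al2 pi lam *m E p lam *m invmx (simple_element al1 al2 (tpi p) lam).
  move=> Op /eqP l1 /eqP l2.
  rewrite /tE; apply: (dressed_trivE (PP p Op) (d1E _ _ (Ob1 _ Op)) (d2E _ _ (Ob2 _ Op))) => //.
  - exact: K1.
  - exact: K2.
have sd1 lam : mxsmooth_on O (fun p => dq1 p lam) by exact: mxsmooth_on_sub (d1s lam).
have sd2 lam : mxsmooth_on O (fun p => dq2 p lam) by exact: mxsmooth_on_sub (d2s lam).
have DtE' v p (c : nat -> 'M[R[i]]_n.+1) d lam : O p ->
    mxderive v (fun p => E p lam) p = E p lam *m lampoly c d lam ->
    mxderive v (fun p => dq1 p lam) p = dq1 p lam *m lampoly c d al1 + E p lam *m ddlampoly c d al1 lam ->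
    mxderive v (fun p => dq2 p lam) p = dq2 p lam *m lampoly c d al2 + E p lam *m ddlampoly c d al2 lam ->
    mxderive v tpi p = bracket (tpi p) (right_value (A p) c d) ->
    mxderive v (fun p => tE p lam) p = tE p lam *m lampoly (dressed (A p) c) d lam.
  move=> Op e1 e2 e3 e4.
  apply: (dressed_triv_derive (mxsmooth_on_diff (sE lam) Op) (mxsmooth_on_diff (sd1 lam) Op)
    (mxsmooth_on_diff (sd2 lam) Op) (mxsmooth_on_diff sP Op) e1 e2 e3 e4 (PP p Op)
    (d1E _ _ (Ob1 _ Op)) (d2E _ _ (Ob2 _ Op))).
  - exact: K1.
  - exact: K2.
have systx p : O p -> Dx tpi p = - bracket (u p) (tpi p) - bracket a (tpi p) *m A p.
  by move=> Op; rewrite projection_system_x Dxtpi.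
have systt p : O p -> Dt tpi p =
    - \sum_(k < j.+1) bracket (q (j - k)%N p) (tpi p) *m A p ^+ k.
  by move=> Op; rewrite (projection_system_t _ _ _ (q^~ p)) Dttpi.
exists O; split.
  split=> // p Op; split.
    by apply: dressed_subspaces_cap => //; exact: uS.
  by apply: dressed_subspaces_add => //; exact: uS.
split; last first.
  split; first by split.
  move=> f [sf fx ft ff f0] p Op; rewrite tpiE//.
  apply: (dressed_proj_unique (r := r) (u := u) (q := q) (j := j) (a := a)
    (al1 := al1) (al2 := al2) pipi) => //.
  - exact: sE.
  - exact: sE.
  - by move=> p1 Op1; exact: Ex (OO2 _ Op1).
  - by move=> p1 Op1; exact: Ex (OO2 _ Op1).
  - by move=> p1 Op1; exact: DtE.
  - by move=> p1 Op1; exact: DtE.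
  - exact: E0.
  - exact: E0.
  - by move=> p1 Op1; rewrite -projection_system_x fx.
  - by move=> p1 Op1; rewrite -(projection_system_t _ _ _ (q^~ p1)) ft.
split.
  split=> // p Op.
  have [_ /(_ j) QE] := QP.2 O tu oO stu ptu p Op; rewrite QE -QtuE//=.
  have dP := mxsmooth_on_diff sP Op; have du := mxsmooth_on_diff suO Op.
  have da1 := mxdifferentiable_cst a p.
  have dbr : mxdifferentiable (fun p => bracket a (tpi p)) p.
    by apply: mxdifferentiableB; apply: mxdifferentiableM.
  rewrite /tu /Dt (mxderiveD _ du (mxdifferentiableZ _ dbr)) mxderiveZ//.
  rewrite /bracket (mxderiveB _ (mxdifferentiableM da1 dP) (mxdifferentiableM dP da1)).
  rewrite (mxderiveM _ da1 dP) (mxderiveM _ dP da1) mxderive_cst mul0mx mulmx0 add0r addr0.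
  have := Dttpi p Op; rewrite /Dt => ->.
  have := ut p (OO1 _ Op); rewrite /Dt => ->.
  have [_ /(_ j) ->] := QP.2 O u oO suO puO p Op.
  rewrite -/(q j.+1 p) -/(bracket (right_value (A p) (q^~ p) j) (A p)) brA /bracket.
  by move: (right_value _ _ _) (q j.+1 p) (tpi p) => T X Y; rewrite /cst; mxring.
exists tE; split; [|exact: tEE|]; last first.
  apply: (dressed_wave_function (pi := pi) wf) => //; exact: OO2.
split.
- move=> lam; apply: mxsmooth_onD => //; apply: mxsmooth_onZ => //.
  have cs (X : 'M[R[i]]_n.+1) : mxsmooth_on O (fun=> X) by exact: mxsmooth_on_cst.
  apply: mxsmooth_onB => //; apply: mxsmooth_onM => //; try exact: mxsmooth_onM.
  exact: mxsmooth_onB.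
- move=> p Op i k lam; apply: holomorphic_dressed => r' s.
  + exact: Eh (OO2 _ Op) _ _ _.
  + exact: d1h (Ob1 _ Op) _ _ _.
  + exact: d2h (Ob2 _ Op) _ _ _.
- move=> p lam Op.
  have := @DtE' (1, 0) p ((x_coef a u)^~ p) 1%N lam Op (DxE lam p Op).
  rewrite !x_coef_lampoly !x_coef_ddlampoly.
  move=> /(_ (d1x _ _ (Ob1 _ Op)) (d2x _ _ (Ob2 _ Op))).
  rewrite /= {1}addrC => /(_ (Dxtpi p Op)); rewrite /Dx => ->.
  by rewrite lampolyS lampoly0 tuE.
- move=> p lam Op.
  have := DtE' (0, 1) p (q^~ p) j lam Op (DtE lam p Op) (d1t _ _ (Ob1 _ Op))
    (d2t _ _ (Ob2 _ Op)) (Dttpi p Op); rewrite /Dt => ->.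
  by congr (_ *m _); apply: eq_bigr => k _; rewrite QtuE.
- move=> lam; rewrite /tE /dressed_triv d10 d20 !mulmx0 !mul0mx subrr scaler0 addr0.
  exact: E0.
Qed.
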